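(* Let $F$ be a quadratic form in $N$ variables over $\overline{\mathbb Q}$, let $V$ be an $L$-dimensional subspace of $\overline{\mathbb Q}^N$, let $r$ be the rank of $F$ on $V$, assume $r \geq 1$, and put $\lambda = L-r$. Let $m$ be the dimension of a maximal totally isotropic subspace of the quadratic space $(V,F)$. Let $J \geq 1$ be an integer and, for each $1 \leq i \leq J$, let $k_i \geq 1$ be an integer and let $P_{i1},\dots,P_{ik_i} \in \overline{\mathbb Q}[X_1,\dots,X_N]$ be homogeneous polynomials of respective degrees $m_{i1},\dots,m_{ik_i} \geq 1$. Let $$\mathcal Z = \bigcup_{i=1}^J \{ \boldsymbol x \in \overline{\mathbb Q}^N : P_{i1}(\boldsymbol x) = \dots = P_{ik_i}(\boldsymbol x) = 0 \}, \qquad M = \sum_{i=1}^J \max_{1 \leq j \leq k_i} m_{ij}.$$ Suppose that $F$ has a nontrivial zero in $V \setminus \mathcal Z$. Then there exist $m$ linearly independent zeros $\boldsymbol x_1,\dots,\boldsymbol x_m$ of $F$ in $V \setminus \mathcal Z$ such that $$H(\boldsymbol x_1) \leq H(\boldsymbol x_2) \leq \dots \leq H(\boldsymbol x_m), \qquad h(\boldsymbol x_1) \leq h(\boldsymbol x_2) \leq \dots \leq h(\boldsymbol x_m),$$ and for each $1 \leq n \leq m$, $$H(\boldsymbol x_n) \leq h(\boldsymbol x_n) \leq T(L,M+1)\, H(F)^{\max\{r,29/2\}}\, \mathcal H(V)^{30},$$ where $$T(L,M) = 3^{18(L-\lambda) + \frac{18L(L-1)}{L-\lambda} + \frac{33L(L-1)}{4}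 + 3} L^{51}.$$ (The expression for $T(L,M)$ depends on $\lambda$ and does not involve $M$ explicitly.)
   Context: Heights. Let $K$ be a number field of degree $d=[K:\mathbb Q]$ with set of places $M(K)$. For $v \in M(K)$ let $d_v=[K_v:\mathbb Q_v]$ be the local degree and $|\cdot|_v$ the absolute value on $K_v$ extending the usual absolute value on $\mathbb R$ (if $v\mid\infty$) or the usual $p$-adic absolute value on $\mathbb Q_p$ (if $v\mid p$). For $\boldsymbol x=(x_1,\dots,x_N)\in K_v^N$ put $H_v(\boldsymbol x)=\max_i |x_i|_v^{d_v}$, and for $v\mid\infty$ also $\mathcal H_v(\boldsymbol x)=\left(\sum_i |x_i|_v^2\right)^{d_v/2}$. For nonzero $\boldsymbol x\in K^N$ put $$H(\boldsymbol x)=\Big(\prod_{v\in M(K)}H_v(\boldsymbol x)\Big)^{1/d},\qquad \mathcal H(\boldsymbol x)=\Big(\prod_{v\nmid\infty}H_v(\boldsymbol x)\prod_{v\mid\infty}\mathcal H_v(\boldsymbol x)\Big)^{1/d},$$ and for $\boldsymbol x \in K^N$ put $h(\boldsymbol x)=H(1,\boldsymbol x)$. These do not depend on the choice of a number field $K$ containing the coordinates, so they are defined over $\overline{\mathbb Q}$. For an $L$-dimensional subspace $V\subseteq\overline{\mathbb Q}^N$ with basis $\boldsymbol v_1,\dots,\boldsymbol v_L$, $\mathcal H(V)=\mathcal H(\boldsymbol v_1\wedge\dots\wedge\boldsymbol v_L)$, i.e. $\mathcal H$ of the vector of $L\times L$ minors of the basis matrix; this is independent of the basis. Quadratic forms.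 A quadratic form is $F(\boldsymbol X)=F(\boldsymbol X,\boldsymbol X)$, where $F(\boldsymbol X,\boldsymbol Y)=\sum_{i,j=1}^N f_{ij}X_iY_j$, $f_{ij}=f_{ji}\in\overline{\mathbb Q}$, is a symmetric bilinear form; $H(F)$ is the height $H$ of the symmetric coefficient matrix $(f_{ij})$ regarded as a vector. For a subspace $V$, $(V,F)$ is the corresponding quadratic space; its radical is $V^\perp=\{\boldsymbol x\in V: F(\boldsymbol x,\boldsymbol y)=0\ \forall\,\boldsymbol y\in V\}$, $\lambda=\dim V^\perp$, and the rank of $F$ on $V$ is $r=\dim V-\lambda$. A subspace $W\subseteq V$ is totally isotropic if $F(\boldsymbol x,\boldsymbol y)=0$ for all $\boldsymbol x,\boldsymbol y\in W$; all maximal totally isotropic subspaces of $(V,F)$ have the same dimension. *)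

(* Defs.v *)
From HB Require Import structures.
From mathcomp Require Import all_boot all_order all_algebra all_field.
From mathcomp Require Import boolp classical_sets fsbigop reals exp.
From mathcomp Require Import -(notations) mpoly.

Set Implicit Arguments.
Unset Strict Implicit.
Unset Printing Implicit Defensive.

Import Order.TTheory GRing.Theory Num.Theory.
Local Open Scope classical_set_scope.
Local Open Scope ring_scope.

(* mpoly is imported without its notations, which clash with those of
   mathcomp-analysis. *)
Notation "{ 'mpoly' T [ n ] }" := (mpoly n T)
  (at level 0, T at level 2, n at level 2, format "{ 'mpoly'  T [ n ] }").

Section Places.
Variable R : realType.

Definition is_absolute_value (K : fieldType) (v : K -> R) : Prop :=
  [/\ forall x, 0 <= v x,
      forall x, v x = 0 <-> x = 0,
      forall x y, v (x * y) = v x * v y &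
      forall x y, v (x + y) <= v x + v y].

Definition padic_abs (p : nat) (q : rat) : R :=
  if q == 0 then 0
  else p%:R ^ ((logn p `|denq q|%N)%:Z - (logn p `|numq q|%N)%:Z).

(* Every place has exactly one representative extending the usual absolute
   value or a p-adic one on Q; a place is identified with that absolute
   value. *)
Definition infinite_places (K : fieldExtType rat) : set (K -> R) :=
  [set v | is_absolute_value v /\ forall q : rat, v q%:A = `|ratr q|].

Definition finite_places (K : fieldExtType rat) : set (K -> R) :=
  [set v | is_absolute_value v /\
     exists2 p : nat, prime p & forall q : rat, v q%:A = padic_abs p q].

Definition places (K : fieldExtType rat) : set (K -> R) :=
  @finite_places K `|` @infinite_places K.

(* (Kv, w) is a completion of (K, v) along iota. *)
Definition is_completion (K : fieldType) (v : K -> R)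
    (Kv : fieldType) (w : Kv -> R) (iota : {rmorphism K -> Kv}) : Prop :=
  [/\ is_absolute_value w,
      forall x, w (iota x) = v x,
      forall (y : Kv) (e : R), 0 < e -> exists x : K, w (y - iota x) < e &
      forall u : nat -> Kv,
        (forall e : R, 0 < e -> exists n0 : nat, forall m n : nat,
           (n0 <= m)%N -> (n0 <= n)%N -> w (u m - u n) < e) ->
        exists l : Kv, forall e : R, 0 < e -> exists n0 : nat, forall n : nat,
           (n0 <= n)%N -> w (u n - l) < e].

(* The closure of Q in K_v, that is, the copy of Q_v inside K_v. *)
Definition rat_closure (Kv : fieldType) (w : Kv -> R) : set Kv :=
  [set y | forall e : R, 0 < e -> exists q : rat, w (y - ratr q) < e].

(* n = [K_v : Q_v]. Completions are unique up to isometric isomorphism over K,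
   so n does not depend on the one chosen. *)
Definition is_local_degree (K : fieldExtType rat) (v : K -> R) (n : nat) :
    Prop :=
  exists (Kv : fieldType) (w : Kv -> R) (iota : {rmorphism K -> Kv}),
    is_completion v w iota /\
    exists b : 'I_n -> Kv, forall y : Kv,
      exists! c : {ffun 'I_n -> Kv},
        (forall i, rat_closure w (c i)) /\ y = \sum_i c i * b i.

Definition local_degree (K : fieldExtType rat) (v : K -> R) : nat :=
  xget 0%N [set n | is_local_degree v n].

End Places.

Arguments infinite_places : clear implicits.
Arguments finite_places : clear implicits.
Arguments places : clear implicits.

Section Heights.
Variable R : realType.

Section NumberField.
Variable K : fieldExtType rat.

Definition locH (v : K -> R) (s : seq K) : R :=
  \big[Num.max/0]_(a <- s) v a ^+ local_degree v.

Definition loccalH (v : K -> R) (s : seq K) : R :=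
  (\sum_(a <- s) v a ^+ 2) `^ ((local_degree v)%:R / 2).

(* For a nonzero vector all but finitely many factors are 1, and the
   finitely supported product is the product over all places. *)
Definition heightH_in (s : seq K) : R :=
  (\big[*%R/1]_(v \in places R K) locH v s) `^ (\dim {:K})%:R^-1.

Definition calH_in (s : seq K) : R :=
  ((\big[*%R/1]_(v \in finite_places R K) locH v s) *
   (\big[*%R/1]_(v \in infinite_places R K) loccalH v s))
    `^ (\dim {:K})%:R^-1.

End NumberField.

(* The heights do not depend on the number field containing the coordinates;
   the one used is that generated by the coordinates, as provided by
   num_field_exists together with its embedding in algC and the preimage of
   the list of coordinates. *)
Definition heightH (s : seq algC) : R :=
  let: existT K (existT _ (exist2 s1 _ _)) := num_field_exists s in
  @heightH_in K s1.

Definition calH (s : seq algC) : R :=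
  let: existT K (existT _ (exist2 s1 _ _)) := num_field_exists s in
  @calH_in K s1.

Definition coords N (x : 'rV[algC]_N) : seq algC :=
  [seq x 0 i | i <- enum 'I_N].

Definition vecH N (x : 'rV[algC]_N) : R := heightH (coords x).

Definition vech N (x : 'rV[algC]_N) : R := heightH (1 :: coords x).

Definition mxH m n (A : 'M[algC]_(m, n)) : R :=
  heightH [seq A i j | i <- enum 'I_m, j <- enum 'I_n].

(* The L x L minors of an L x N matrix are indexed by the strictly increasing
   maps 'I_L -> 'I_N, encoded as L-tuples. *)
Definition maximal_minors L N (B : 'M[algC]_(L, N)) : seq algC :=
  [seq \det (\matrix_(i, j) B i (tnth t j))
     | t : L.-tuple 'I_N <- enum {: L.-tuple 'I_N}
         & sorted ltn (map (@nat_of_ord N) t)].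

Definition basis_mx N (V : {vspace 'rV[algC]_N}) : 'M[algC]_(\dim V, N) :=
  \matrix_(i, j) (tnth (vbasis V) i) 0 j.

Definition spaceH N (V : {vspace 'rV[algC]_N}) : R :=
  calH (maximal_minors (basis_mx V)).

End Heights.

Section QuadraticSpaces.
Variables (N : nat) (f : 'M[algC]_N).
Implicit Types (V W : {vspace 'rV[algC]_N}) (x y : 'rV[algC]_N).

Definition bform x y : algC := \sum_i \sum_j f i j * x 0 i * y 0 j.

Definition qform x : algC := bform x x.

Definition radical V : {vspace 'rV[algC]_N} :=
  (V :&: \bigcap_(i < \dim V)
     lker (linfun (fun x => bform x (vbasis V)`_i : algC^o)))%VS.

Lemma bform_linearl y : linear (fun x => bform x y : algC^o).
Proof.
move=> a x1 x2; rewrite /bform scaler_sumr -big_split; apply: eq_bigr => i _.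
rewrite scaler_sumr -big_split; apply: eq_bigr => j _ /=.
by rewrite !mxE mulrDr mulrDl /GRing.scale /= !mulrA [f i j * a]mulrC.
Qed.

Lemma bform_linearr x : linear (fun y => bform x y : algC^o).
Proof.
move=> a x1 x2; rewrite /bform scaler_sumr -big_split; apply: eq_bigr => i _.
rewrite scaler_sumr -big_split; apply: eq_bigr => j _ /=.
by rewrite !mxE mulrDr /GRing.scale /= mulrCA.
Qed.

Lemma mem_radical V x :
  x \in radical V <-> x \in V /\ forall y, y \in V -> bform x y = 0.
Proof.
have linE y z : linfun (fun x => bform x y : algC^o) z = bform z y.
  pose g := GRing.isLinear.Build _ _ _ _ _ (bform_linearl y).
  pose G : {linear 'rV[algC]_N -> algC^o} := HB.pack (fun x => bform x y) g.
  by rewrite (lfunE G).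
rewrite /radical memv_cap; split.
  case/andP=> xV xk; split=> // y yV; rewrite (coord_vbasis yV).
  pose g := GRing.isLinear.Build _ _ _ _ _ (bform_linearr x).
  pose G : {linear 'rV[algC]_N -> algC^o} := HB.pack (fun y => bform x y) g.
  rewrite -[LHS]/(G _) linear_sum big1 // => i _; rewrite linearZ /=.
  move/subvP: xk => /(_ x (memv_line x)) xk.
  have : x \in lker (linfun (fun x => bform x (vbasis V)`_i : algC^o)).
    by move: xk; rewrite memvE => /subv_bigcapP; apply.
  by rewrite memv_ker linE => /eqP ->; rewrite scaler0.
case=> xV xy; rewrite xV /= memvE; apply/subv_bigcapP => i _.
rewrite -memvE memv_ker linE; apply/eqP/xy/vbasis_mem/mem_nth.
by rewrite size_tuple.
Qed.

Definition form_rank V : nat := \dim V - \dim (radical V).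

Definition totally_isotropic W : Prop :=
  forall x y, x \in W -> y \in W -> bform x y = 0.

Definition maximal_totally_isotropic V W : Prop :=
  [/\ (W <= V)%VS, totally_isotropic W &
      forall W', (W <= W')%VS -> (W' <= V)%VS -> totally_isotropic W' ->
        W' = W].

End QuadraticSpaces.

Definition union_of_zero_sets N J (k : 'I_J -> nat)
    (P : forall i : 'I_J, 'I_(k i) -> {mpoly algC[N]}) : set 'rV[algC]_N :=
  [set x | exists i : 'I_J, forall j : 'I_(k i),
     meval (fun l => x 0 l) (P i j) = 0].

(* The expression also depends on lam = dim V - r, and M does not occur in
   it. *)
Definition boundT (R : realType) (lam L M : nat) : R :=
  3 `^ (18 * (L%:R - lam%:R)
        + 18 * L%:R * (L%:R - 1) / (L%:R - lam%:R)
        + 33 * L%:R * (L%:R - 1) / 4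
        + 3)
  * L%:R ^+ 51.

(* Main.v *)
Require Import Defs.
From HB Require Import structures.
From mathcomp Require Import all_boot all_order all_algebra all_field.
From mathcomp Require Import perm ring_quotient generic_quotient.
From mathcomp Require Import boolp classical_sets functions fsbigop reals exp.
From mathcomp Require Import -(notations) mpoly.
From mathcomp Require Import zify ring lra.

(** The zeros that are constructed satisfy the bound
   [h <= 72 * L ^ 3 * H(F) ^ 2 * calH(V) ^ 13], which implies the one claimed
   since the heights of nonzero vectors are at least 1 ([boundT_ge]).

   The idea is that a root of unity has absolute value 1 at every place, and that
   a polynomial which is not identically zero does not vanish at some point whose
   coordinates are roots of unity ([polyfun_unity]). Therefore avoiding an
   algebraic set costs nothing in terms of heights, provided that isotropic
   vectors are parametrized by polynomials with small coefficients.

   Let [C] be the basis matrix of [V] in echelon form ([echelon]). Its entries are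
   quotients of maximal minors, hence are bounded at each place by the local
   factor of [calH(V)] divided by the absolute value of one fixed minor. The form
   becomes [G = C F C^T]. From an isotropic vector [x0] one gets all the vectors
   [G(y, y) x0 - 2 G(x0, y) y], which are isotropic; if [y] is isotropic this is a
   multiple of [y] ([reflection_param]). A suitable [x0] is found by solving a
   quadratic equation in the plane of a basis vector and another vector with
   coordinates 0 and 1 ([small_isotropic]); in rank one a linear parametrization
   is available ([rank_one_param]). The parametrization reaches the given zero [z]
   outside the algebraic set, after [z] has been moved out of the radical. It also
   reaches a basis of an isotropic space of dimension at least [m] that contains
   [z], obtained from a maximal one by intersecting it with the orthogonal of [z]
   and adding [z] ([isotropic_extend]). By the first idea the parameters of [m]
   independent isotropic vectors outside the algebraic set can then be taken among
   roots of unity ([small_isotropic_points]). Dividing each point by one of its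
   nonzero coordinates makes the heights [H] and [h] equal.

   In the product of the local estimates all denominators disappear by the product
   formula ([point_height]). The constants of the triangle inequality matter at
   the archimedean places only. They involve the number of nonzero entries in a
   row of [C] rather than the number of variables, and this number is at most
   [calH(V) ^ 2], by the arithmetic-geometric mean inequality applied to the
   Euclidean norm of the vector of minors ([support_bound]).

   The heights are defined through the places of a number field and its local
   degrees, and have first to be made accessible. Each place of the rationals is
   extended to an absolute value [w] of the algebraic numbers ([place_exists]), in
   the finite case by means of a maximal subring in which [p] is not invertible. By
   the independence of absolute values ([abv_independence]) every place of a number
   field is induced by [w] through some embedding ([place_conj]), and its local
   degree is the number of embeddings that induce it ([local_degreeE]). Thus a
   height to the power of the degree is a product over embeddings, which is easily
   compared between different fields ([heightH_formula], [calH_formula]). *)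

Set Implicit Arguments.
Unset Strict Implicit.
Unset Printing Implicit Defensive.

Import Order.TTheory GRing.Theory Num.Theory.
Local Open Scope ring_scope.

(** * Absolute values and weak approximation *)
Section AbsoluteValue.
Variables (R : realType) (F : fieldType) (v : F -> R).
Hypothesis av : is_absolute_value v.

Lemma abv_ge0 x : 0 <= v x. Proof. by case: av. Qed.

Lemma abv_eq0 x : (v x == 0) = (x == 0).
Proof. by case: av => _ v0 _ _; apply/eqP/eqP => /v0. Qed.

Lemma abv0 : v 0 = 0. Proof. by apply/eqP; rewrite abv_eq0. Qed.

Lemma abvM x y : v (x * y) = v x * v y. Proof. by case: av. Qed.

Lemma abvD x y : v (x + y) <= v x + v y. Proof. by case: av. Qed.

Lemma abv_gt0 x : (0 < v x) = (x != 0).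
Proof. by rewrite lt0r abv_eq0 abv_ge0 andbT. Qed.

Lemma abv1 : v 1 = 1.
Proof.
have v1 : v 1 != 0 by rewrite abv_eq0 oner_eq0.
by apply: (mulfI v1); rewrite -abvM !mulr1.
Qed.

Lemma abvX x n : v (x ^+ n) = v x ^+ n.
Proof. by elim: n => [|n IH]; rewrite ?expr0 ?abv1 // !exprS abvM IH. Qed.

Lemma abv_unity n x : (0 < n)%N -> x ^+ n = 1 -> v x = 1.
Proof.
move=> n0 /(congr1 v); rewrite abvX abv1 => /eqP.
by rewrite pexpr_eq1 ?abv_ge0 // => /eqP.
Qed.

Lemma abvN x : v (- x) = v x.
Proof. by rewrite -mulN1r abvM (@abv_unity 2) ?mul1r // sqrrN expr1n. Qed.

Lemma abvB x y : v (x - y) <= v x + v y.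
Proof. by rewrite (le_trans (abvD _ _)) // abvN. Qed.

Lemma abv_distC x y : v (x - y) = v (y - x).
Proof. by rewrite -abvN opprB. Qed.

Lemma abvV x : v x^-1 = (v x)^-1.
Proof.
have [->|x0] := eqVneq x 0; first by rewrite invr0 abv0 invr0.
have vx : v x != 0 by rewrite abv_eq0.
by apply: (mulfI vx); rewrite -abvM !divff // abv1.
Qed.

Lemma abv_div x y : v (x / y) = v x / v y.
Proof. by rewrite abvM abvV. Qed.

Lemma abv_exprz x n : v (x ^ n) = v x ^ n.
Proof. by case: n => n; rewrite /exprz ?abvV abvX. Qed.

Lemma abv_sum (I : Type) (r : seq I) (P : pred I) (E : I -> F) :
  v (\sum_(i <- r | P i) E i) <= \sum_(i <- r | P i) v (E i).
Proof.
elim/big_rec2: _ => [|i a x _ IH]; first by rewrite abv0.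
by rewrite (le_trans (abvD _ _)) // lerD2l.
Qed.

Lemma abv_prod (I : Type) (r : seq I) (P : pred I) (E : I -> F) :
  v (\prod_(i <- r | P i) E i) = \prod_(i <- r | P i) v (E i).
Proof. by rewrite (big_morph v abvM abv1). Qed.

Lemma abv_dist x y : `|v x - v y| <= v (x - y).
Proof.
have half a b : v a - v b <= v (a - b) by rewrite lerBlDr -{1}(subrK b a) abvD.
by rewrite ler_norml half lerNl opprB abv_distC half.
Qed.

End AbsoluteValue.

Lemma abv_comp (R : realType) (F F' : fieldType) (v : F -> R)
    (f : {rmorphism F' -> F}) :
  is_absolute_value v -> is_absolute_value (v \o f).
Proof.
move=> av; split=> [x|x|x y|x y] /=; first exact: abv_ge0.
- by split=> [/eqP|->]; rewrite ?rmorph0 ?abv0 // abv_eq0 // fmorph_eq0 => /eqP.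
- by rewrite rmorphM abvM.
by rewrite rmorphD abvD.
Qed.

Section Powers.
Variable R : realType.
Implicit Types (a e : R).

(** Bernoulli's inequality. *)
Lemma expr_unbounded a e : 1 < a -> exists k, forall n, (k <= n)%N -> e < a ^+ n.
Proof.
move=> a1; have d0 : 0 < a - 1 by rewrite subr_gt0.
exists (Num.truncn (`|e| / (a - 1))).+1 => n kn.
have bern k : 1 + (a - 1) *+ k <= a ^+ k.
  elim: k => [|k IH]; first by rewrite mulr0n addr0 expr0.
  rewrite exprS; apply: le_trans (ler_wpM2l _ IH); last lra.
  rewrite mulrDr mulr1 mulrS addrA -subr_ge0.
  have : 0 <= (a - 1) *+ k by rewrite mulrn_wge0 // ltW.
  move: (_ *+ k) => z z0; nra.
apply: lt_le_trans (bern n); rewrite (le_lt_trans (ler_norm e)) //.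
have : `|e| / (a - 1) < n%:R.
  by rewrite (lt_le_trans (truncnS_gt _)) // ler_nat.
rewrite ltr_pdivrMr // mulr_natl => h; apply: lt_le_trans h _; lra.
Qed.

Lemma expr_vanishing a e :
  0 <= a < 1 -> 0 < e -> exists k, forall n, (k <= n)%N -> a ^+ n < e.
Proof.
case/andP=> a0 a1 e0; have [->|an0] := eqVneq a 0.
  by exists 1%N => -[|n] // _; rewrite expr0n.
have ap : 0 < a by rewrite lt0r an0.
have [|k hk] := @expr_unbounded a^-1 e^-1; first by rewrite invf_gt1.
exists k => n /hk; rewrite exprVn ltf_pV2 // posrE //.
exact: exprn_gt0.
Qed.

(** The integer powers of [a] are spread with bounded gaps on a logarithmic
   scale, on which the distance from [x ^+ n] to [y ^+ n] grows with [n]. *)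
Lemma exprz_between a x y :
  1 < a -> 0 < x -> x < y ->
  exists (n : nat) (k : int), (0 < n)%N /\ x ^+ n < a ^ k < y ^+ n.
Proof.
move=> a1 x0 xy; have a0 : 0 < a by rewrite (lt_trans ltr01).
have y0 := lt_trans x0 xy.
have [|n hn] := @expr_unbounded (y / x) a; first by rewrite ltr_pdivlMr ?mul1r.
pose m := n.+1; have := hn m (leqnSn _); rewrite expr_div_n.
rewrite ltr_pdivlMr ?exprn_gt0 // => am.
have la : 0 < ln a by rewrite ln_gt0.
pose k := (Num.floor (ln (x ^+ m) / ln a) + 1)%R.
have xm0 : 0 < x ^+ m by rewrite exprn_gt0.
have ltk : x ^+ m < a ^ k.
  rewrite -ltr_ln ?posrE ?exprz_gt0 // -powR_intmul ?(ltW a0) // ln_powR.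
  rewrite -ltr_pdivrMr // /k; have := floorD1_gt (ln (x ^+ m) / ln a).
  by [].
have lek : a ^ k <= a * x ^+ m.
  rewrite -ler_ln ?posrE ?exprz_gt0 ?mulr_gt0 // -powR_intmul ?(ltW a0) // ln_powR.
  rewrite lnM ?posrE // -ler_pdivlMr // /k mulrDl divff ?gt_eqF //.
  by rewrite intrD addrC lerD2l ge_floor.
exists m, k; split=> //; rewrite ltk /=; exact: le_lt_trans lek am.
Qed.

Lemma inv_succ_vanishing e :
  0 < e -> exists n0, forall n : nat, (n0 <= n)%N -> n.+1%:R^-1 < e.
Proof.
move=> e0; exists (Num.truncn e^-1) => n hn.
rewrite -[ltRHS]invrK ltf_pV2 ?posrE ?ltr0n ?invr_gt0 //.
by rewrite (lt_le_trans (truncnS_gt _)) // ler_nat.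
Qed.

End Powers.

Lemma list_eventually (T : eqType) (P : T -> nat -> Prop) (s : seq T) :
  (forall u, u \in s -> exists k, forall n, (k <= n)%N -> P u n) ->
  exists k, forall n, (k <= n)%N -> forall u, u \in s -> P u n.
Proof.
elim: s => [|u s IH] h; first by exists 0%N.
have [|k hk] := IH; first by move=> u' us; apply: h; rewrite inE us orbT.
have [|k' hk'] := h u; first by rewrite inE eqxx.
exists (maxn k k') => n; rewrite geq_max => /andP[kn k'n] w /predU1P[->|ws].
  exact: hk'.
exact: hk.
Qed.

Section Independence.
Variables (R : realType) (K : fieldType).
Implicit Types (u v : K -> R).

(** Two absolute values with the same nontrivial restriction to a subfield
   differ only if they order some element differently with respect to 1: the
   powers of an element of the subfield are spread densely enough to separate
   [u x ^+ n] from [v x ^+ n]. *)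
Lemma abv_separate u v (c : K) :
  is_absolute_value u -> is_absolute_value v -> 1 < u c -> u c = v c ->
  u <> v -> exists y, u y < 1 < v y.
Proof.
move=> au av c1 ucv nuv.
have [x ltx] : exists x, u x < v x.
  apply: contrapT => nx; apply: nuv; apply: funext => x.
  have le_vu y : v y <= u y by rewrite leNgt; apply/negP => h; apply: nx; exists y.
  apply/eqP; rewrite eq_le le_vu andbT.
  have [->|x0] := eqVneq x 0; first by rewrite !abv0.
  by have := le_vu x^-1; rewrite !abvV // lef_pV2 ?posrE ?abv_gt0.
have x0 : x != 0.
  by apply: contraTneq ltx => ->; rewrite !abv0 // ltxx.
have c0 : c != 0 by rewrite -(abv_gt0 au) (lt_trans ltr01).
have ux : 0 < u x by rewrite abv_gt0.
have [n [k [n0 /andP[h1 h2]]]] := exprz_between c1 ux ltx.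
exists (x ^+ n / c ^ k); rewrite !abv_div // !abvX // (abv_exprz au) (abv_exprz av) -ucv.
have ck : 0 < u c ^ k by rewrite exprz_gt0 // (lt_trans ltr01).
by rewrite ltr_pdivrMr // mul1r h1 ltr_pdivlMr // mul1r.
Qed.

(** The Artin-Whaples independence theorem. The quotients [x^k / (1 + x^k)]
   tend to 1 where [x] is large and to 0 where it is small, which lets one
   more absolute value be added without spoiling the others. *)
Lemma abv_independence v (c : K) (I : eqType) (U : I -> K -> R) (us : seq I) :
  is_absolute_value v -> 1 < v c ->
  (forall u : I, u \in us -> is_absolute_value (U u)) ->
  (forall u : I, u \in us -> exists y, U u y < 1 < v y) ->
  exists2 x, 1 < v x & forall u : I, u \in us -> U u x < 1.
Proof.
move=> av vc; elim: us => [|u us IH] aus sep; first by exists c.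
have [||x vx usx] := IH.
- by move=> w ws; apply: aus; rewrite in_cons ws orbT.
- by move=> w ws; apply: sep; rewrite in_cons ws orbT.
have [|y /andP[uy vy]] := sep u; first by rewrite inE eqxx.
have au : is_absolute_value (U u) by apply: aus; rewrite inE eqxx.
have small w : w \in us -> exists k, forall n, (k <= n)%N ->
    U w x ^+ n * (1 + U w y) < 1.
  move=> ws; have aw : is_absolute_value (U w) by apply: aus; rewrite in_cons ws orbT.
  have wy : 0 < 1 + U w y by rewrite ltr_wpDr ?abv_ge0.
  have [||k hk] := @expr_vanishing _ (U w x) (1 + U w y)^-1.
  - by rewrite abv_ge0 // usx.
  - by rewrite invr_gt0.
  by exists k => n /hk h; rewrite -ltr_pdivlMr // div1r.
have [ux|ux] := leP (U u x) 1.
  have [k /(_ k (leqnn k)) hk] := list_eventually small.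
  exists (x ^+ k * y).
    by rewrite abvM // abvX // (lt_le_trans vy) // ler_peMl ?abv_ge0 ?exprn_ege1 // ltW.
  move=> w; rewrite inE => /predU1P[->|ws].
    rewrite abvM // abvX // (le_lt_trans _ uy) // ler_piMl ?abv_ge0 //.
    by rewrite exprn_ile1 ?abv_ge0.
  have aw : is_absolute_value (U w) by apply: aus; rewrite in_cons ws orbT.
  rewrite abvM // abvX // (le_lt_trans _ (hk w ws)) // ler_wpM2l ?lerDr //.
  by rewrite exprn_ge0 ?abv_ge0.
have [k1 hk1] := list_eventually small.
have [k2 hk2] := expr_unbounded (v y - 1)^-1 vx.
have [k3 hk3] := expr_unbounded (1 - U u y)^-1 ux.
pose k := maxn k1 (maxn k2 k3).
have kP : [&& k1 <= k, k2 <= k & k3 <= k]%N.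
  by rewrite /k !leq_max !leqnn !orbT.
case/and3P: kP => /hk1 {}hk1 /hk2 {}hk2 /hk3 {}hk3.
have lowv (w : K -> R) : is_absolute_value w -> w x ^+ k - 1 <= w (1 + x ^+ k).
  move=> aw; have := abvD aw (1 + x ^+ k) (- 1).
  by rewrite addrAC subrr add0r abvN // abv1 // abvX // lerBlDr.
have lowv' (w : K -> R) : is_absolute_value w -> 1 - w x ^+ k <= w (1 + x ^+ k).
  move=> aw; have := abvB aw (1 + x ^+ k) (x ^+ k).
  by rewrite addrK abv1 // abvX // lerBlDr.
have upv (w : K -> R) : is_absolute_value w -> w (1 + x ^+ k) <= 1 + w x ^+ k.
  by move=> aw; have := abvD aw 1 (x ^+ k); rewrite abv1 // abvX.
have Au : 1 < U u x ^+ k * (1 - U u y) by rewrite -ltr_pdivrMr ?subr_gt0 // div1r.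
have Av : 1 < v x ^+ k * (v y - 1) by rewrite -ltr_pdivrMr ?subr_gt0 // div1r.
have uyge := abv_ge0 au y.
have den_neq0 : 1 + x ^+ k != 0.
  apply: contraTneq Au => den0; have := lowv (U u) au.
  rewrite den0 abv0 // -leNgt; have : 0 <= U u x ^+ k by rewrite exprn_ge0 ?abv_ge0.
  move: (U u x ^+ k) => A; nra.
have den_gt0 (w : K -> R) : is_absolute_value w -> 0 < w (1 + x ^+ k).
  by move=> aw; rewrite abv_gt0.
exists (x ^+ k / (1 + x ^+ k) * y).
  rewrite abvM // abv_div // abvX // mulrAC ltr_pdivlMr ?den_gt0 // mul1r.
  rewrite (le_lt_trans (upv v av)) //; move: Av; rewrite mulrBr mulr1; lra.
move=> w; rewrite inE => /predU1P[->|ws].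
  rewrite abvM // abv_div // abvX // mulrAC ltr_pdivrMr ?den_gt0 // mul1r.
  rewrite (lt_le_trans _ (lowv (U u) au)) //; move: Au; rewrite mulrBr mulr1; lra.
have aw : is_absolute_value (U w) by apply: aus; rewrite in_cons ws orbT.
rewrite abvM // abv_div // abvX // mulrAC ltr_pdivrMr ?den_gt0 // mul1r.
rewrite (lt_le_trans _ (lowv' (U w) aw)) //.
by have := hk1 w ws; rewrite mulrDr mulr1; lra.
Qed.

End Independence.

(** * The archimedean place of the algebraic numbers *)
Section RationalPlaces.
Variable R : realType.

(** The places of the rational field: [None] is the archimedean one. *)
Definition rat_abs (o : option nat) (q : rat) : R :=
  if o is Some p then padic_abs R p q else `|ratr q|.

Definition rat_place (o : option nat) : bool :=
  if o is Some p then prime p else true.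

(** Extensions to the algebraic numbers; the ultrametric inequality is required
   separately at the finite places. *)
Definition extends_rat (o : option nat) (w : algC -> R) : Prop :=
  [/\ is_absolute_value w, forall q, w (ratr q) = rat_abs o q &
      o -> forall x y, w (x + y) <= Num.max (w x) (w y)].

End RationalPlaces.

Section ArchimedeanPlace.
Variable R : realType.

Let cut (z : algC) : set R :=
  [set ratr q | q in [set q : rat | (ratr q : algC) <= `|z|]].

Let w z : R := sup (cut z).

Let cut_bounded (z : algC) : has_sup (cut z).
Proof.
split; first by exists (ratr 0), 0; rewrite //= rmorph0.
exists (ratr (Num.truncn `|z|).+1%:R) => _ [q /= qz <-].
rewrite ler_rat -(ler_rat algC) (le_trans qz) // ratr_nat ltW //.
by have /truncn_itv/andP[] := normr_ge0 z.
Qed.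

Let ge_w (z : algC) q : (ratr q : algC) <= `|z| -> ratr q <= w z.
Proof. by move=> qz; apply: sup_upper_bound => //; exists q. Qed.

Let le_w (z : algC) q : `|z| <= (ratr q : algC) -> w z <= ratr q.
Proof.
move=> zq; apply: ge_sup; first by case: (cut_bounded z).
by move=> _ [q' /= q'z <-]; rewrite ler_rat -(ler_rat algC) (le_trans q'z).
Qed.

Let approx (z : algC) (n : nat) : exists2 q : rat, 0 <= q &
  (ratr q : algC) <= `|z| <= ratr (q + n.+1%:R^-1).
Proof.
have n0 : 0 < n.+1%:R :> algC by rewrite ltr0n.
have /truncn_itv/andP[h1 h2] : 0 <= `|z| * n.+1%:R by rewrite mulr_ge0 // ltW.
exists ((Num.truncn (`|z| * n.+1%:R))%:R / n.+1%:R).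
  by rewrite divr_ge0 ?ler0n.
rewrite rmorphD /= fmorph_div fmorphV /= !ratr_nat ler_pdivrMr // h1 /=.
rewrite -[X in _ <= _ + X]mul1r -mulrDl ler_pdivlMr //.
by rewrite -[X in _ + X]/(1%:R) -natrD addn1 ltW.
Qed.

Let eq_of_close (a b c : R) : 0 <= c ->
  (forall n : nat, a <= b + c / n.+1%:R) -> a <= b.
Proof.
move=> c0 h; rewrite leNgt; apply/negP => ba.
have ab0 : 0 < a - b by rewrite subr_gt0.
have [n hn] : exists n : nat, c / (a - b) < n.+1%:R.
  by exists (Num.truncn (c / (a - b))); rewrite truncnS_gt.
move: hn; rewrite ltr_pdivrMr // => hn; have := h n.
by rewrite -lerBlDl ler_pdivlMr ?ltr0n // leNgt mulrC hn.
Qed.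

Let w_rat q : w (ratr q) = `|ratr q|.
Proof.
have e : `|ratr q : algC| = ratr `|q| by rewrite ratr_norm.
by apply/eqP; rewrite eq_le -ratr_norm le_w ?ge_w // e.
Qed.

Let w_ge0 z : 0 <= w z.
Proof. by rewrite -(rmorph0 (ratr : rat -> R)) ge_w // rmorph0. Qed.

Let w_approx (z : algC) n : exists2 q : rat, 0 <= q &
  [/\ (ratr q : algC) <= `|z|, `|z| <= (ratr (q + n.+1%:R^-1) : algC),
      ratr q <= w z & w z <= ratr q + n.+1%:R^-1].
Proof.
have [q q0 /andP[h1 h2]] := approx z n; exists q => //; split=> //.
  exact: ge_w.
by rewrite (le_trans (le_w h2)) // rmorphD /= fmorphV /= ratr_nat.
Qed.

(** The modulus has its values in the field of algebraic numbers itself; it is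
   transported to [R] by sending [z] to the real number with the same rational
   cut as its modulus. *)
Lemma archimedean_place : exists w : algC -> R, extends_rat None w.
Proof.
exists w; split=> //; split=> //.
- move=> z; split=> [wz0|->]; last by rewrite -(rmorph0 ratr) w_rat rmorph0 normr0.
  apply/eqP; apply: contraT => z0.
  pose q : rat := (Num.truncn (`|z|^-1)).+1%:R^-1.
  have : (0 : R) < ratr q by rewrite ltr0q invr_gt0 ltr0n.
  rewrite ltNge -wz0 ge_w // /q fmorphV /= ratr_nat -[leRHS]invrK.
  rewrite lef_pV2 ?posrE ?ltr0n ?invr_gt0 ?normr_gt0 // ltW //.
  by have /truncn_itv/andP[] : 0 <= `|z|^-1 by rewrite invr_ge0.
- move=> x y; apply/eqP; rewrite eq_le.
  have n1 n : (n.+1%:R^-1 : R) <= 1 by rewrite invf_le1 ?ltr0n // ler1n.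
  have n0 n : 0 <= (n.+1%:R^-1 : R) by rewrite invr_ge0 ler0n.
  have C0 : 0 <= w x + w y + 1 by rewrite !addr_ge0.
  apply/andP; split; apply: (eq_of_close C0) => n.
    have [q q0 [h1 h2 h3 h4]] := w_approx x n.
    have [r r0 [k1 k2 k3 k4]] := w_approx y n.
    have /le_w h : `|x * y| <=
        (ratr ((q + n.+1%:R^-1) * (r + n.+1%:R^-1)) : algC).
      by rewrite normrM rmorphM ler_pM.
    apply: le_trans h _.
    rewrite rmorphM /= !rmorphD /= !fmorphV /= !ratr_nat.
    have q0' : 0 <= (ratr q : R) by rewrite ler0q.
    have r0' : 0 <= (ratr r : R) by rewrite ler0q.
    move: (n1 n) (n0 n) h3 h4 k3 k4 q0' r0'; move: (n.+1%:R^-1 : R) => e.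
    move: (ratr q) (ratr r) (w x) (w y) => a b X Y *; nra.
  have [q q0 [h1 h2 h3 h4]] := w_approx x n.
  have [r r0 [k1 k2 k3 k4]] := w_approx y n.
  have /ge_w h : (ratr (q * r) : algC) <= `|x * y|.
    by rewrite normrM rmorphM ler_pM ?ler0q.
  apply: (@le_trans _ _ (ratr (q * r) + (w x + w y + 1) / n.+1%:R)); last first.
    by rewrite lerD2r.
  rewrite rmorphM /=.
  have q0' : 0 <= (ratr q : R) by rewrite ler0q.
  have r0' : 0 <= (ratr r : R) by rewrite ler0q.
  move: (n1 n) (n0 n) h3 h4 k3 k4 q0' r0'; move: (n.+1%:R^-1 : R) => e.
  move: (ratr q) (ratr r) (w x) (w y) => a b X Y *; nra.
move=> x y; apply: (@eq_of_close _ _ 2) => // n.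
have [q q0 [h1 h2 h3 h4]] := w_approx x n.
have [r r0 [k1 k2 k3 k4]] := w_approx y n.
have /le_w h : `|x + y| <=
    (ratr ((q + n.+1%:R^-1) + (r + n.+1%:R^-1)) : algC).
  by rewrite rmorphD (le_trans (ler_normD _ _)) // lerD.
apply: le_trans h _; rewrite !rmorphD /= !fmorphV /= !ratr_nat.
move: h3 k3; move: (n.+1%:R^-1 : R) (w x) (w y) (ratr q : R) (ratr r : R).
by move=> e X Y a b; lra.
Qed.

End ArchimedeanPlace.

(** * Maximal subrings in which p is not invertible *)
Section ValuationRing.
Variable p : nat.
Hypothesis p_pr : prime p.
Local Notation pC := (p%:R : algC).

Let p0 : pC != 0. Proof. by rewrite pnatr_eq0 -lt0n prime_gt0. Qed.

(** The maximal such subrings are the valuation rings of the places over [p]. *)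
Definition avoids_inv (A : set algC) : Prop :=
  [/\ A 1, (forall x y, A x -> A y -> A (x - y)),
      (forall x y, A x -> A y -> A (x * y)) & ~ A pC^-1].

(** Zorn's lemma starting from the integers. The empty set is admitted as well,
   so that the empty chain has an upper bound. *)
Lemma maximal_avoiding_ring :
  exists2 A, avoids_inv A & forall B, (A `<=` B)%classic -> avoids_inv B ->
    B = A.
Proof.
have AZ : avoids_inv [set x | x \in Num.int]%classic.
  split=> /= [|x y|x y|]; [exact: rpred1|exact: rpredB|exact: rpredM|].
  have pinv : pC^-1 = ratr p%:R^-1 by rewrite fmorphV /= ratr_nat.
  move/Aint_Cint => h.
  have /Cint_rat_Aint/(_ h)/intrP[k hk] : pC^-1 \in Crat.
    by rewrite pinv; apply: Crat_rat.
  have : pC * k%:~R = 1 by rewrite -hk divff.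
  rewrite -[pC]/((p%:Z)%:~R : algC) -intrM => /eqP; rewrite -[1]/(1%:~R) eqr_int.
  move/eqP/(congr1 absz); rewrite abszM /= => /eqP.
  by rewrite muln_eq1 => /andP[/eqP p1]; move: p_pr; rewrite p1.
have [F FP tot|A [AP Amax]] := @Zorn_bigcup algC
    [set A | A = set0%classic \/ avoids_inv A]%classic.
  have [[A FA [a Aa]]|F0] := pselect (exists2 A, F A & exists a, A a); last first.
    left; apply/seteqP; split=> // x [A FA Ax]; apply: F0; exists A => //.
    by exists x.
  have ring B x : F B -> B x -> avoids_inv B.
    by move=> FB Bx; case: (FP B FB) => // B0; move: Bx; rewrite B0.
  have common x y : (\bigcup_(X in F) X)%classic x ->
      (\bigcup_(X in F) X)%classic y -> exists2 B, F B & B x /\ B y.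
    move=> [B FB Bx] [C FC Cy]; have [BC|CB] := tot B C FB FC.
      by exists C => //; split=> //; apply: BC.
    by exists B => //; split=> //; apply: CB.
  right; split.
  - by exists A => //; case: (ring A a FA Aa).
  - move=> x y Ux Uy; have [B FB [Bx By]] := common x y Ux Uy.
    by exists B => //; case: (ring B x FB Bx) => _ + _ _; apply.
  - move=> x y Ux Uy; have [B FB [Bx By]] := common x y Ux Uy.
    by exists B => //; case: (ring B x FB Bx) => _ _ + _; apply.
  by move=> [B FB Bx]; case: (ring B _ FB Bx).
have AP' : avoids_inv A.
  case: AP => // A0; exfalso; apply: (Amax [set x | x \in Num.int]%classic).
    rewrite A0; split; first by move=> x.
    by move=> /(_ 1); apply; case: AZ.
  by right.
exists A => // B AB BP; apply/seteqP; split=> //.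
apply: contrapT => nBA; apply: (Amax B); last by right.
by split.
Qed.

Variable A : set algC.
Hypotheses (Ap : avoids_inv A)
  (Amax : forall B, (A `<=` B)%classic -> avoids_inv B -> B = A).

Lemma vring1 : A 1. Proof. by case: Ap. Qed.
Lemma vringB x y : A x -> A y -> A (x - y). Proof. by case: Ap => _ + _ _; apply. Qed.
Lemma vringM x y : A x -> A y -> A (x * y). Proof. by case: Ap => _ _ + _; apply. Qed.
Lemma vringNp : ~ A pC^-1. Proof. by case: Ap. Qed.
Lemma vring0 : A 0. Proof. by rewrite -(subrr 1); apply: vringB; apply: vring1. Qed.
Lemma vringN x : A x -> A (- x).
Proof. by rewrite -sub0r; apply/vringB/vring0. Qed.
Lemma vringD x y : A x -> A y -> A (x + y).
Proof. by move=> Ax Ay; rewrite -[y]opprK; apply/vringB/vringN. Qed.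
Lemma vringX x n : A x -> A (x ^+ n).
Proof.
by move=> Ax; elim: n => [|n IH]; rewrite ?expr0 ?exprS; [apply: vring1|apply: vringM].
Qed.
Lemma vring_nat n : A n%:R.
Proof.
elim: n => [|n IH]; first exact: vring0.
by rewrite -natr1; apply/vringD/vring1.
Qed.
Lemma vring_sum (I : Type) (r : seq I) (P : pred I) (E : I -> algC) :
  (forall i, P i -> A (E i)) -> A (\sum_(i <- r | P i) E i).
Proof. by move=> h; apply: big_ind => //; [apply: vring0|apply: vringD]. Qed.

Lemma vring_adjoin (B : set algC) :
  (A `<=` B)%classic -> B 1 -> (forall x y, B x -> B y -> B (x - y)) ->
  (forall x y, B x -> B y -> B (x * y)) -> ~ B pC^-1 ->
  (B `<=` A)%classic.
Proof. by move=> AB B1 BB BM Bp; rewrite (Amax AB). Qed.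

(** The powers of [1 - p a] are congruent to 1 modulo [p], so that its inverse
   can be adjoined without making [p] invertible. *)
Lemma vring_unit a : A a -> A (1 - pC * a)^-1.
Proof.
move=> Aa; set y : algC := 1 - pC * a.
have Ay : A y by apply/vringB/vringM => //; [apply: vring1|apply: vring_nat].
have yk k : exists2 b, A b & y ^+ k = 1 - pC * b.
  elim: k => [|k [b Ab IH]]; first by exists 0; [apply: vring0|rewrite mulr0 subr0].
  exists (a + b * y); last by rewrite exprS IH /y; ring.
  by apply: vringD => //; apply: vringM.
have y0 : y != 0.
  apply/eqP => y0; apply: vringNp; suff -> : pC^-1 = a by [].
  apply: (mulfI p0); rewrite divff //; apply/esym/eqP.
  by rewrite eq_sym -subr_eq0 -/y y0.
pose B : set algC := [set x : algC | exists2 b : algC, A b & exists k, x = b / y ^+ k]%classic.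
have common x z : B x -> B z -> exists b c k, [/\ A b, A c, x = b / y ^+ k & z = c / y ^+ k].
  move=> [b Ab [k ->]] [c Ac [l ->]]; exists (b * y ^+ l), (c * y ^+ k), (k + l)%N.
  have yn n : y ^+ n != 0 by rewrite expf_neq0.
  split; [by apply/vringM/vringX|by apply/vringM/vringX| |].
    by rewrite exprD; field; rewrite !yn.
  by rewrite exprD; field; rewrite !yn.
apply: (@vring_adjoin B); last first.
- by exists 1; [apply: vring1|exists 1%N; rewrite expr1 div1r].
- move=> [b Ab [k hk]]; have [c Ac hc] := yk k; apply: vringNp.
  have yn : y ^+ k != 0 by rewrite expf_neq0.
  have e : y ^+ k = pC * b.
    by apply: (mulfI (invr_neq0 p0)); rewrite mulKf // hk mulfVK.
  suff -> : pC^-1 = b + c by apply: vringD.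
  apply: (mulfI p0); rewrite divff // mulrDr -e hc; ring.
- move=> x z Bx Bz; have [b [c [k [Ab Ac -> ->]]]] := common x z Bx Bz.
  exists (b * c); first exact: vringM.
  exists (k + k)%N; rewrite exprD; field; exact: expf_neq0.
- move=> x z Bx Bz; have [b [c [k [Ab Ac -> ->]]]] := common x z Bx Bz.
  exists (b - c); first exact: vringB.
  by exists k; rewrite mulrBl.
- by exists 1; [apply: vring1|exists 0%N; rewrite expr0 divr1].
by move=> x Ax; exists x => //; exists 0%N; rewrite expr0 divr1.
Qed.

Let over (f : {poly algC}) := forall i, A f`_i.

Let overM f g : over f -> over g -> over (f * g).
Proof.
move=> hf hg i; rewrite coefM; apply: vring_sum => j _; exact: vringM.
Qed.

(** If [x] is not in the ring then adjoining it reaches [p^-1], by maximality. *)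
Let relation x : ~ A x -> exists2 f, over f & pC * f.[x] = 1.
Proof.
move=> nAx; apply: contrapT => nf; apply: nAx.
pose B : set algC := [set z : algC | exists2 f : {poly algC}, over f & z = f.[x]]%classic.
apply: (@vring_adjoin B); last first.
- exists 'X; last by rewrite hornerX.
  by move=> i; rewrite coefX; case: eqP => _; [apply: vring1|apply: vring0].
- by move=> [f hf e]; apply: nf; exists f => //; rewrite -e divff.
- move=> _ _ [f hf ->] [g hg ->]; exists (f * g); last by rewrite hornerM.
  exact: overM.
- move=> _ _ [f hf ->] [g hg ->]; exists (f - g); last by rewrite hornerD hornerN.
  by move=> i; rewrite coefB; apply: vringB.
- exists 1; last by rewrite hornerC.
  by move=> i; rewrite coef1; case: eqP => _; [apply: vring1|apply: vring0].
move=> z Az; exists z%:P; last by rewrite hornerC.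
by move=> i; rewrite coefC; case: eqP => _ //; apply: vring0.
Qed.

(** Of two relations, for [x] and for its inverse, the longer one can be
   shortened by the other: as [1 - p b] is a unit for the constant coefficient
   [b] of the shorter one, this one expresses 1 through the negative powers of
   [x], which replaces the top term of the longer one by lower terms. *)
Lemma vring_total x : x != 0 -> A x \/ A x^-1.
Proof.
move=> x0; apply: contrapT => /not_orP[nAx nAV].
have min z : ~ A z -> exists n f, [/\ over f, (size f <= n.+1)%N, pC * f.[z] = 1 &
    forall g, over g -> pC * g.[z] = 1 -> (n < size g)%N].
  move=> nAz; have [f hf ef] := relation nAz.
  pose Q n := `[< exists2 g, over g & pC * g.[z] = 1 /\ (size g <= n.+1)%N >].
  have exQ : exists n, Q n.
    by exists (size f); apply/asboolP; exists f => //; split.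
  have [n /asboolP[g hg [eg sg]] nmin] := ex_minnP exQ.
  exists n, g; split=> // k hk ek; rewrite ltnNge; apply/negP => sk.
  case: n sg nmin sk => [|n] sg nmin sk.
    have k0 : k = 0 by apply/eqP; rewrite -size_poly_leq0.
    by move: ek; rewrite k0 horner0 mulr0 => /eqP; rewrite eq_sym oner_eq0.
  have : Q n by apply/asboolP; exists k.
  by move/nmin; rewrite ltnn.
wlog : x x0 nAx nAV / (exists n m f g, [/\ (m <= n)%N,
    [/\ over f, (size f <= n.+1)%N, pC * f.[x] = 1 &
    forall g, over g -> pC * g.[x] = 1 -> (n < size g)%N] &
    [/\ over g, (size g <= m.+1)%N & pC * g.[x^-1] = 1]]).
  move=> h; have [n [f hf]] := min x nAx; have [m [g hg]] := min x^-1 nAV.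
  have [mn|nm] := leqP m n.
    by apply: (h x) => //; exists n, m, f, g; case: hg.
  apply: (h x^-1); rewrite ?invr_eq0 ?invrK //.
  by exists m, n, g, f; rewrite ltnW //; case: hf.
case=> n [m [f [g [mn [hf sf ef nmin] [hg sg eg]]]]].
have n0 : (0 < n)%N.
  rewrite lt0n; apply/eqP => n0; apply: vringNp.
  move: sf ef; rewrite n0 => /size1_polyC ->; rewrite hornerC => e.
  suff -> : pC^-1 = f`_0 by [].
  by apply: (mulfI p0); rewrite divff.
pose u := (1 - pC * g`_0)^-1; have Au : A u by apply: vring_unit.
have u0 : 1 - pC * g`_0 != 0.
  apply/eqP => e; apply: vringNp; suff -> : pC^-1 = g`_0 by [].
  by apply: (mulfI p0); rewrite divff //; apply/eqP; rewrite -subr_eq0 e.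
pose h := f - f`_n *: 'X^n + \sum_(j < m) (pC * u * f`_n * g`_j.+1) *: 'X^(n - j.+1).
have sh : (size h <= n)%N.
  apply/leq_sizeP => i ni; rewrite /h coefD coefB coefZ coefXn coef_sum big1.
    rewrite addr0; move: ni; rewrite leq_eqVlt => /predU1P[<-|lt].
      by rewrite eqxx mulr1 subrr.
    by rewrite gtn_eqF // mulr0 subr0 nth_default // (leq_trans sf).
  move=> j _; rewrite coefZ coefXn gtn_eqF ?mulr0 //.
  apply: leq_trans ni; rewrite ltn_subrL //.
have hh : over h.
  move=> i; rewrite /h coefD coefB coef_sum; apply: vringD.
    apply: vringB => //; rewrite coefZ coefXn; apply: vringM => //.
    exact: vring_nat.
  apply: vring_sum => j _; rewrite coefZ coefXn; apply: vringM; last exact: vring_nat.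
  by do !apply: vringM => //; apply: vring_nat.
suff eh : pC * h.[x] = 1 by have := nmin h hh eh; rewrite ltnNge sh.
have eg' : \sum_(j < m) g`_j.+1 * x ^- j.+1 = (pC * u)^-1.
  move: eg; rewrite (horner_coef_wide _ sg) big_ord_recl expr0 mulr1 mulrDr.
  move=> e; apply: (mulfI p0); rewrite invfM mulVKf // /u invrK.
  apply: (addrI (pC * g`_0)); rewrite [RHS]addrC subrK; apply: etrans e.
  by congr (_ + _ * _); apply: eq_bigr => j _; rewrite exprVn.
rewrite /h !hornerD hornerN hornerZ hornerXn horner_sum.
have -> : \sum_(j < m) ((pC * u * f`_n * g`_j.+1) *: 'X^(n - j.+1)).[x] =
   f`_n * x ^+ n.
  rewrite (eq_bigr (fun j : 'I_m => (pC * u * f`_n * x ^+ n) * (g`_j.+1 * x ^- j.+1))).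
    rewrite -mulr_sumr eg' /u; field; by rewrite p0 u0.
  move=> j _; rewrite hornerZ hornerXn exprB ?unitfE ?(leq_trans (ltn_ord j)) //.
  by ring.
by rewrite subrK.
Qed.

End ValuationRing.

(** * The p-adic places of the algebraic numbers *)
Section PadicPlace.
Variables (R : realType) (p : nat).
Hypothesis p_pr : prime p.
Local Notation pC := (p%:R : algC).

Let p0 : pC != 0. Proof. by rewrite pnatr_eq0 -lt0n prime_gt0. Qed.

Variable A : set algC.
Hypotheses (Ap : avoids_inv p A)
  (Amax : forall B, (A `<=` B)%classic -> avoids_inv p B -> B = A).

Definition vunit z := A z /\ A z^-1.

Lemma vunitM x y : vunit x -> vunit y -> vunit (x * y).
Proof. by move=> [x1 x2] [y1 y2]; split; rewrite ?invfM; apply: (vringM Ap). Qed.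

Lemma vunitV x : vunit x -> vunit x^-1.
Proof. by case=> x1 x2; split; rewrite ?invrK. Qed.

Lemma vunit1 : vunit 1.
Proof. by split; rewrite ?invr1; apply: (vring1 Ap). Qed.

Lemma vunitX x n : vunit x -> vunit (x ^+ n).
Proof.
by move=> ux; elim: n => [|n IH]; rewrite ?expr0 ?exprS; [apply: vunit1|apply: vunitM].
Qed.

Lemma vunit_coprime m : coprime p m -> vunit m%:R.
Proof.
move=> cop; split; first exact: (vring_nat Ap).
have m0 : (0 < m)%N.
  by case: m cop => //; rewrite /coprime gcdn0 => /eqP p1; move: p_pr; rewrite p1.
have [[u v] /= e] : exists u, (u.1 * m - u.2 * p = 1)%N.
  by apply/coprimeP; rewrite // coprime_sym.
have e' : (u * m = v * p + 1)%N.
  by rewrite -e subnKC // ltnW // -subn_gt0 e.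
have : A (1 - pC * - v%:R)^-1.
  by apply: (vring_unit p_pr Ap Amax); apply: (vringN Ap); apply: (vring_nat Ap).
have -> : 1 - pC * - v%:R = (u * m)%:R.
  by rewrite e' natrD natrM mulrN opprK addrC mulrC.
move=> Au; have um : (u * m)%:R != 0 :> algC by rewrite e' addn1 pnatr_eq0.
have -> : m%:R^-1 = u%:R * (u * m)%:R^-1 :> algC.
  by move: um; rewrite natrM mulf_eq0 negb_or => /andP[u0 m0']; field; rewrite u0 m0'.
by apply: (vringM Ap) => //; apply: (vring_nat Ap).
Qed.

Lemma vunit_nat n : (0 < n)%N -> vunit (n%:R / pC ^ (logn p n)%:Z).
Proof.
move=> n0; have [m cop {1}->] := pfactor_coprime p_pr n0.
rewrite natrM natrX mulfK ?expf_neq0 //; exact: vunit_coprime.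
Qed.

Definition padic_val (q : rat) : int := (logn p `|numq q|)%:Z - (logn p `|denq q|)%:Z.

Lemma vunit_rat (q : rat) : q != 0 -> vunit (ratr q / pC ^ padic_val q).
Proof.
move=> q0; have n0 : (0 < `|numq q|)%N by rewrite absz_gt0 numq_eq0.
have d0 : (0 < `|denq q|)%N by rewrite absz_gt0 denq_neq0.
have e : ratr q = (numq q)%:~R / (`|denq q|%N)%:R :> algC.
  by rewrite /ratr -{1}(absz_denq q).
have num : (numq q)%:~R = (-1) ^+ (numq q < 0)%R * (`|numq q|%N)%:R :> algC.
  by rewrite {1}[numq q]intEsign intrM rmorphXn /= rmorphN1.
rewrite e num /padic_val expfzDr // -invr_expz.
set a : algC := (`|numq q|%N)%:R; set b : algC := (`|denq q|%N)%:R.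
have -> : forall s : algC, s * a / b / (pC ^ (logn p `|numq q|)%:Z / pC ^ (logn p `|denq q|)%:Z)
   = s * (a / pC ^ (logn p `|numq q|)%:Z) * (b / pC ^ (logn p `|denq q|)%:Z)^-1.
  move=> s; have ? : pC ^ (logn p `|numq q|)%:Z != 0 by rewrite expfz_neq0.
  have ? : pC ^ (logn p `|denq q|)%:Z != 0 by rewrite expfz_neq0.
  by have b0 : b != 0 by [rewrite pnatr_eq0 -lt0n]; field; apply/and3P.
apply: vunitM; last by apply/vunitV/vunit_nat.
apply: vunitM; last exact: vunit_nat.
apply: vunitX; split; rewrite ?invrN1; apply: (vringN Ap); apply: (vring1 Ap).
Qed.

(** Divisibility in a valuation ring is total. *)
Lemma vring_max (s : seq algC) : {in s, forall t, t = 0} \/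
  exists2 t, t \in s & t != 0 /\ {in s, forall u, A (u / t)}.
Proof.
elim: s => [|a s IH]; first by left.
have [->|a0] := eqVneq a 0.
  case: IH => [s0|[t ts [t0 st]]]; [left|right].
    by move=> u /predU1P[->|/s0].
  exists t; first by rewrite inE ts orbT.
  by split=> // u /predU1P[->|/st //]; rewrite mul0r; apply: (vring0 Ap).
right; case: IH => [s0|[t ts [t0 st]]].
  exists a; rewrite ?inE ?eqxx //; split=> // u /predU1P[->|/s0 ->].
    by rewrite divff //; apply: (vring1 Ap).
  by rewrite mul0r; apply: (vring0 Ap).
have [ta|at_] : A (a / t) \/ A (a / t)^-1.
  by apply: (vring_total p_pr Ap Amax); rewrite mulf_neq0 ?invr_eq0.
  exists t; first by rewrite inE ts orbT.
  by split=> // u /predU1P[->|/st].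
exists a; rewrite ?inE ?eqxx //; split=> // u /predU1P[->|/st ut].
  by rewrite divff //; apply: (vring1 Ap).
have -> : u / a = (u / t) * (a / t)^-1 by field; rewrite a0 t0.
exact: (vringM Ap).
Qed.

(** A term that strictly dominates the others cannot be cancelled by them,
   since the nonunits of a valuation ring form an ideal. *)
Lemma vring_two_max n (t : 'I_n -> algC) : \sum_i t i = 0 ->
  (exists i, t i != 0) -> exists i j, [/\ i != j, t i != 0, t j != 0 & vunit (t i / t j)].
Proof.
move=> sum0 [i0 ti0]; pose s := [seq t i | i : 'I_n].
have [s0|[_ /mapP[j _ ->] [tj st]]] := vring_max s.
  by move: ti0; rewrite (s0 (t i0)) ?eqxx //; apply: map_f; rewrite mem_enum.
apply: contrapT => nex.
pose nonunit z := A z /\ (z = 0 \/ ~ A z^-1).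
have nu i : i != j -> nonunit (t i / t j).
  move=> ij; have At : A (t i / t j) by apply: st; apply: map_f; rewrite mem_enum.
  split=> //; have [e|tin] := eqVneq (t i) 0; first by left; rewrite e mul0r.
  by right=> AV; apply: nex; exists i, j.
have nuD x y : nonunit x -> nonunit y -> nonunit (x + y).
  move=> [Ax nx] [Ay ny]; split; first exact: (vringD Ap).
  case: nx => [->|nx]; first by rewrite add0r.
  case: ny => [->|ny]; first by rewrite addr0; right.
  have x0 : x != 0 by apply/eqP => x0; apply: nx; rewrite x0 invr0; apply: (vring0 Ap).
  have y0 : y != 0 by apply/eqP => y0; apply: ny; rewrite y0 invr0; apply: (vring0 Ap).
  have [xy0|xy0] := eqVneq (x + y) 0; [by left|right=> Axy].
  have [h|h] : A (x / y) \/ A (x / y)^-1.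
    by apply: (vring_total p_pr Ap Amax); rewrite mulf_neq0 ?invr_eq0.
    apply: ny; have -> : y^-1 = (x + y)^-1 * (x / y + 1) by field; rewrite y0 xy0.
    by apply: (vringM Ap) => //; apply: (vringD Ap) => //; apply: (vring1 Ap).
  apply: nx; have -> : x^-1 = (x + y)^-1 * ((x / y)^-1 + 1) by field; rewrite x0 y0 xy0.
  by apply: (vringM Ap) => //; apply: (vringD Ap) => //; apply: (vring1 Ap).
have : nonunit (\sum_(i | i != j) t i / t j).
  apply: big_ind => //; split; [exact: (vring0 Ap)|by left].
have -> : \sum_(i | i != j) t i / t j = -1.
  move: sum0; rewrite (bigD1 j) //= -mulr_suml => /eqP; rewrite addrC addr_eq0 => /eqP ->.
  by rewrite mulNr divff.
case=> _ [/eqP|]; first by rewrite oppr_eq0 oner_eq0.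
by apply; rewrite invrN1; apply: (vringN Ap); apply: (vring1 Ap).
Qed.

(** The valuation of [x], normalized to be 1 at [p], is the rational number
   [nk.2 / nk.1]. *)
Definition has_val (x : algC) (nk : nat * int) :=
  (0 < nk.1)%N /\ vunit (x ^+ nk.1 / pC ^ nk.2).

(** Two terms of the minimal polynomial of [x] have the same valuation, by
   [vring_two_max]. As the coefficients are rational, this determines the
   valuation of a power of [x]. *)
Lemma has_val_exists x : x != 0 -> exists nk, has_val x nk.
Proof.
move=> x0; have [q [_ mon_q] dv] := minCpolyP x.
have : root (map_poly ratr q) x by rewrite dv.
rewrite /root horner_coef size_map_poly => /eqP sum0.
have [|i [j [ij ti tj uij]]] := vring_two_max sum0.
  have sq : (0 < size q)%N by rewrite size_poly_gt0 monic_neq0.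
  exists (Ordinal (etrans (ltn_predL _) sq)); rewrite /= coef_map mulf_neq0 ?expf_neq0 //.
  by rewrite fmorph_eq0 -/(lead_coef q) (monicP mon_q) oner_eq0.
have main (a b : 'I_(size q)) : (a < b)%N -> (map_poly ratr q)`_a * x ^+ a != 0 ->
    (map_poly ratr q)`_b * x ^+ b != 0 ->
    vunit ((map_poly ratr q)`_a * x ^+ a / ((map_poly ratr q)`_b * x ^+ b)) ->
    exists nk, has_val x nk.
  have nz (c : nat) : (map_poly ratr q)`_c * x ^+ c != 0 -> q`_c != 0.
    by apply: contraNneq => qc; rewrite coef_map qc raddf0 mul0r.
  move=> ab /nz qa /nz qb; rewrite !coef_map /= => u.
  exists ((b - a)%N, padic_val q`_a - padic_val q`_b); rewrite /has_val /= subn_gt0.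
  split=> //; rewrite exprB ?unitfE ?(ltnW ab) // expfzDr // -invr_expz.
  have ua := vunit_rat qa; have ub := vunit_rat qb.
  have := vunitM (vunitV u) (vunitM ua (vunitV ub)); congr vunit.
  have ? : pC ^ padic_val q`_a != 0 by rewrite expfz_neq0.
  have ? : pC ^ padic_val q`_b != 0 by rewrite expfz_neq0.
  have ? : x ^+ a != 0 by rewrite expf_neq0.
  have ? : x ^+ b != 0 by rewrite expf_neq0.
  have ? : ratr q`_a != 0 :> algC by rewrite fmorph_eq0.
  have ? : ratr q`_b != 0 :> algC by rewrite fmorph_eq0.
  by field; do ?[apply/andP; split].
move: ij; rewrite neq_ltn => /orP[ij|ji]; first exact: (main i j).
by apply: (main j i) => //; rewrite -invf_div; apply: vunitV.
Qed.

Lemma vunit_pX (k : int) : vunit (pC ^ k) -> k = 0.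
Proof.
have pos n : ~ vunit (pC ^+ n.+1).
  move=> [_ h]; apply: (vringNp Ap); have -> : pC^-1 = pC ^+ n * (pC ^+ n.+1)^-1.
    by rewrite exprS; field; rewrite p0 expf_neq0.
  by apply: (vringM Ap) => //; apply: (vringX Ap); apply: (vring_nat Ap).
case: k => [[|n]|n] //; first by move/pos.
by rewrite NegzE -exprz_inv => /vunitV; rewrite -exprVn invrK => /pos.
Qed.

Lemma has_val_uniq x nk nk' : x != 0 -> has_val x nk -> has_val x nk' ->
  nk.2%:~R / nk.1%:R = nk'.2%:~R / nk'.1%:R :> R.
Proof.
case: nk nk' => [n k] [n' k'] /= x0 [n0 u] [n0' u'] /=.
have h : k * n'%:Z = k' * n%:Z.
  apply/eqP; rewrite -subr_eq0; apply/eqP/vunit_pX.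
  have := vunitM (vunitX n u') (vunitV (vunitX n' u)); congr vunit.
  rewrite /= expfzDr // -invr_expz !expr_div_n -!exprM [(n' * n)%N]mulnC.
  have ? : x ^+ (n * n') != 0 by rewrite expf_neq0.
  have e (a : int) (b : nat) : (pC ^ a) ^+ b = pC ^ (a * b%:Z).
    by rewrite exprnP exprz_exp.
  rewrite !e.
  have ? : pC ^ (k * n'%:Z) != 0 by rewrite expfz_neq0.
  have ? : pC ^ (k' * n%:Z) != 0 by rewrite expfz_neq0.
  by field; do ?[apply/andP; split].
have n0R : n%:R != 0 :> R by rewrite pnatr_eq0 -lt0n.
have n0R' : n'%:R != 0 :> R by rewrite pnatr_eq0 -lt0n.
apply/eqP; rewrite eqr_div //; apply/eqP.
by have := congr1 (fun z : int => z%:~R : R) h; rewrite !intrM.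
Qed.

Let val (x : algC) : R := let nk := xget (1%N, 0) (has_val x) in nk.2%:~R / nk.1%:R.

Let valE x nk : x != 0 -> has_val x nk -> val x = nk.2%:~R / nk.1%:R.
Proof.
move=> x0 h; apply: (has_val_uniq x0 _ h); apply: xgetPex.
by exists nk.
Qed.

Let valM x y : x != 0 -> y != 0 -> val (x * y) = val x + val y.
Proof.
move=> x0 y0; have [[n k] hx] := has_val_exists x0.
have [[n' k'] hy] := has_val_exists y0.
rewrite (valE x0 hx) (valE y0 hy).
have xy0 : x * y != 0 by rewrite mulf_neq0.
case: hx hy => /= n0 u [/= n0' u'].
rewrite (@valE _ ((n * n')%N, k * n'%:Z + k' * n%:Z)) //=.
  rewrite natrM intrD !intrM /=; field.
  by rewrite !pnatr_eq0 -!lt0n n0 n0'.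
split; first by rewrite /= muln_gt0 n0.
have := vunitM (vunitX n' u) (vunitX n u'); congr vunit => /=.
rewrite expfzDr // !expr_div_n -!exprM exprMn.
have e (a : int) (b : nat) : (pC ^ a) ^+ b = pC ^ (a * b%:Z).
  by rewrite exprnP exprz_exp.
rewrite !e [(n' * n)%N]mulnC.
have ? : pC ^ (k * n'%:Z) != 0 by rewrite expfz_neq0.
have ? : pC ^ (k' * n%:Z) != 0 by rewrite expfz_neq0.
by field; do ?[apply/andP; split].
Qed.

Let val_ge0 x : x != 0 -> A x -> 0 <= val x.
Proof.
move=> x0 Ax; have [[n k] hx] := has_val_exists x0; rewrite (valE x0 hx) /=.
case: hx => /= n0 [u u']; rewrite divr_ge0 ?ler0n // ler0z leNgt.
apply/negP; case: k u u' => // k _; rewrite NegzE -exprnN invf_div => u' _.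
apply: (vringNp Ap); have -> : pC^-1 = pC ^+ k * (x ^+ n * (pC ^- k.+1 / x ^+ n)).
  by rewrite exprS; field; rewrite p0 !expf_neq0.
apply: (vringM Ap); first by apply: (vringX Ap); apply: (vring_nat Ap).
by apply: (vringM Ap) => //; apply: (vringX Ap).
Qed.

Let w (x : algC) : R := if x == 0 then 0 else p%:R `^ (- val x).

Let pR : 1 < p%:R :> R. Proof. by rewrite ltr1n prime_gt1. Qed.
Let pR0 : 0 < p%:R :> R. Proof. exact: lt_trans ltr01 pR. Qed.

Let wM x y : w (x * y) = w x * w y.
Proof.
rewrite /w mulf_eq0; case: eqVneq => [|x0] /=; first by rewrite mul0r.
case: eqVneq => [|y0] /=; first by rewrite mulr0.
by rewrite valM // opprD powRD // (gt_eqF pR0) implybT.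
Qed.

Let w_ge0 x : 0 <= w x.
Proof. by rewrite /w; case: ifP => // _; apply: powR_ge0. Qed.

Let w_eq0 x : w x = 0 -> x = 0.
Proof.
rewrite /w; case: eqVneq => // x0 /eqP.
by rewrite powR_eq0 (gt_eqF pR0).
Qed.

Let w_le1 x : A x -> w x <= 1.
Proof.
rewrite /w; case: eqVneq => // x0 Ax.
have : - val x <= 0 by rewrite oppr_le0 val_ge0.
by move/(ler_powR (ltW pR)); rewrite powRr0.
Qed.

Let w_max x y : w (x + y) <= Num.max (w x) (w y).
Proof.
have half a b : b != 0 -> A (a / b) -> w (a + b) <= w b.
  move=> b0 h; have -> : a + b = (a / b + 1) * b by field.
  rewrite wM ler_piMl ?w_le1 //; apply: (vringD Ap) => //; exact: (vring1 Ap).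
rewrite le_max; have [->|x0] := eqVneq x 0; first by rewrite add0r lexx orbT.
have [->|y0] := eqVneq y 0; first by rewrite addr0 lexx.
have [h|h] : A (x / y) \/ A (x / y)^-1.
  by apply: (vring_total p_pr Ap Amax); rewrite mulf_neq0 ?invr_eq0.
  by rewrite half ?orbT.
by rewrite addrC half // -invf_div.
Qed.

Lemma padic_place_of_vring : exists w : algC -> R, extends_rat (Some p) w.
Proof.
exists w; split=> // [|q].
  split=> // [x|x y]; first by split=> [/w_eq0|->] //; rewrite /w eqxx.
  apply: le_trans (w_max x y) _; rewrite ge_max lerDl lerDr !w_ge0 //.
rewrite /= /padic_abs /w fmorph_eq0; case: eqVneq => // q0.
rewrite (@valE _ (1%N, padic_val q)) ?fmorph_eq0 //=; last first.
  by split=> //=; rewrite expr1; apply: vunit_rat.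
by rewrite divr1 -intrN powR_intmul ?(ltW pR0) // /padic_val opprB.
Qed.

End PadicPlace.

Theorem place_exists (R : realType) (o : option nat) :
  rat_place o -> exists w : algC -> R, extends_rat o w.
Proof.
case: o => [p /= p_pr|_]; last exact: archimedean_place.
have [A Ap Amax] := maximal_avoiding_ring p_pr.
exact: (padic_place_of_vring R p_pr Ap Amax).
Qed.

(** * Conjugates *)
Lemma rmorph_in_alg (K : fieldExtType rat) (rR : unitRingType)
    (eps : {rmorphism K -> rR}) (a : rat) : eps a%:A = ratr a.
Proof. by rewrite rmorphZ_num rmorph1 mulr1. Qed.

Lemma map_in_alg (K : fieldExtType rat) (eps : {rmorphism K -> algC}) (q : {poly rat}) :
  map_poly eps (map_poly (in_alg K) q) = map_poly ratr q.
Proof.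
by rewrite -map_poly_comp; apply: eq_map_poly => a; rewrite /= rmorph_in_alg.
Qed.

Lemma minPoly_minCpoly (K : fieldExtType rat) (eps : {rmorphism K -> algC}) z :
  map_poly eps (minPoly 1 z) = minCpoly (eps z).
Proof.
have [q Dq] : exists q, minPoly 1 z = map_poly (in_alg K) q.
  exact/polyOver1P/minPolyOver.
have [m [Dm mon_m] dv] := minCpolyP (eps z).
have rq : map_poly eps (minPoly 1 z) = map_poly ratr q by rewrite Dq map_in_alg.
apply/eqP; rewrite -eqp_monic ?map_monic ?monic_minPoly ?minCpoly_monic //.
rewrite /eqp; apply/andP; split; last first.
  by rewrite rq Dm dvdp_map -dv -rq fmorph_root root_minPoly.
rewrite Dm -(map_in_alg eps) dvdp_map; apply: minPoly_dvdp.
  by apply/polyOver1P; exists m.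
by rewrite -(fmorph_root eps) map_in_alg -Dm root_minCpoly.
Qed.

(** The map that sends a root of the minimal polynomial to another one extends
   to the splitting field, and from there to all algebraic numbers. *)
Lemma conj_aut (t xi : algC) :
  root (minCpoly t) xi -> exists nu : {rmorphism algC -> algC}, nu t = xi.
Proof.
have [r Dr] := closed_field_poly_normal (minCpoly t).
rewrite (monicP (minCpoly_monic t)) scale1r in Dr.
have tr : t \in r by rewrite -root_prod_XsubC -Dr root_minCpoly.
rewrite Dr root_prod_XsubC => xir.
have [Q [QC [rr Drr genQ]]] := num_field_exists r.
move: tr xir; rewrite -Drr => /mapP[z zr Dt] /mapP[x xr Dxi].
have hom1 : kHom 1 1 (\1%VF : 'End(Q)) by rewrite kHom1.
have idm (s : {poly Q}) : map_poly \1%VF s = s.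
  by apply/polyP => i; rewrite coef_map /= id_lfunE.
have DQ : minPoly 1 z = \prod_(y <- rr) ('X - y%:P).
  apply: (map_poly_inj QC); rewrite minPoly_minCpoly -Dt Dr -Drr big_map rmorph_prod.
  by apply: eq_bigr => y _; rewrite /= map_polyXsubC.
have rx : root (map_poly \1%VF (minPoly 1 z)) x.
  by rewrite idm DQ root_prod_XsubC.
have homE := kHomExtendP (sub1v 1%AS) hom1 rx.
have split : splittingFieldFor <<1; z>> (minPoly 1 z) {:Q}.
  apply: splittingFieldForS (sub1v _) (subvf _) _.
  by exists rr; rewrite // DQ eqpxx.
have [g hg gE] := kHom_extends (sub1v <<1; z>>%AS) homE (minPolyOver 1%AS z) split.
pose gM := GRing.isMonoidMorphism.Build _ _ g (kHom_monoid_morphism hg).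
pose gR : {rmorphism Q -> Q} := HB.pack (fun_of_lfun g) gM.
have [nu Dnu] := extend_algC_subfield_aut QC gR.
exists nu; rewrite Dt -Dnu Dxi; congr (QC _).
by rewrite /= -gE ?memv_adjoin // (kHomExtend_val hom1 rx).
Qed.

Section Conjugates.
Variables (K : fieldExtType rat) (eps : {rmorphism K -> algC}).
Local Notation d := (\dim {:K}).

Lemma primitive_element : exists th : K, <<1; th>>%VS = fullv.
Proof.
have [z [a Dz] [ps Dps]] := algC_PET [seq eps b | b <- vbasis {:K}].
set s := [seq _ | _ <- _] in a Dz Dps.
have [th Dth] : exists th, z = eps th.
  exists (\sum_(i < size s) (vbasis {:K})`_i *+ a i); rewrite Dz rmorph_sum.
  apply: eq_bigr => i _; rewrite rmorphMn (nth_map 0) //.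
  by rewrite -(size_map eps).
exists th; apply/vspaceP => y; rewrite memvf (coord_vbasis (memvf y)).
apply: rpred_sum => i _; apply: rpredZ.
have iS : (i < size s)%N by rewrite size_map size_tuple.
have ips : (i < size ps)%N by rewrite -(size_map (fun p => (map_poly ratr p).[z])) -Dps.
have /fmorph_inj -> : eps (vbasis {:K})`_i = eps (map_poly (in_alg K) ps`_i).[th].
  rewrite -(nth_map _ 0) ?size_tuple // -/s Dps (nth_map 0) // Dth.
  by rewrite -(map_in_alg eps) horner_map.
apply/Fadjoin1_polyP; by exists ps`_i.
Qed.

(** The embeddings of a number field, extended to automorphisms of the algebraic
   numbers so that they act on all number fields at once. *)
Lemma conjugates : exists (th : K) (nu : 'I_d -> {rmorphism algC -> algC}),
  [/\ injective (fun i => nu i (eps th)),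
      forall xi, root (minCpoly (eps th)) xi -> exists i, xi = nu i (eps th) &
      forall y, exists c : 'I_d -> rat, y = \sum_j c j *: th ^+ j].
Proof.
have [th gen] := primitive_element.
have dE : d = adjoin_degree 1 th by rewrite -gen dim_Fadjoin dimv1 muln1.
have [r Dr] := closed_field_poly_normal (minCpoly (eps th)).
rewrite (monicP (minCpoly_monic _)) scale1r in Dr.
have sr : size r = d.
  apply: succn_inj; rewrite dE -size_minPoly -(size_map_poly eps) minPoly_minCpoly.
  by rewrite Dr size_prod_XsubC.
have ur : uniq r.
  rewrite -separable_prod_XsubC -Dr -minPoly_minCpoly separable_map.
  by apply: pcharf0_separable => i; rewrite pchar_lalg pchar_num.
have ex (i : 'I_d) : exists nu : {rmorphism algC -> algC}, nu (eps th) = r`_i.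
  by apply: conj_aut; rewrite Dr root_prod_XsubC mem_nth ?sr.
exists th, (fun i => projT1 (cid (ex i))).
have nuE i : projT1 (cid (ex i)) (eps th) = r`_i by case: cid.
split.
- move=> i j; rewrite !nuE => /eqP; rewrite nth_uniq ?sr // => /eqP; exact: val_inj.
- move=> xi; rewrite Dr root_prod_XsubC => xr.
  have ix : (index xi r < d)%N by rewrite -sr index_mem.
  by exists (Ordinal ix); rewrite nuE /= nth_index.
move=> y; have : y \in <<1; th>>%VS by rewrite gen memvf.
move/Fadjoin_poly_eq => Dy.
have [q Dq] : exists q, Fadjoin_poly 1 th y = map_poly (in_alg K) q.
  exact/polyOver1P/Fadjoin_polyOver.
exists (fun j => q`_j); rewrite -{1}Dy (@horner_coef_wide _ d); last first.
  by rewrite dE size_Fadjoin_poly.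
apply: eq_bigr => j _; rewrite Dq coef_map /=.
by rewrite mulr_algl.
Qed.

End Conjugates.

(** * The places of a number field are induced by its embeddings *)
Section RationalClosure.
Variables (R : realType) (F : fieldType) (w : F -> R).
Hypothesis aw : is_absolute_value w.
Variable j : {rmorphism rat -> F}.
Let jE q : j q = ratr q. Proof. exact: fmorph_eq_rat. Qed.

Local Notation rc := (rat_closure w).

Lemma rat_closure_rat q : rc (ratr q).
Proof. by move=> e e0; exists q; rewrite subrr abv0. Qed.

Lemma rat_closureD x y : rc x -> rc y -> rc (x + y).
Proof.
move=> hx hy e e0; have e2 : 0 < e / 2 by rewrite divr_gt0.
have [p hp] := hx _ e2; have [q hq] := hy _ e2.
exists (p + q); rewrite -jE rmorphD !jE opprD addrACA.
by rewrite (le_lt_trans (abvD aw _ _)) // [e]splitr ltrD.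
Qed.

Lemma rat_closureM x y : rc x -> rc y -> rc (x * y).
Proof.
move=> hx hy e e0; pose B := w x + w y + 2.
have B0 : 0 < B by rewrite ltr_wpDl ?addr_ge0 ?abv_ge0.
pose a := Num.min 1 (e / B).
have a0 : 0 < a by rewrite lt_min ltr01 divr_gt0.
have [p hp] := hx _ a0; have [q hq] := hy _ a0.
exists (p * q); rewrite -jE rmorphM !jE.
have -> : x * y - ratr p * ratr q =
    (x - ratr p) * y + x * (y - ratr q) - (x - ratr p) * (y - ratr q) by ring.
rewrite (le_lt_trans (abvB aw _ _)) //.
apply: (@le_lt_trans _ _ (w (x - ratr p) * w y + w x * w (y - ratr q) +
    w (x - ratr p) * w (y - ratr q))).
  by rewrite -!abvM // lerD2r abvD.
have aB : a * B <= e by rewrite -ler_pdivlMr // ge_min lexx orbT.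
have a1 : a <= 1 by rewrite ge_min lexx.
apply: lt_le_trans aB; rewrite /B.
have h1 := abv_ge0 aw x; have h2 := abv_ge0 aw y.
have h3 := abv_ge0 aw (x - ratr p); have h4 := abv_ge0 aw (y - ratr q).
move: hp hq h1 h2 h3 h4 a0 a1; move: (w (x - _)) (w (y - _)) (w x) (w y) a => P Q X Y A.
nra.
Qed.

Lemma rat_closureV x : rc x -> rc x^-1.
Proof.
move=> hx e e0; have [->|x0] := eqVneq x 0.
  by exists 0; rewrite -jE rmorph0 invr0 subrr abv0.
have wx : 0 < w x by rewrite abv_gt0.
pose a := Num.min (w x / 2) (e * w x ^+ 2 / 2).
have a0 : 0 < a by rewrite lt_min !divr_gt0 // mulr_gt0 ?exprn_gt0.
have [q hq] := hx _ a0; exists q^-1; rewrite -jE fmorphV jE.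
have lq : w x / 2 < w (ratr q).
  have := abvD aw (x - ratr q) (ratr q); rewrite subrK => h.
  have : a <= w x / 2 by rewrite ge_min lexx.
  by move: h hq; lra.
have q0 : ratr q != 0 :> F.
  by rewrite -(abv_gt0 aw) (lt_trans _ lq) // divr_gt0.
have -> : x^-1 - (ratr q)^-1 = (ratr q - x) / (x * ratr q) by field; rewrite x0 q0.
rewrite abv_div // abvM // abv_distC // ltr_pdivrMr; last first.
  by rewrite mulr_gt0 ?abv_gt0.
apply: (@lt_le_trans _ _ a) => //.
apply: (@le_trans _ _ (e * w x ^+ 2 / 2)); first by rewrite ge_min lexx orbT.
rewrite -mulrA ler_pM2l // expr2 -mulrA ler_pM2l // ltW //.
Qed.

Lemma rat_closureN x : rc x -> rc (- x).
Proof.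
have r1 : -1 = ratr (-1) :> F by rewrite -jE rmorphN1.
by move=> hx; rewrite -mulN1r r1; apply: rat_closureM => //; apply: rat_closure_rat.
Qed.

Lemma rat_closureB x y : rc x -> rc y -> rc (x - y).
Proof. by move=> hx hy; apply/rat_closureD/rat_closureN. Qed.

Lemma rat_closure0 : rc 0.
Proof. by rewrite -(rmorph0 j) jE; apply: rat_closure_rat. Qed.

Lemma rat_closure1 : rc 1.
Proof. by rewrite -(rmorph1 j) jE; apply: rat_closure_rat. Qed.

Lemma rat_closure_sum (I : Type) (r : seq I) (P : pred I) (E : I -> F) :
  (forall i, P i -> rc (E i)) -> rc (\sum_(i <- r | P i) E i).
Proof.
by move=> h; apply: big_ind => //; [exact: rat_closure0|exact: rat_closureD].
Qed.

Lemma rat_closure_det n (A : 'M[F]_n) : (forall i k, rc (A i k)) -> rc (\det A).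
Proof.
move=> hA; apply: rat_closure_sum => s _; apply: rat_closureM.
  rewrite -signr_odd; case: odd; rewrite ?expr1 ?expr0; [apply: rat_closureN|];
    exact: rat_closure1.
by apply: big_ind => //; [exact: rat_closure1|exact: rat_closureM].
Qed.

Lemma rat_closure_invmx n (A : 'M[F]_n) : (forall i k, rc (A i k)) ->
  forall i k, rc (invmx A i k).
Proof.
move=> hA i k; rewrite /invmx; case: ifP => // _.
rewrite !mxE; apply: rat_closureM; first exact/rat_closureV/rat_closure_det.
rewrite /cofactor; apply: rat_closureM.
  rewrite -signr_odd; case: odd; rewrite ?expr1 ?expr0; [apply: rat_closureN|];
    exact: rat_closure1.
by apply: rat_closure_det => a b; rewrite !mxE.
Qed.

End RationalClosure.

Section Places.
Variables (R : realType) (K : fieldExtType rat) (eps : {rmorphism K -> algC}).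
Local Notation d := (\dim {:K}).
Variables (th : K) (nu : 'I_d -> {rmorphism algC -> algC}).
Hypothesis nu_inj : injective (fun i => nu i (eps th)).
Hypothesis th_span : forall y, exists c : 'I_d -> rat, y = \sum_j c j *: th ^+ j.

Local Notation tau i := (nu i \o eps : {rmorphism K -> algC}).

Lemma conj_lin i n (q : 'I_n -> rat) :
  tau i (\sum_j q j *: th ^+ j) = \sum_j ratr (q j) * tau i th ^+ j.
Proof.
by rewrite rmorph_sum; apply: eq_bigr => j _; rewrite rmorphZ_num rmorphXn.
Qed.

(** A transposed Vandermonde matrix. *)
Definition conj_mx c (f : 'I_c -> 'I_d) : 'M[algC]_c := \matrix_(i, j) tau (f i) th ^+ j.

Lemma conj_mx_unit c (f : 'I_c -> 'I_d) : injective f -> conj_mx f \in unitmx.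
Proof.
move=> finj; have -> : conj_mx f = (Vandermonde c (\row_i tau (f i) th))^T.
  by apply/matrixP => i j; rewrite !mxE.
rewrite unitmx_tr unitmxE det_Vandermonde unitfE; apply/prodf_neq0 => i _.
apply/prodf_neq0 => j ij; rewrite !mxE subr_eq0.
by apply: contraTneq ij => /= /nu_inj/finj ->; rewrite ltnn.
Qed.

(** Multiplication by [y] has a rational matrix in the basis of the powers of
   [th], and the conjugates of [y] are the eigenvalues of this matrix. *)
Lemma mul_conj_mx y : exists Q : 'M[rat]_d,
  diag_mx (\row_i tau i y) *m conj_mx id = conj_mx id *m map_mx ratr Q.
Proof.
have row k : exists c : 'I_d -> rat, y * th ^+ k = \sum_j c j *: th ^+ j by exact: th_span.
pose m (k : nat) := projT1 (cid (row k)).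
have mE k : y * th ^+ k = \sum_j m k j *: th ^+ j by rewrite /m; case: cid.
exists (\matrix_(j, k) m k j); apply/matrixP => i k.
rewrite mul_diag_mx !mxE -rmorphXn -rmorphM mE conj_lin.
by apply: eq_bigr => j _; rewrite !mxE mulrC.
Qed.

Lemma trace_rational y : exists q, \sum_i tau i y = ratr q.
Proof.
have [Q DU] := mul_conj_mx y; exists (\tr Q); rewrite -trace_map_mx.
have Uu : conj_mx id \in unitmx by apply: (@conj_mx_unit d).
rewrite -(mulKmx Uu (map_mx _ Q)) -DU mxtrace_mulC mulmxK // mxtrace_diag.
by apply: eq_bigr => i _; rewrite mxE.
Qed.

Lemma norm_rational y : exists q, \prod_i tau i y = ratr q.
Proof.
have [Q DU] := mul_conj_mx y; exists (\det Q); rewrite -det_map_mx.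
have : conj_mx id \in unitmx by apply: (@conj_mx_unit d).
rewrite unitmxE unitfE => Uu; apply: (mulfI Uu).
rewrite -det_mulmx -DU det_mulmx det_diag mulrC.
by congr (_ * _); apply: eq_bigr => i _; rewrite mxE.
Qed.

Variables (o : option nat) (w : algC -> R).
Hypotheses (aw : is_absolute_value w) (w_rat : forall q, w (ratr q) = rat_abs R o q).
Variable c0 : rat.
Hypothesis c0_gt1 : 1 < rat_abs R o c0.

Let aconj i : is_absolute_value (w \o tau i). Proof. exact: abv_comp. Qed.

Let conj_rat i (q : rat) : w (tau i q%:A) = rat_abs R o q.
Proof. by rewrite (rmorph_in_alg (tau i)). Qed.

(** Inverting the matrix of conjugates recovers the coordinates of an element
   from its conjugates. *)
Lemma coord_bound c (f : 'I_c -> 'I_d) : injective f ->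
  exists2 C : R, 0 <= C & forall (q : 'I_c -> rat) j,
    rat_abs R o (q j) <= C * \sum_i w (tau (f i) (\sum_k q k *: th ^+ k)).
Proof.
move=> finj; pose M := conj_mx f; have Mu : M \in unitmx by apply: conj_mx_unit.
have C0 : 0 <= \sum_j \sum_i w (invmx M j i).
  by do 2!apply: sumr_ge0 => ? _; apply: abv_ge0.
exists (\sum_j \sum_i w (invmx M j i)) => // q j; rewrite -w_rat.
set y : K := \sum_k q k *: th ^+ k.
have -> : ratr (q j) = \sum_i invmx M j i * tau (f i) y.
  pose Q : 'cV[algC]_c := \col_k ratr (q k).
  have MQ : M *m Q = \col_i tau (f i) y.
    apply/matrixP => i k; rewrite !mxE conj_lin; apply: eq_bigr => l _.
    by rewrite !mxE mulrC.
  have := mulKmx Mu Q; rewrite MQ => /matrixP/(_ j 0); rewrite !mxE => <-.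
  by apply: eq_bigr => i _; rewrite !mxE.
rewrite (le_trans (abv_sum aw _ _ _)) //.
have S0 i : 0 <= w (tau (f i) y) by apply: abv_ge0.
apply: (@le_trans _ _ (\sum_i w (invmx M j i) * \sum_k w (tau (f k) y))).
  apply: ler_sum => i _; rewrite abvM // ler_wpM2l ?abv_ge0 //.
  by rewrite [leRHS](bigD1 i) //= lerDl; apply: sumr_ge0 => k _; apply: abv_ge0.
rewrite -mulr_suml ler_wpM2r ?sumr_ge0 //.
rewrite [leRHS](bigD1 j) //= lerDl; apply: sumr_ge0 => k _.
by apply: sumr_ge0 => i _; apply: abv_ge0.
Qed.

(** The conjugates of an element control its coordinates, which control its
   size at any place. *)
Lemma abv_dominated (v : K -> R) : is_absolute_value v ->
  (forall q : rat, v q%:A = rat_abs R o q) ->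
  exists2 C : R, 0 <= C & forall y, v y <= C * \sum_i w (tau i y).
Proof.
move=> av v_rat; have [C C0 hC] := @coord_bound d id (inj_id (A:=_)).
have S0 : 0 <= \sum_(k < d) v (th ^+ k).
  by apply: sumr_ge0 => k _; apply: abv_ge0.
exists (C * \sum_(k < d) v (th ^+ k)); first exact: mulr_ge0.
move=> y; have [q Dy] := th_span y.
rewrite mulrAC {1}Dy (le_trans (abv_sum av _ _ _)) // mulr_sumr.
apply: ler_sum => j _; rewrite -mulr_algl abvM // v_rat.
by rewrite ler_wpM2r ?abv_ge0 // Dy hC.
Qed.

Let separated (v u : K -> R) : is_absolute_value v -> is_absolute_value u ->
  (forall q : rat, v q%:A = rat_abs R o q) ->
  (forall q : rat, u q%:A = rat_abs R o q) ->
  u <> v -> exists y, u y < 1 < v y.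
Proof.
move=> av au vq uq; apply: (@abv_separate _ _ _ _ c0%:A) => //.
  by rewrite uq.
by rewrite uq vq.
Qed.

Let outside (v : K -> R) : is_absolute_value v ->
  (forall q : rat, v q%:A = rat_abs R o q) ->
  exists2 x, 1 < v x & forall i, w \o tau i <> v -> w (tau i x) < 1.
Proof.
move=> av vq.
pose us := enum [pred i : 'I_d | `[< w \o tau i <> v >]].
have usP i : reflect (w \o tau i <> v) (i \in us).
  by rewrite mem_enum inE; apply: asboolP.
have [|i _|i /usP ne|x vx ux] :=
    @abv_independence _ _ v c0%:A _ (fun i => w \o tau i) us av.
- by rewrite vq.
- exact: aconj.
- by apply: separated => // q /=; rewrite conj_rat.
by exists x => // i ne; apply: ux; apply/usP.
Qed.

(** An absolute value which is not induced by any conjugation would be large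
   at some element all of whose conjugates are small, which [abv_dominated]
   forbids for the powers of that element. *)
Lemma place_conj (v : K -> R) : is_absolute_value v ->
  (forall q : rat, v q%:A = rat_abs R o q) -> exists i, w \o tau i = v.
Proof.
move=> av vq; apply: contrapT => nv.
have [x vx ux] := outside av vq; have [C C0 hC] := abv_dominated av vq.
have small i : exists k, forall n, (k <= n)%N -> w (tau i x) ^+ n * (C * d%:R + 1) < 1.
  have B0 : 0 < C * d%:R + 1 by rewrite ltr_wpDl ?mulr_ge0 ?ler0n.
  have [||k hk] := @expr_vanishing _ (w (tau i x)) (C * d%:R + 1)^-1.
  - by rewrite abv_ge0 //= ux // => e; apply: nv; exists i.
  - by rewrite invr_gt0.
  by exists k => n /hk h; rewrite -ltr_pdivlMr // div1r.
have [i0 _] : exists i : 'I_d, True by exists (Ordinal (adim_gt0 {:K}%AS)).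
have [k /(_ k (leqnn k)) hk] := list_eventually (fun i (_ : i \in enum 'I_d) => small i).
have {}hk i : w (tau i (x ^+ k)) * (C * d%:R + 1) < 1.
  by rewrite rmorphXn /= abvX // hk // mem_enum.
have := hC (x ^+ k); apply/negP; rewrite -ltNge abvX //.
apply: (@lt_le_trans _ _ 1); last by rewrite exprn_ege1 // ltW.
have B0 : 0 < C * d%:R + 1 by rewrite ltr_wpDl ?mulr_ge0 ?ler0n.
apply: (@le_lt_trans _ _ (C * (d%:R * (C * d%:R + 1)^-1))).
  rewrite ler_wpM2l // mulr_natl -[X in _ *+ X]card_ord -sumr_const ler_sum // => i _.
  by rewrite -[leRHS]mul1r ler_pdivlMr // ltW.
by rewrite mulrA ltr_pdivrMr // mul1r ltrDl.
Qed.

Variable v : K -> R.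
Hypotheses (av : is_absolute_value v) (v_rat : forall q : rat, v q%:A = rat_abs R o q).

Definition conj_over : {set 'I_d} := [set i | `[< w \o tau i = v >]].

Let overP i : reflect (w \o tau i = v) (i \in conj_over).
Proof. by rewrite inE; apply: asboolP. Qed.

(** The witness is [x ^+ k / (1 + x ^+ k)] for an element [x] which is large at
   [v] and small at the other places over the same rational place. *)
Lemma approx_idempotent (e : R) : 0 < e -> exists z, forall i,
  w (tau i z - (i \in conj_over)%:R) < e.
Proof.
move=> e0; have [x vx ux] := outside av v_rat.
have [i0 /overP Di0] : exists i, i \in conj_over.
  by have [i Di] := place_conj av v_rat; exists i; apply/overP.
have [k1 hk1] := expr_unbounded (1 + e^-1) vx.
have small i : i \in enum 'I_d -> exists k, forall n, (k <= n)%N ->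
    i \notin conj_over -> w (tau i x) ^+ n * (1 + e) < e.
  move=> _; have e1 : 0 < 1 + e by rewrite addr_gt0.
  case: (boolP (i \in conj_over)) => [_|/overP ne]; first by exists 0%N.
  have [||k hk] := @expr_vanishing _ (w (tau i x)) (e / (1 + e)).
  - by rewrite abv_ge0 //= ux.
  - by rewrite divr_gt0.
  by exists k => n /hk h _; rewrite -ltr_pdivlMr.
have [k2 hk2] := list_eventually small.
pose k := maxn k1 k2; have {}hk1 := hk1 k (leq_maxl _ _).
have {}hk2 := hk2 k (leq_maxr _ _).
have ei : 0 < e^-1 by rewrite invr_gt0.
have den0 : 1 + x ^+ k != 0.
  rewrite -(abv_gt0 av); have := abvB av (1 + x ^+ k) 1.
  rewrite addrAC subrr add0r abv1 // abvX //; move: hk1 ei.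
  move: (v x ^+ k) e^-1 => a b; lra.
exists (x ^+ k / (1 + x ^+ k)) => i.
have tden0 : tau i (1 + x ^+ k) != 0 by rewrite fmorph_eq0.
have tk : tau i (x ^+ k) = tau i x ^+ k by rewrite rmorphXn.
have tden : tau i (1 + x ^+ k) = 1 + tau i x ^+ k by rewrite rmorphD rmorph1 tk.
rewrite fmorph_div tk tden; rewrite tden in tden0.
have wden : 0 < w (1 + tau i x ^+ k) by rewrite abv_gt0.
case: overP => [Di|ni].
  have -> : tau i x ^+ k / (1 + tau i x ^+ k) - 1 = - (1 + tau i x ^+ k)^-1 by field.
  rewrite abvN // abvV // -[ltRHS]invrK ltf_pV2 ?posrE //.
  have := abvB aw (1 + tau i x ^+ k) 1.
  rewrite addrAC subrr add0r abv1 // abvX //.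
  have -> : w (tau i x) = v x by rewrite -Di.
  by move: hk1; move: (v x ^+ k) => a; lra.
rewrite subr0 abv_div // abvX // ltr_pdivrMr //.
have := abvB aw (1 + tau i x ^+ k) (tau i x ^+ k).
rewrite addrK abv1 // abvX //.
have := hk2 i; rewrite mem_enum => /(_ isT); move/overP: (ni) => ni' /(_ ni').
move: (w (tau i x) ^+ k) (w (1 + _)) => a b; nra.
Qed.

(** Multiplied by an element of [approx_idempotent], [y] has a trace which is
   rational and close to the part of the trace of [y] that belongs to [v]. *)
Lemma local_trace_closure y : rat_closure w (\sum_(i in conj_over) tau i y).
Proof.
move=> e e0; pose B := \sum_i w (tau i y).
have B0 : 0 <= B by apply: sumr_ge0 => i _; apply: abv_ge0.
have B1 : 0 < B + 1 by rewrite ltr_wpDl.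
have [z hz] := approx_idempotent (divr_gt0 e0 B1).
have [q Dq] := trace_rational (z * y); exists q; rewrite -Dq abv_distC //.
have -> : \sum_i tau i (z * y) - \sum_(i in conj_over) tau i y =
    \sum_i (tau i z - (i \in conj_over)%:R) * tau i y.
  rewrite [X in _ - X]big_mkcond -sumrB; apply: eq_bigr => i _.
  by rewrite rmorphM mulrBl; case: ifP; rewrite ?mul1r ?mul0r.
rewrite (le_lt_trans (abv_sum aw _ _ _)) //.
apply: (@le_lt_trans _ _ (\sum_i e / (B + 1) * w (tau i y))).
  by apply: ler_sum => i _; rewrite abvM // ler_wpM2r ?abv_ge0 // ltW.
by rewrite -mulr_sumr mulrAC ltr_pdivrMr // ltr_pM2l // ltrDl.
Qed.

Local Notation c := #|conj_over|.
Let f (i : 'I_c) : 'I_d := enum_val i.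
Let f_inj : injective f. Proof. exact: enum_val_inj. Qed.
Let fv i y : w (tau (f i) y) = v y.
Proof. by have /overP <- := enum_valP i. Qed.

Let sum_f (E : 'I_d -> algC) : \sum_i E (f i) = \sum_(i in conj_over) E i.
Proof. by rewrite [RHS]big_enum_val. Qed.

(** The conjugates of [u] over [v] are combinations of those of the first powers
   of [th]. The coefficients solve a linear system made of local traces, hence
   lie in the closure of the rationals by [local_trace_closure]. *)
Lemma local_span u (e : R) : 0 < e ->
  exists q : 'I_c -> rat, v (u - \sum_j q j *: th ^+ j) < e.
Proof.
move=> e0; pose M := conj_mx f; have Mu : M \in unitmx by apply: conj_mx_unit.
pose b : 'cV[algC]_c := \col_i tau (f i) u.
pose G := M^T *m M; pose be := invmx G *m (M^T *m b).
have Gu : G \in unitmx by rewrite unitmx_mul unitmx_tr Mu.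
have Mbe : M *m be = b.
  apply: (can_inj (mulKmx (_ : M^T \in unitmx))); first by rewrite unitmx_tr.
  by rewrite mulmxA mulKVmx.
have be_rc j : rat_closure w (be j 0).
  rewrite mxE; apply: (rat_closure_sum aw ratr) => k _.
  apply: (rat_closureM aw ratr).
    apply: (rat_closure_invmx aw ratr) => {}j {}k.
    have -> : G j k = \sum_(i in conj_over) tau i (th ^+ (j + k)).
      rewrite -sum_f mxE; apply: eq_bigr => i _.
      by rewrite !mxE rmorphXn exprD.
    exact: local_trace_closure.
  have -> : (M^T *m b) k 0 = \sum_(i in conj_over) tau i (th ^+ k * u).
    rewrite -sum_f mxE; apply: eq_bigr => i _.
    by rewrite !mxE rmorphM rmorphXn.
  exact: local_trace_closure.
have [i0 i0v] : exists i, i \in conj_over.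
  by have [i Di] := place_conj av v_rat; exists i; apply/overP.
pose k0 := enum_rank_in i0v i0.
pose B := \sum_(j < c) v (th ^+ j).
have B0 : 0 <= B by apply: sumr_ge0 => j _; apply: abv_ge0.
have B1 : 0 < B + 1 by rewrite ltr_wpDl.
have ex j : exists q : rat, w (be j 0 - ratr q) < e / (B + 1).
  by apply: be_rc; apply: divr_gt0.
pose q j := projT1 (cid (ex j)).
have hq j : w (be j 0 - ratr (q j)) < e / (B + 1) by rewrite /q; case: cid.
exists q; rewrite -(fv k0) rmorphB conj_lin.
have -> : tau (f k0) u = \sum_j be j 0 * tau (f k0) th ^+ j.
  have /matrixP/(_ k0 0) := Mbe; rewrite !mxE => <-.
  by apply: eq_bigr => j _; rewrite !mxE mulrC.
rewrite -sumrB (le_lt_trans (abv_sum aw _ _ _)) //.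
apply: (@le_lt_trans _ _ (\sum_(j < c) e / (B + 1) * v (th ^+ j))).
  apply: ler_sum => j _; rewrite -mulrBl abvM // -(fv k0) rmorphXn.
  by rewrite ler_wpM2r ?abv_ge0 // ltW.
by rewrite -mulr_sumr mulrAC ltr_pdivrMr // ltr_pM2l // ltrDl.
Qed.

(** With [local_span], this says that the first powers of [th] become a basis of
   the completion over the closure of the rationals. *)
Lemma local_coord_bound : exists2 C : R, 0 <= C & forall (q : 'I_c -> rat) j,
  rat_abs R o (q j) <= C * v (\sum_k q k *: th ^+ k).
Proof.
have [C C0 hC] := coord_bound f_inj; exists (C * c%:R).
  by rewrite mulr_ge0 ?ler0n.
move=> q j; apply: le_trans (hC q j) _; rewrite -mulrA ler_wpM2l //.
by rewrite (eq_bigr _ (fun i _ => fv i _)) sumr_const card_ord mulr_natl.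
Qed.

End Places.

(** * Completions *)
Section RealLimits.
Variable R : realType.

Definition tends (a : nat -> R) (l : R) : Prop :=
  forall e, 0 < e -> exists n0, forall n, (n0 <= n)%N -> `|a n - l| < e.

Lemma tends_uniq a l l' : tends a l -> tends a l' -> l = l'.
Proof.
move=> h h'; apply/eqP; rewrite -subr_eq0 -normr_le0 leNgt; apply/negP => ll.
have e0 : 0 < `|l - l'| / 2 by rewrite divr_gt0.
have [n hn] := h _ e0; have [m hm] := h' _ e0.
have := hn _ (leq_maxl n m); have := hm _ (leq_maxr n m); set k := maxn n m.
have := ler_distD (a k) l l'; rewrite [`|l - a k|]distrC; lra.
Qed.

Lemma tends_le a b l m : tends a l -> tends b m -> (forall n, a n <= b n) -> l <= m.
Proof.
move=> ha hb ab; rewrite leNgt; apply/negP => ml.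
have e0 : 0 < (l - m) / 2 by rewrite divr_gt0 // subr_gt0.
have [n hn] := ha _ e0; have [k hk] := hb _ e0.
have := hn _ (leq_maxl n k); have := hk _ (leq_maxr n k); have := ab (maxn n k).
rewrite !ltr_distl; move=> h /andP[_ h1] /andP[h2 _]; lra.
Qed.

Lemma tends_cst l : tends (fun=> l) l.
Proof. by move=> e e0; exists 0%N => n _; rewrite subrr normr0. Qed.

Lemma tendsD a b l m : tends a l -> tends b m -> tends (fun n => a n + b n) (l + m).
Proof.
move=> ha hb e e0; have e2 : 0 < e / 2 by rewrite divr_gt0.
have [n hn] := ha _ e2; have [k hk] := hb _ e2.
exists (maxn n k) => i; rewrite geq_max => /andP[/hn h1 /hk h2].
by rewrite opprD addrACA (le_lt_trans (ler_normD _ _)) // [e]splitr ltrD.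
Qed.

Lemma tendsM a b l m : tends a l -> tends b m -> tends (fun n => a n * b n) (l * m).
Proof.
move=> ha hb e e0; pose B := `|l| + `|m| + 1.
have B0 : 0 < B by rewrite ltr_wpDl ?addr_ge0.
have e1 : 0 < Num.min 1 (e / B) by rewrite lt_min ltr01 divr_gt0.
have [n hn] := ha _ e1; have [k hk] := hb _ e1.
exists (maxn n k) => i; rewrite geq_max => /andP[/hn h1 /hk h2].
have -> : a i * b i - l * m = (a i - l) * m + l * (b i - m) + (a i - l) * (b i - m).
  by ring.
rewrite (le_lt_trans (ler_normD _ _)) //.
apply: (@le_lt_trans _ _ (`|a i - l| * `|m| + `|l| * `|b i - m| + `|a i - l| * `|b i - m|)).
  by rewrite -!normrM lerD2r ler_normD.
have h3 : Num.min 1 (e / B) * B <= e by rewrite -ler_pdivlMr // ge_min lexx orbT.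
have h4 : Num.min 1 (e / B) <= 1 by rewrite ge_min lexx.
apply: lt_le_trans h3; move: h1 h2 e1 h4; rewrite /B.
have h5 := normr_ge0 (a i - l); have h6 := normr_ge0 (b i - m).
have h7 := normr_ge0 l; have h8 := normr_ge0 m.
move: (Num.min _ _) h5 h6 h7 h8 => A.
move: (`|a i - l|) (`|b i - m|) (`|l|) (`|m|) => P Q X Y; nra.
Qed.

Lemma cauchy_tends (a : nat -> R) :
  (forall e, 0 < e -> exists n0, forall m n, (n0 <= m)%N -> (n0 <= n)%N ->
     `|a m - a n| < e) -> exists l, tends a l.
Proof.
move=> ca; pose S : set R := [set x | exists n0, forall n, (n0 <= n)%N -> x <= a n]%classic.
have near e : 0 < e -> exists n0, forall n, (n0 <= n)%N ->
    S (a n - e) /\ (forall x, S x -> x <= a n + e).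
  move=> e0; have [n0 h] := ca _ e0; exists n0 => n n0n; split.
    by exists n0 => m n0m; have := h _ _ n0m n0n; rewrite ltr_distl => /andP[/ltW].
  move=> x [n1 h1]; have := h1 _ (leq_maxl n1 n0) => /le_trans; apply.
  have := h _ _ (leq_maxr n1 n0) n0n; rewrite ltr_distl => /andP[_ /ltW //].
have [n0 /(_ _ (leqnn _)) [S0 ub0]] := near 1 ltr01.
have supS : has_sup S by split; [exists (a n0 - 1)|exists (a n0 + 1)].
exists (sup S) => e e0; have e2 : 0 < e / 2 by rewrite divr_gt0.
have [n1 h1] := near _ e2; exists n1 => n /h1[Sa ub].
have : sup S <= a n + e / 2 by apply: ge_sup => //; case: supS.
have : a n - e / 2 <= sup S by apply: sup_upper_bound.
rewrite ltr_distl => ? ?; apply/andP; split; lra.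
Qed.

End RealLimits.

Section Completion.
Variables (R : realType) (F : fieldType) (v : F -> R).
Hypothesis av : is_absolute_value v.

Definition cauchy (u : nat -> F) : Prop :=
  forall e : R, 0 < e -> exists n0, forall m n, (n0 <= m)%N -> (n0 <= n)%N ->
    v (u m - u n) < e.

Lemma cauchy_bounded u : cauchy u -> exists2 B, 0 < B & exists n0, forall n, (n0 <= n)%N -> v (u n) <= B.
Proof.
move=> cu; have [n0 h] := cu 1 ltr01; exists (v (u n0) + 1).
  by rewrite ltr_wpDl ?abv_ge0.
exists n0 => n n0n; have := abvD av (u n - u n0) (u n0); rewrite subrK => /le_trans; apply.
by rewrite addrC lerD2l ltW // h.
Qed.

Definition cauchy_pred : {pred (nat -> F)} := fun u => `[< cauchy u >].

Lemma cauchy_subring : subring_closed cauchy_pred.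
Proof.
split; first by apply/asboolP => e e0; exists 0%N => m n _ _; rewrite subrr abv0.
- move=> x y /asboolP hx /asboolP hy; apply/asboolP => e e0.
  have e2 : 0 < e / 2 by rewrite divr_gt0.
  have [n hn] := hx _ e2; have [k hk] := hy _ e2.
  exists (maxn n k) => i j; rewrite !geq_max => /andP[ni ki] /andP[nj kj].
  have -> : (x - y) i - (x - y) j = (x i - x j) - (y i - y j).
    by rewrite -[(x - y) i]/(x i - y i) -[(x - y) j]/(x j - y j); ring.
  by rewrite (le_lt_trans (abvB av _ _)) // [e]splitr ltrD ?hn ?hk.
move=> x y /asboolP hx /asboolP hy; apply/asboolP => e e0.
have [B B0 [n1 hB]] := cauchy_bounded hx; have [C C0 [n2 hC]] := cauchy_bounded hy.
have e2 : 0 < e / (B + C) by rewrite divr_gt0 // addr_gt0.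
have [n hn] := hx _ e2; have [k hk] := hy _ e2.
exists (maxn (maxn n1 n2) (maxn n k)) => i j; rewrite !geq_max.
move=> /andP[/andP[i1 i2] /andP[i3 i4]] /andP[/andP[j1 j2] /andP[j3 j4]].
have -> : (x * y) i - (x * y) j = (x i - x j) * y i + x j * (y i - y j).
  by rewrite -[(x * y) i]/(x i * y i) -[(x * y) j]/(x j * y j); ring.
rewrite (le_lt_trans (abvD av _ _)) // !(abvM av).
have BC : 0 < B + C by rewrite addr_gt0.
have -> : e = e / (B + C) * C + B * (e / (B + C)).
  by rewrite [B * _]mulrC -mulrDr [C + B]addrC mulfVK ?gt_eqF.
apply: ltr_leD.
  by rewrite (le_lt_trans (ler_wpM2l _ (hC _ i2))) ?abv_ge0 // ltr_pM2r // hn.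
by rewrite ler_pM ?abv_ge0 ?hB // ltW // hk.
Qed.

HB.instance Definition _ := GRing.isSubringClosed.Build (nat -> F) cauchy_pred cauchy_subring.

Record cseq := Cseq {cseq_val : nat -> F; cseq_valP : cseq_val \in cauchy_pred}.
HB.instance Definition _ := [isSub for cseq_val].
HB.instance Definition _ := [Choice of cseq by <:].
HB.instance Definition _ := [SubChoice_isSubComNzRing of cseq by <:].

Local Notation val := cseq_val.

Let cP (u : cseq) : cauchy (val u). Proof. by case: u => u /= /asboolP. Qed.

Let limit_exists (u : cseq) : exists l, tends (fun n => v (val u n)) l.
Proof.
apply: cauchy_tends => e e0; have [n0 h] := cP u e0; exists n0 => m n m0 n0'.
by rewrite (le_lt_trans (abv_dist av _ _)) // h.
Qed.

Let lim (u : cseq) : R := projT1 (cid (limit_exists u)).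

Let limP u : tends (fun n => v (val u n)) (lim u).
Proof. by rewrite /lim; case: cid. Qed.

Let lim_ge0 u : 0 <= lim u.
Proof.
apply: tends_le (tends_cst 0) (limP u) _ => n; exact: abv_ge0.
Qed.

Let limM u t : lim (u * t) = lim u * lim t.
Proof.
apply: tends_uniq (limP _) _ => e e0.
have [n0 h] := tendsM (limP u) (limP t) e0; exists n0 => n /h.
by rewrite -abvM.
Qed.

Let limD u t : lim (u + t) <= lim u + lim t.
Proof.
apply: tends_le (limP _) (tendsD (limP u) (limP t)) _ => n; exact: abvD.
Qed.

Let limN u : lim (- u) = lim u.
Proof.
apply: tends_uniq (limP _) _ => e e0.
have [n0 h] := limP u e0; exists n0 => n /h.
by rewrite -(abvN av).
Qed.

Let lim_le u e : (exists n0, forall n, (n0 <= n)%N -> v (val u n) <= e) -> lim u <= e.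
Proof.
case=> n0 h; rewrite leNgt; apply/negP => eL.
have d0 : 0 < lim u - e by rewrite subr_gt0.
have [n1 h1] := limP u d0; have := h1 _ (leq_maxr n0 n1).
by have := h _ (leq_maxl n0 n1); rewrite ltr_distl => ? /andP[? _]; lra.
Qed.

Definition null_pred : {pred cseq} := fun u => lim u == 0.

Let lim0 : lim 0 = 0.
Proof.
by apply/eqP; rewrite eq_le lim_ge0 andbT; apply: lim_le; exists 0%N => n _; rewrite abv0.
Qed.

Let lim_cst (u : cseq) x : (forall n, val u n = x) -> lim u = v x.
Proof.
move=> h; apply: tends_uniq (limP _) _ => e e0.
by exists 0%N => n _; rewrite h subrr normr0.
Qed.

Lemma null_ideal : idealr_closed null_pred.
Proof.
split; rewrite ?inE ?unfold_in ?lim0 //.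
  by rewrite (@lim_cst 1 1) // abv1 // oner_eq0.
move=> a x y; rewrite !unfold_in => /eqP x0 /eqP y0.
by rewrite eq_le lim_ge0 (le_trans (limD _ _)) // limM x0 y0 mulr0 addr0.
Qed.
HB.instance Definition _ := isIdealr.Build cseq null_pred null_ideal.

Local Notation quo := {ideal_quot null_pred}.
Local Notation pi := (\pi_quo%qT).

Let piE (u t : cseq) : pi u = pi t <-> lim (u - t) = 0.
Proof.
split=> [/eqP|e].
  by rewrite -(Quotient.idealrBE null_pred) unfold_in => /eqP.
by apply/eqP; rewrite -(Quotient.idealrBE null_pred) unfold_in e.
Qed.

Let inverse_exists (x : quo) : x != 0 -> exists y, y * x = 1.
Proof.
elim/quotW: x => u u0.
have l0 : lim u != 0.
  apply: contra u0 => /eqP l0; rewrite -(rmorph0 pi); apply/eqP/piE.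
  by rewrite subr0.
have lp : 0 < lim u by rewrite lt0r l0 lim_ge0.
have low : exists n0, forall n, (n0 <= n)%N -> lim u / 2 < v (val u n).
  have l2 : 0 < lim u / 2 by rewrite divr_gt0.
  have [n0 h] := limP u l2; exists n0 => n /h.
  by rewrite ltr_distl => /andP[? _]; lra.
have [n0 h0] := low.
have ci : cauchy (fun n => (val u n)^-1).
  move=> e e0; have l2 : 0 < lim u / 2 by rewrite divr_gt0.
  have e1 : 0 < e * (lim u / 2) ^+ 2 by rewrite mulr_gt0 ?exprn_gt0.
  have [n1 h1] := cP u e1; exists (maxn n0 n1) => m n.
  rewrite !geq_max => /andP[/h0 m0 m1] /andP[/h0 n0' n1'].
  have um : val u m != 0 by rewrite -(abv_gt0 av) (lt_trans l2).
  have un : val u n != 0 by rewrite -(abv_gt0 av) (lt_trans l2).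
  have -> : (val u m)^-1 - (val u n)^-1 = (val u n - val u m) / (val u m * val u n).
    by field; rewrite um un.
  rewrite (abv_div av) (abvM av) ltr_pdivrMr ?mulr_gt0 ?abv_gt0 //.
  apply: lt_trans (h1 _ _ n1' m1) _; rewrite ltr_pM2l // expr2.
  by rewrite ltr_pM // ltW.
pose ui := Cseq (asboolT ci : _ \in cauchy_pred).
exists (pi ui); rewrite -rmorphM -(rmorph1 pi); apply/piE.
apply/eqP; rewrite eq_le lim_ge0 andbT; apply: lim_le; exists n0 => n /h0 hn.
have un : val u n != 0 by rewrite -(abv_gt0 av) (lt_trans _ hn) // divr_gt0.
by rewrite -[val _ n]/((val u n)^-1 * val u n - 1) mulVf // subrr abv0.
Qed.

Let qinv (x : quo) : quo := xget 0 [set y | y * x = 1]%classic.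

Let qmulV (x : quo) : x != 0 -> qinv x * x = 1.
Proof. by move=> /inverse_exists ex; have := xgetPex 0 ex. Qed.

Let qinv0 : qinv 0 = 0.
Proof.
apply: xgetPN => y /= /eqP; rewrite mulr0 eq_sym; exact/negP/oner_neq0.
Qed.

#[local] HB.instance Definition _ := GRing.ComNzRing_isField.Build quo qmulV qinv0.

Let w (x : quo) : R := lim (repr x)%qT.

Let w_pi u : w (pi u) = lim u.
Proof.
have /piE e : pi (repr (pi u))%qT = pi u by rewrite reprK.
have half a b : lim (a - b) = 0 -> lim a <= lim b.
  by move=> ab; rewrite -[a](subrK b) (le_trans (limD _ _)) // ab add0r.
by apply/eqP; rewrite eq_le !half // -limN opprB.
Qed.

Let aw : is_absolute_value w.
Proof.
split=> [x|x|x y|x y]; first exact: lim_ge0.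
- elim/quotW: x => u; rewrite w_pi; split=> [l0|].
    by rewrite -(rmorph0 pi); apply/piE; rewrite subr0.
  by rewrite -(rmorph0 pi) => /piE; rewrite subr0.
- by elim/quotW: x => u; elim/quotW: y => t; rewrite -rmorphM !w_pi limM.
by elim/quotW: x => u; elim/quotW: y => t; rewrite -rmorphD !w_pi limD.
Qed.

Let cst_cauchy (x : F) : cauchy (fun=> x).
Proof. by move=> e e0; exists 0%N => m n _ _; rewrite subrr abv0. Qed.

Let cst (x : F) : cseq := Cseq (asboolT (cst_cauchy x) : _ \in cauchy_pred).

Let iota (x : F) : quo := pi (cst x).

Let cst_ext (s t : cseq) : val s = val t -> s = t.
Proof. exact: val_inj. Qed.

Let iota_zmod : zmod_morphism iota.
Proof.
by move=> x y; rewrite /iota -rmorphB; congr pi; apply: cst_ext.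
Qed.

Let iota_monoid : monoid_morphism iota.
Proof.
split; first by rewrite -(rmorph1 pi); congr pi; apply: cst_ext.
by move=> x y; rewrite /iota -rmorphM; congr pi; apply: cst_ext.
Qed.

Let iotaR : {rmorphism F -> quo} := HB.pack iota
  (GRing.isZmodMorphism.Build F quo iota iota_zmod)
  (GRing.isMonoidMorphism.Build F quo iota iota_monoid).

Let w_iota x : w (iotaR x) = v x.
Proof. by rewrite w_pi; apply: lim_cst. Qed.

Let close_iota (u : cseq) e : 0 < e -> exists n0, forall n, (n0 <= n)%N ->
  w (pi u - iotaR (val u n)) <= e.
Proof.
move=> e0; have [n0 h] := cP u e0; exists n0 => n n0n.
rewrite -rmorphB w_pi; apply: lim_le; exists n0 => m n0m.
by rewrite ltW // -[val _ m]/(val u m - val u n) h.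
Qed.

Let w_dense y e : 0 < e -> exists x, w (y - iotaR x) < e.
Proof.
elim/quotW: y => u e0; have e2 : 0 < e / 2 by rewrite divr_gt0.
have [n0 h] := close_iota u e2; exists (val u n0).
by rewrite (le_lt_trans (h _ (leqnn _))) // [ltRHS]splitr ltrDl.
Qed.

(** Cauchy sequences modulo null sequences. *)
Lemma completion_exists : exists (Kv : fieldType) (w : Kv -> R)
  (iota : {rmorphism F -> Kv}), is_completion v w iota.
Proof.
exists quo, w, iotaR; split=> // u cu.
have ex n : exists x, w (u n - iotaR x) < n.+1%:R^-1 by apply: w_dense; rewrite invr_gt0 ltr0n.
pose x n := projT1 (cid (ex n)).
have hx n : w (u n - iotaR (x n)) < n.+1%:R^-1 by rewrite /x; case: cid.
have cx : cauchy x.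
  move=> e e0; have e3 : 0 < e / 3 by rewrite divr_gt0.
  have [n1 h1] := cu _ e3; have [n2 h2] := inv_succ_vanishing e3.
  exists (maxn n1 n2) => m n; rewrite !geq_max => /andP[m1 /h2 m2] /andP[n1' /h2 n2'].
  rewrite -w_iota rmorphB.
  have -> : iotaR (x m) - iotaR (x n) =
      (u m - u n) - (u m - iotaR (x m)) + (u n - iotaR (x n)) by ring.
  have tri := le_trans (abvD aw _ _) (lerD (abvB aw _ _) (lexx _)).
  rewrite (le_lt_trans (tri _ _ _)) //.
  have -> : e = e / 3 + e / 3 + e / 3 by field.
  by rewrite !ltrD ?h1 // (lt_trans (hx _)).
exists (pi (Cseq (asboolT cx : _ \in cauchy_pred))) => e e0.
have e2 : 0 < e / 2 by rewrite divr_gt0.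
have [n1 h1] := close_iota (Cseq (asboolT cx : _ \in cauchy_pred)) e2.
have [n2 h2] := inv_succ_vanishing e2; exists (maxn n1 n2) => n; rewrite geq_max => /andP[/h1 k1 /h2 k2].
set z := pi _ in k1 *.
have -> : u n - z = u n - iotaR (x n) - (z - iotaR (x n)) by ring.
rewrite (le_lt_trans (abvB aw _ _)) // [e]splitr ltr_leD //.
exact: lt_trans (hx n) k2.
Qed.

End Completion.

(** * Local degrees *)
Section BasisUniqueness.
Variables (F : fieldType) (S : set F).
Hypotheses (S0 : S 0) (S1 : S 1) (SD : forall x y, S x -> S y -> S (x + y))
  (SM : forall x y, S x -> S y -> S (x * y)).

Definition basis_over n (b : 'I_n -> F) : Prop := forall y : F,
  exists! c : {ffun 'I_n -> F}, (forall i, S (c i)) /\ y = \sum_i c i * b i.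

(** The matrices that express the two bases in terms of each other are inverse
   to each other. *)
Lemma basis_over_le m n (a : 'I_m -> F) (b : 'I_n -> F) :
  basis_over a -> basis_over b -> (m <= n)%N.
Proof.
move=> ha hb; pose X i := projT1 (cid (hb (a i))); pose Y j := projT1 (cid (ha (b j))).
have hX i : (forall j, S (X i j)) /\ a i = \sum_j X i j * b j.
  by rewrite /X; case: cid => c [].
have hY j : (forall i, S (Y j i)) /\ b j = \sum_i Y j i * a i.
  by rewrite /Y; case: cid => c [].
apply: (@mulmx1_min _ m n (\matrix_(i, j) X i j) (\matrix_(j, i) Y j i)).
apply/matrixP => i k; rewrite !mxE.
have [c [_ uc]] := ha (a i).
pose d1 : {ffun 'I_m -> F} := [ffun k => \sum_j X i j * Y j k].
pose d2 : {ffun 'I_m -> F} := [ffun k => (i == k)%:R].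
have e1 : c = d1.
  apply: uc; split=> [l|].
    by rewrite ffunE; apply: big_ind => // j _; apply: SM; [case: (hX i)|case: (hY j)].
  rewrite {1}(hX i).2; under [RHS]eq_bigr do rewrite ffunE mulr_suml.
  rewrite exchange_big; apply: eq_bigr => j _ /=.
  by rewrite {1}(hY j).2 mulr_sumr; apply: eq_bigr => l _; rewrite mulrA.
have e2 : c = d2.
  apply: uc; split=> [l|]; first by rewrite ffunE; case: (i == l).
  rewrite (bigD1 i) //= ffunE eqxx mul1r big1 ?addr0 // => l li.
  by rewrite ffunE eq_sym (negPf li) mul0r.
have := congr1 (fun g : {ffun _} => g k) (etrans (esym e1) e2); rewrite !ffunE => <-.
by apply: eq_bigr => j _; rewrite !mxE.
Qed.

End BasisUniqueness.

Section LocalDegree.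
Variables (R : realType) (K : fieldExtType rat) (eps : {rmorphism K -> algC}).
Local Notation d := (\dim {:K}).
Variables (th : K) (nu : 'I_d -> {rmorphism algC -> algC}).
Hypothesis nu_inj : injective (fun i => nu i (eps th)).
Hypothesis th_span : forall y, exists c : 'I_d -> rat, y = \sum_j c j *: th ^+ j.
Variables (o : option nat) (w : algC -> R).
Hypotheses (aw : is_absolute_value w) (w_rat : forall q, w (ratr q) = rat_abs R o q).
Variable c0 : rat.
Hypothesis c0_gt1 : 1 < rat_abs R o c0.
Variable v : K -> R.
Hypotheses (av : is_absolute_value v) (v_rat : forall q : rat, v q%:A = rat_abs R o q).
Local Notation c := #|conj_over eps nu w v|.

Section InCompletion.
Variables (Kv : fieldType) (wv : Kv -> R) (iota : {rmorphism K -> Kv}).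
Hypothesis compl : is_completion v wv iota.

Let awv : is_absolute_value wv. Proof. by case: compl. Qed.
Let wv_iota x : wv (iota x) = v x. Proof. by case: compl. Qed.

Let j : {rmorphism rat -> Kv} := iota \o in_alg K.

Let wv_rat q : wv (ratr q) = rat_abs R o q.
Proof. by rewrite -(rmorph_in_alg iota) wv_iota. Qed.

Let b (k : 'I_c) : Kv := iota (th ^+ k).

Let iota_lin (q : 'I_c -> rat) : iota (\sum_k q k *: th ^+ k) = \sum_k ratr (q k) * b k.
Proof. by rewrite rmorph_sum; apply: eq_bigr => k _; rewrite rmorphZ_num. Qed.

Let B := \sum_k wv (b k).
Let B0 : 0 <= B. Proof. by apply: sumr_ge0 => k _; apply: abv_ge0. Qed.

(** An element of the completion is a limit of combinations with rational
   coefficients; [local_coord_bound] makes these coefficients converge. *)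
Let exist_coord y : exists g : {ffun 'I_c -> Kv},
  (forall i, rat_closure wv (g i)) /\ y = \sum_i g i * b i.
Proof.
have [C C0 hC] := local_coord_bound nu_inj aw w_rat v.
have [_ _ dense complete] := compl.
have inv_gt0 n : 0 < n.+1%:R^-1 :> R by rewrite invr_gt0 ltr0n.
have ex n : exists q : 'I_c -> rat, wv (y - \sum_k ratr (q k) * b k) < n.+1%:R^-1.
  have e2 : 0 < n.+1%:R^-1 / 2 :> R by rewrite divr_gt0.
  have [u hu] := dense y _ e2.
  have [q hq] := local_span nu_inj th_span aw w_rat c0_gt1 av v_rat u e2.
  exists q; rewrite -iota_lin.
  rewrite -[y](subrK (iota u)) -addrA -rmorphB (le_lt_trans (abvD awv _ _)) //.
  by rewrite [ltRHS]splitr ltrD // wv_iota.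
pose q n := projT1 (cid (ex n)).
have hq n : wv (y - \sum_k ratr (q n k) * b k) < n.+1%:R^-1 by rewrite /q; case: cid.
have cau k : forall e : R, 0 < e -> exists n0, forall m n, (n0 <= m)%N -> (n0 <= n)%N ->
    wv (ratr (q m k) - ratr (q n k)) < e.
  move=> e e0; have C1 : 0 < (C + 1) * 2 by rewrite mulr_gt0 // ltr_wpDl.
  have [n0 hn0] := inv_succ_vanishing (divr_gt0 e0 C1); exists n0 => m n /hn0 hm /hn0 hn.
  rewrite -!(fmorph_eq_rat j) -rmorphB fmorph_eq_rat wv_rat.
  rewrite (le_lt_trans (hC (fun k => q m k - q n k) k)) //.
  have le2 : v (\sum_k (q m k - q n k) *: th ^+ k) <= n.+1%:R^-1 + m.+1%:R^-1.
    rewrite -wv_iota iota_lin.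
    have -> : \sum_k ratr (q m k - q n k) * b k =
       (y - \sum_k ratr (q n k) * b k) - (y - \sum_k ratr (q m k) * b k).
      transitivity (\sum_k ratr (q m k) * b k - \sum_k ratr (q n k) * b k); last by ring.
      rewrite -sumrB; apply: eq_bigr => l _.
      by rewrite -!(fmorph_eq_rat j) rmorphB mulrBl.
    by rewrite (le_trans (abvB awv _ _)) // lerD // ltW.
  rewrite (le_lt_trans (ler_wpM2l C0 le2)) //.
  have n0' := inv_gt0 n; have m0' := inv_gt0 m.
  move: hm hn; rewrite !ltr_pdivlMr // => hm hn.
  by move: n0' m0' hm hn; move: (n.+1%:R^-1 : R) (m.+1%:R^-1 : R) => s t; nra.
pose l k := projT1 (cid (complete _ (cau k))).
have hl k : forall e : R, 0 < e -> exists n0, forall n, (n0 <= n)%N ->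
    wv (ratr (q n k) - l k) < e by rewrite /l; case: cid.
exists [ffun k => l k]; split=> [k e e0|].
  rewrite ffunE; have [n0 /(_ n0 (leqnn _)) h] := hl k e e0.
  by exists (q n0 k); rewrite abv_distC.
apply/eqP; rewrite -subr_eq0 -(abv_eq0 awv) eq_le abv_ge0 // andbT.
rewrite leNgt; apply/negP; set X := wv _ => X0.
have e1 : 0 < X / (B + 1) / 2 by rewrite !divr_gt0 // ltr_wpDl.
have [n1 h1] := inv_succ_vanishing (divr_gt0 X0 (ltr0n _ 2)).
have [n2 h2] := list_eventually (fun k (_ : k \in enum 'I_c) => hl k _ e1).
pose n := maxn n1 n2; have {}h1 := h1 n (leq_maxl _ _).
have {}h2 k : wv (ratr (q n k) - l k) < X / (B + 1) / 2.
  by apply: h2; rewrite ?leq_maxr ?mem_enum.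
suff : X < X by rewrite ltxx.
have eX : X = wv ((y - \sum_k ratr (q n k) * b k) + \sum_k (ratr (q n k) - l k) * b k).
  congr wv; under [X in _ = _ + X]eq_bigr do rewrite mulrBl.
  by rewrite sumrB addrA subrK; congr (_ - _); apply: eq_bigr => k _; rewrite ffunE.
rewrite {1}eX (le_lt_trans (abvD awv _ _)) // [ltRHS]splitr ltr_leD //.
  exact: lt_trans (hq n) h1.
rewrite (le_trans (abv_sum awv _ _ _)) //.
apply: (@le_trans _ _ (\sum_k X / (B + 1) / 2 * wv (b k))).
  by apply: ler_sum => k _; rewrite abvM // ler_wpM2r ?abv_ge0 // ltW.
rewrite -mulr_sumr -/B mulrAC ler_pM2r ?invr_gt0 // mulrAC ler_pdivrMr ?ltr_wpDl //.
by rewrite ler_pM2l // lerDl.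
Qed.

Let coord_uniq (g : 'I_c -> Kv) : (forall i, rat_closure wv (g i)) ->
  \sum_i g i * b i = 0 -> forall i, g i = 0.
Proof.
move=> hg g0 i; have [C C0 hC] := local_coord_bound nu_inj aw w_rat v.
apply/eqP; rewrite -(abv_eq0 awv) eq_le abv_ge0 // andbT leNgt; apply/negP => X0.
set X := wv (g i) in X0; have D0 : 0 < 1 + C * B by rewrite ltr_pwDl ?mulr_ge0.
have e0 : 0 < X / (1 + C * B) by rewrite divr_gt0.
pose q k := projT1 (cid (hg k _ e0)).
have hq k : wv (g k - ratr (q k)) < X / (1 + C * B) by rewrite /q; case: cid.
suff : X < X by rewrite ltxx.
have : X <= wv (g i - ratr (q i)) + wv (ratr (q i)) by rewrite /X -{1}[g i](subrK (ratr (q i))) abvD.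
move/le_lt_trans; apply.
have eX : X = X / (1 + C * B) + X / (1 + C * B) * (C * B).
  by field; rewrite gt_eqF.
rewrite [ltRHS]eX ltr_leD // wv_rat (le_trans (hC q i)) // mulrCA ler_wpM2l //.
rewrite -wv_iota iota_lin.
have -> : \sum_k ratr (q k) * b k = - \sum_k (g k - ratr (q k)) * b k.
  by under [X in - X]eq_bigr do rewrite mulrBl; rewrite sumrB g0 sub0r opprK.
rewrite abvN // (le_trans (abv_sum awv _ _ _)) // mulr_sumr.
by apply: ler_sum => k _; rewrite abvM // ler_wpM2r ?abv_ge0 // ltW.
Qed.

Lemma local_basis : basis_over (rat_closure wv) b.
Proof.
move=> y; have [g [gr Dy]] := exist_coord y; exists g; split=> // g' [gr' Dy'].
apply/ffunP => i; apply/eqP; rewrite -subr_eq0; apply/eqP.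
apply: (coord_uniq (g := fun i => g i - g' i)) => [k|].
  exact: (rat_closureB awv j).
by under eq_bigr do rewrite mulrBl; rewrite sumrB -Dy -Dy' subrr.
Qed.

Lemma local_basis_size n (b' : 'I_n -> Kv) : basis_over (rat_closure wv) b' -> n = c.
Proof.
move=> hb'; have le m k (a : 'I_m -> Kv) (a' : 'I_k -> Kv) :=
  @basis_over_le _ _ (rat_closure0 awv j) (rat_closure1 awv j)
    (@rat_closureD _ _ _ awv j) (@rat_closureM _ _ _ awv j) m k a a'.
by apply/eqP; rewrite eqn_leq (le _ _ _ _ hb' local_basis) (le _ _ _ _ local_basis hb').
Qed.

End InCompletion.

(** By [local_basis] the local degree is the number of embeddings that induce
   the place. *)
Theorem local_degreeE : local_degree v = c.
Proof.
have [Kv [wv [iota compl]]] := completion_exists av.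
have ex : exists n, is_local_degree v n.
  exists c, Kv, wv, iota; split=> //; exists (fun k => iota (th ^+ k)).
  exact: local_basis compl.
have := xgetPex 0%N ex; rewrite -/(local_degree v).
move=> [Kv' [wv' [iota' [compl' [b' hb']]]]].
exact: (local_basis_size compl' hb').
Qed.

End LocalDegree.

(** * Absolute values of algebraic numbers over the places of the rationals *)
Section AlgebraicPlaces.
Variable R : realType.

(** One place of the algebraic numbers over each place of the rationals. Since
   all the embeddings of a number field are considered together, the choice
   does not matter. *)
Definition alg_abs (o : option nat) : algC -> R :=
  xget (fun=> 0) [set w | extends_rat o w]%classic.

Lemma alg_absP o : rat_place o -> extends_rat o (alg_abs o).
Proof. by move/(place_exists R) => ex; apply: xgetPex. Qed.

Lemma alg_abs_av o : rat_place o -> is_absolute_value (alg_abs o).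
Proof. by case/alg_absP. Qed.

Lemma alg_abs_rat o q : rat_place o -> alg_abs o (ratr q) = rat_abs R o q.
Proof. by case/alg_absP. Qed.

Lemma alg_abs_max p x y : prime p ->
  alg_abs (Some p) (x + y) <= Num.max (alg_abs (Some p) x) (alg_abs (Some p) y).
Proof. by move=> p_pr; case: (@alg_absP (Some p) p_pr) => _ _; apply. Qed.

Lemma rat_abs_nontrivial o : rat_place o -> exists c, 1 < rat_abs R o c.
Proof.
case: o => [p /= p_pr|_]; last by exists 2; rewrite /= ratr_nat normr_nat ltr1n.
exists (p%:R^-1); have op : rat_place (Some p) by [].
have p1 := prime_gt1 p_pr; have p0 := prime_gt0 p_pr.
rewrite -[X in _ < X](alg_abs_rat _ op) fmorphV /= (abvV (alg_abs_av op)) alg_abs_rat //= /padic_abs.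
rewrite pnatr_eq0 gtn_eqF //.
have -> : p%:R = p%:~R :> rat by [].
rewrite numq_int denq_int logn1 sub0r absz_nat logn_prime // eqxx.
by rewrite -invr_expz invrK expr1z ltr1n.
Qed.

Lemma padic_abs_le1 p q : prime p -> (`|denq q| < p)%N -> padic_abs R p q <= 1.
Proof.
move=> p_pr qp; rewrite /padic_abs; case: ifP => [|q0]; first by rewrite ler01.
have d0 : (0 < `|denq q|)%N by rewrite absz_gt0 denq_neq0.
rewrite lognE p_pr d0 /= gtnNdvd // sub0r.
rewrite -invr_expz invf_le1 ?exprn_gt0 ?ltr0n ?prime_gt0 //.
by rewrite exprn_ege1 // ler1n prime_gt0.
Qed.

(** At a root of absolute value larger than 1 the leading term would dominate all
   the others, whose coefficients are [p]-integral. *)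
Lemma padic_integral p (q : {poly rat}) z : prime p -> q \is monic ->
  (forall i, (`|denq q`_i| < p)%N) -> root (map_poly ratr q) z ->
  alg_abs (Some p) z <= 1.
Proof.
move=> p_pr mq den rz; have op : rat_place (Some p) by [].
have av := alg_abs_av op; rewrite leNgt; apply/negP => z1.
set w := alg_abs (Some p) in av z1.
have z0 : z != 0 by rewrite -(abv_gt0 av) (lt_trans ltr01).
have sumle m (E : nat -> algC) (B : R) : 0 <= B -> (forall i, (i < m)%N -> w (E i) <= B) ->
    w (\sum_(i < m) E i) <= B.
  move=> B0; elim: m => [|m IH] h; first by rewrite big_ord0 abv0.
  rewrite big_ord_recr /= (le_trans (alg_abs_max _ _ p_pr)) // ge_max h // andbT.
  by apply: IH => i im; apply/h/ltnW.
have wn0 n : 0 <= w z ^+ n by rewrite exprn_ge0 ?abv_ge0.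
move: rz; rewrite /root horner_coef size_map_poly.
case sq : (size q) => [|n].
  by move: (monic_neq0 mq); rewrite -size_poly_eq0 sq.
rewrite big_ord_recr /= coef_map /= -[n]/(n.+1.-1) -sq -lead_coefE (monicP mq).
rewrite rmorph1 mul1r sq /= addrC addr_eq0 => /eqP e.
case: n sq e => [|n] sq e.
  by move/eqP: e; rewrite big_ord0 oppr0 expr0 oner_eq0.
have : w z ^+ n.+1 <= w z ^+ n.
  rewrite -(abvX av) e (abvN av).
  apply: (sumle _ (fun i => (map_poly ratr q)`_i * z ^+ i)) => // i im.
  rewrite coef_map /= (abvM av) (abvX av) /w alg_abs_rat // -/w.
  apply: (@le_trans _ _ (w z ^+ i)); first by rewrite ler_piMl // padic_abs_le1.
  by rewrite ler_weXn2l // ltW.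
by rewrite ler_eXn2l // ltnn.
Qed.

(** Conjugation does not change the minimal polynomials of [z] and of its
   inverse, and only finitely many primes occur in their denominators. *)
Lemma padic_unit (z : algC) : z != 0 -> exists n0, forall p, prime p -> (n0 < p)%N ->
  forall nu : {rmorphism algC -> algC}, alg_abs (Some p) (nu z) = 1.
Proof.
have half y : exists n0, forall p, prime p -> (n0 < p)%N ->
    forall nu : {rmorphism algC -> algC}, alg_abs (Some p) (nu y) <= 1.
  have [q [Dq mq] _] := minCpolyP y; exists (\max_(i < size q) `|denq q`_i|%N).
  move=> p p_pr np nu; apply: (padic_integral p_pr mq).
    move=> i; have [iq|qi] := ltnP i (size q); last by rewrite nth_default ?prime_gt1.
    by apply: leq_ltn_trans np; apply: (leq_bigmax (Ordinal iq)).
  by rewrite -Dq -(minCpoly_aut nu) root_minCpoly.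
move=> z0; have [n1 h1] := half z; have [n2 h2] := half z^-1.
exists (maxn n1 n2) => p p_pr; rewrite gtn_max => /andP[p1 p2] nu.
have op : rat_place (Some p) by []; have av := alg_abs_av op.
apply/eqP; rewrite eq_le h1 //=; have := h2 p p_pr p2 nu.
by rewrite fmorphV abvV // invf_le1 // abv_gt0 // fmorph_eq0.
Qed.

Definition rat_places (n : nat) : seq (option nat) :=
  None :: [seq Some p | p <- index_iota 0 n.+1 & prime p].

Lemma mem_rat_places n o : o \in rat_places n = rat_place o && (oapp (fun p => p <= n)%N true o).
Proof.
rewrite in_cons; case: o => [p|] //; rewrite orFb.
by rewrite (mem_map (@Some_inj _)) mem_filter mem_index_iota ltnS //.
Qed.

Lemma rat_places_uniq n : uniq (rat_places n).
Proof.
rewrite cons_uniq (map_inj_uniq (@Some_inj _)) filter_uniq ?iota_uniq // andbT.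
by apply/mapP => -[].
Qed.

Lemma prime_product n m : (0 < m <= n)%N ->
  \prod_(0 <= p < n.+1 | prime p) (p%:R : R) ^+ logn p m = m%:R.
Proof.
case/andP=> m0 mn; rewrite -[in RHS](partnT m0) (widen_partn _ mn) natr_prod.
rewrite [RHS](bigID prime) /= [X in _ = _ * X]big1 ?mulr1; last first.
  by move=> p npr; rewrite lognE (negPf npr).
by apply: eq_big => // p _; rewrite natrX.
Qed.

(** Factorization of the numerator and of the denominator into primes. *)
Lemma rat_product_formula q : q != 0 -> exists n0, forall n, (n0 <= n)%N ->
  \prod_(o <- rat_places n) rat_abs R o q = 1.
Proof.
move=> q0; pose a := `|numq q|%N; pose b := `|denq q|%N.
have a0 : (0 < a)%N by rewrite absz_gt0 numq_eq0.
have b0 : (0 < b)%N by rewrite absz_gt0 denq_neq0.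
exists (maxn a b) => n; rewrite geq_max => /andP[an bn].
rewrite big_cons big_map big_filter /=.
have -> : `|ratr q : R| = a%:R / b%:R.
  by rewrite /ratr normrM normfV -!intr_norm -!abszE.
under eq_bigr => p pr_p.
  have p0 : (p%:R : R) != 0 by rewrite pnatr_eq0 -lt0n prime_gt0.
  rewrite /padic_abs (negPf q0) expfzDr // -invr_expz -!exprnP -/a -/b.
over.
rewrite big_split /= prodfV !prime_product ?a0 ?b0 //.
by field; rewrite !pnatr_eq0 -!lt0n a0 b0.
Qed.

End AlgebraicPlaces.

(** * Heights as products over embeddings *)
(** A primitive element and the automorphisms that induce the embeddings of the
   field; a record because heights are computed in several fields. *)
Record conj_system (K : fieldExtType rat) (eps : {rmorphism K -> algC}) := ConjSystem {
  gen : K;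
  cj : 'I_(\dim {:K}) -> {rmorphism algC -> algC};
  cj_inj : injective (fun i => cj i (eps gen));
  cj_root : forall xi, root (minCpoly (eps gen)) xi -> exists i, xi = cj i (eps gen);
  gen_span : forall y, exists c : 'I_(\dim {:K}) -> rat, y = \sum_j c j *: gen ^+ j }.

Lemma conj_system_exists K eps : inhabited (@conj_system K eps).
Proof. by have [th [nu [h1 h2 h3]]] := conjugates eps; exists; exists th nu. Qed.

Section Norms.
Variables (R : realType) (F : fieldType) (v : F -> R).
Hypothesis av : is_absolute_value v.
Implicit Types s : seq F.

Definition supnorm s : R := \big[Num.max/0]_(a <- s) v a.

Definition euclnorm s : R := Num.sqrt (\sum_(a <- s) v a ^+ 2).

(** The local factor of the height [calH]. *)
Definition mixnorm (o : option nat) s : R := if o is Some _ then supnorm s else euclnorm s.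

Lemma supnorm_ge0 s : 0 <= supnorm s.
Proof.
rewrite /supnorm; elim: s => [|a s IH]; rewrite ?big_nil // big_cons.
by rewrite le_max IH orbT.
Qed.

Lemma supnorm_leP s B : 0 <= B ->
  reflect {in s, forall a, v a <= B} (supnorm s <= B).
Proof.
move=> B0; rewrite /supnorm; elim: s => [|a s IH].
  by rewrite big_nil B0; constructor.
rewrite big_cons ge_max; apply: (iffP andP) => [[h /IH hs] b|h].
  by rewrite inE => /predU1P[->|/hs].
split; first by apply: h; rewrite inE eqxx.
by apply/IH => b bs; apply: h; rewrite inE bs orbT.
Qed.

Lemma supnorm_ge s a : a \in s -> v a <= supnorm s.
Proof. by move=> sa; have /(supnorm_leP _ (supnorm_ge0 s)) := lexx (supnorm s); apply. Qed.

Lemma supnorm_pow s n : (0 < n)%N -> \big[Num.max/0]_(a <- s) v a ^+ n = supnorm s ^+ n.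
Proof.
move=> n0; rewrite /supnorm; elim: s => [|a s IH].
  by rewrite !big_nil expr0n gtn_eqF.
rewrite !big_cons IH -/(supnorm s).
have va := abv_ge0 av a; have sa := supnorm_ge0 s.
by case: (leP (v a) (supnorm s)) => h; [apply/max_idPr|apply/max_idPl];
  rewrite lerXn2r // ltW.
Qed.

Lemma supnorm_unit s : has (fun a => a != 0) s ->
  (forall a, a \in s -> a != 0 -> v a = 1) -> supnorm s = 1.
Proof.
move=> /hasP[a sa a0] h; apply/eqP; rewrite eq_le -{2}(h a sa a0) supnorm_ge // andbT.
apply/supnorm_leP => // b sb; have [->|b0] := eqVneq b 0; first by rewrite abv0.
by rewrite h.
Qed.

End Norms.

Lemma supnorm_map (R : realType) (F F' : fieldType) (v : F -> R) (f : F' -> F) s :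
  supnorm v (map f s) = supnorm (v \o f) s.
Proof. by rewrite /supnorm big_map. Qed.

Lemma euclnorm_map (R : realType) (F F' : fieldType) (v : F -> R) (f : F' -> F) s :
  euclnorm v (map f s) = euclnorm (v \o f) s.
Proof. by rewrite /euclnorm big_map. Qed.

Section Master.
Variables (R : realType) (K : fieldExtType rat) (eps : {rmorphism K -> algC}).
Variable sys : conj_system eps.
Local Notation d := (\dim {:K}).
Local Notation tau i := (cj sys i \o eps : {rmorphism K -> algC}).
Local Notation pl o i := (alg_abs R o \o tau i).

Let tau_rat i q : tau i q%:A = ratr q.
Proof. exact: rmorph_in_alg. Qed.

Lemma place_rat o i q : rat_place o -> pl o i q%:A = rat_abs R o q.
Proof. by move=> op; rewrite -[LHS]/(alg_abs R o (tau i q%:A)) tau_rat alg_abs_rat. Qed.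

Lemma pl_av o i : rat_place o -> is_absolute_value (pl o i).
Proof. by move=> op; apply/abv_comp/alg_abs_av. Qed.

Definition places_over (o : option nat) : set (K -> R) :=
  [set v | is_absolute_value v /\ forall q : rat, v q%:A = rat_abs R o q]%classic.

Lemma places_overE o v : rat_place o -> places_over o v <-> exists i, pl o i = v.
Proof.
move=> op; have [c0 c1] := rat_abs_nontrivial R op; split=> [[av vq]|[i <-]].
  exact: (place_conj (@cj_inj _ _ sys) (@gen_span _ _ sys) (alg_abs_av R op)
    (fun q => alg_abs_rat R q op) c1 av vq).
by split=> [|q]; [apply: pl_av|apply: place_rat].
Qed.

Lemma local_degree_pl o i : rat_place o ->
  local_degree (pl o i) = #|[set j | `[< pl o j = pl o i >]]|.
Proof.
move=> op; have [c0 c1] := rat_abs_nontrivial R op.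
by apply: (local_degreeE (@cj_inj _ _ sys) (@gen_span _ _ sys) (alg_abs_av R op)
    (fun q => alg_abs_rat R q op) c1 (pl_av i op)) => q; apply: place_rat.
Qed.

Lemma padic_abs_nat p n : (0 < n)%N -> padic_abs R p n%:R = (p%:R : R) ^- logn p n.
Proof.
move=> n0; rewrite /padic_abs pnatr_eq0 gtn_eqF //.
have -> : n%:R = n%:~R :> rat by [].
by rewrite numq_int denq_int logn1 sub0r absz_nat -invr_expz.
Qed.

Lemma rat_abs_inj o o' : rat_place o -> rat_place o' ->
  rat_abs R o =1 rat_abs R o' -> o = o'.
Proof.
wlog : o o' / o' -> o.
  move=> h op op' e; case: o op e => [p|] op e; first exact: h.
  by case: o' op' e => // p' op' e; apply/esym/h => // q; rewrite e.
case: o o' => [p|] [p'|] // h.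
- move=> /= pr pr' /(_ p%:R) /=; have p0 := prime_gt0 pr; have p1 := prime_gt1 pr.
  rewrite !padic_abs_nat // logn_prime // eqxx logn_prime //.
  case: eqVneq => [->|_] //; rewrite expr0 invr1 expr1 => /eqP.
  by rewrite invr_eq1 pnatr_eq1 gtn_eqF.
- move=> /= pr _ /(_ p%:R) /=; have p0 := prime_gt0 pr; have p1 := prime_gt1 pr.
  rewrite padic_abs_nat // logn_prime // eqxx ratr_nat normr_nat expr1 => e.
  have : (p%:R^-1 : R) < p%:R.
    rewrite (@lt_trans _ _ 1) ?ltr1n // invf_lt1 ?ltr1n ?ltr0n //.
  by rewrite e ltxx.
by have := h isT.
Qed.

(** The exponent [local_degree v] is the number of embeddings that induce [v],
   which turns a product over places into a product over embeddings. *)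
Lemma places_product (O : pred (option nat)) (os : seq (option nat)) (g : (K -> R) -> R) :
  uniq os -> {in os, forall o, O o} -> (forall o, O o -> rat_place o) ->
  (forall o i, O o -> o \notin os -> g (pl o i) = 1) ->
  \big[*%R/1]_(v \in [set v | exists2 o, O o & places_over o v]%classic)
     g v ^+ local_degree v = \prod_(o <- os) \prod_i g (pl o i).
Proof.
move=> uos osO Op out.
pose S := [seq pl o i | o <- os, i <- enum 'I_d].
have memS o i : o \in os -> pl o i \in S.
  by move=> oos; apply/allpairsP; exists (o, i); rewrite mem_enum.
have Sin v : v \in S -> exists o i, o \in os /\ v = pl o i.
  by case/allpairsP => -[o i] /= [oos _ ->]; exists o, i.
rewrite (@fsbigE _ _ _ _ _ (undup S)) ?undup_uniq //; last first.
- move=> v /= [o Oo /(places_overE _ (Op o Oo))[i <-]]; rewrite mem_undup => nS.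
  rewrite out ?expr1n //; apply: contra nS; exact: memS.
- move=> v /=; rewrite mem_undup => /Sin[o [i [oos ->]]].
  by exists o; rewrite ?osO //; apply/places_overE; [apply/Op/osO|exists i].
transitivity (\prod_(v <- S) g v); last by rewrite big_allpairs_dep; under eq_bigr do rewrite big_enum.
rewrite -[RHS]big_undup_iterop_count [LHS]big_seq_cond [RHS]big_seq_cond.
apply: eq_big => [v|v /andP[vS _]].
  apply/idP/idP => [/andP[-> _]//|/andP[vS _]]; rewrite vS /=; apply/mem_set.
  move: vS; rewrite mem_undup => /Sin[o [i [oos ->]]].
  by exists o; rewrite ?osO //; apply/places_overE; [apply/Op/osO|exists i].
move: vS; rewrite mem_undup => /Sin[o [i [oos ->]]].
rewrite local_degree_pl ?(Op _ (osO _ oos)) // /GRing.exp; congr (iterop _ _ _ _).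
rewrite -sum1_count big_mkcond big_allpairs_dep (bigD1_seq o) //=.
rewrite [X in (_ + X)%N]big1_seq ?addn0; last first.
  move=> o' /andP[no oos']; rewrite big1 // => j _; case: eqP => // e.
  case/eqP: no; apply: rat_abs_inj; rewrite ?(Op _ (osO _ _)) //.
  move=> q; rewrite -(place_rat j) ?(Op _ (osO _ _)) //.
  by rewrite -(place_rat i q (Op _ (osO _ oos))) e.
rewrite big_enum -big_mkcond sum1_card; apply: eq_card => j.
by rewrite inE.
Qed.

Lemma finite_placesE : finite_places R K =
  [set v | exists2 o, isSome o && rat_place o & places_over o v]%classic.
Proof.
apply/seteqP; split=> v /=.
  by move=> [av [p p_pr vq]]; exists (Some p).
by move=> [[p|] //= p_pr [av vq]]; split=> //; exists p.
Qed.

Lemma infinite_placesE : infinite_places R K =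
  [set v | exists2 o, o == None & places_over o v]%classic.
Proof.
apply/seteqP; split=> v /=; first by move=> h; exists None.
by move=> [o /eqP -> h].
Qed.

Lemma placesE : places R K = [set v | exists2 o, rat_place o & places_over o v]%classic.
Proof.
rewrite /places finite_placesE infinite_placesE; apply/seteqP; split=> v /=.
  by move=> [[o /andP[_ op] h]|[o /eqP -> h]]; [exists o|exists None].
by move=> [[p|] op h]; [left; exists (Some p)|right; exists None].
Qed.

Lemma d_gt0 : (0 < d)%N. Proof. exact: (adim_gt0 {:K}%AS). Qed.

Lemma root_pow (x : R) : 0 <= x -> (x `^ d%:R^-1) ^+ d = x.
Proof.
move=> x0; rewrite -powR_mulrn ?powR_ge0 // -powRrM mulVf ?powRr1 //.
by rewrite pnatr_eq0 -lt0n d_gt0.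
Qed.

Lemma local_degree_gt0 o i : rat_place o -> (0 < local_degree (pl o i))%N.
Proof.
move=> op; rewrite local_degree_pl //; apply/card_gt0P; exists i.
by rewrite inE; apply/asboolP.
Qed.

Lemma finite_supnorm1 (s : seq K) : has (fun a => a != 0) s ->
  exists n0, forall p, prime p -> (n0 < p)%N -> forall i, supnorm (pl (Some p) i) s = 1.
Proof.
move=> hs; have ex a : a != 0 -> exists n0, forall p, prime p -> (n0 < p)%N ->
    forall nu : {rmorphism algC -> algC}, alg_abs R (Some p) (nu (eps a)) = 1.
  by move=> a0; apply: padic_unit; rewrite fmorph_eq0.
have [n0 h] : exists n0, forall n, (n0 <= n)%N -> forall a, a \in s ->
    a != 0 -> forall p, prime p -> (n < p)%N -> forall i, pl (Some p) i a = 1.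
  apply: list_eventually => a _; have [a0|a0] := eqVneq a 0.
    by exists 0%N.
  have [n0 h] := ex a a0; exists n0 => n n0n _ p p_pr np i.
  by apply: h => //; apply: leq_ltn_trans np.
exists n0 => p p_pr np i; apply: supnorm_unit => //.
  exact: (@pl_av (Some p)).
by move=> a sa a0; apply: (h n0).
Qed.

Lemma heightH_in_pow (s : seq K) : has (fun a => a != 0) s ->
  exists n0, forall n, (n0 <= n)%N ->
  heightH_in R s ^+ d = \prod_(o <- rat_places n) \prod_i supnorm (pl o i) s.
Proof.
move=> hs; have [n0 h] := finite_supnorm1 hs; exists n0 => n n0n.
rewrite /heightH_in placesE.
rewrite (_ : \big[_/_]_(v \in _) _ = \big[*%R/1]_(v \in
    [set v | exists2 o, rat_place o & places_over o v]%classic) supnorm v s ^+ local_degree v).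
  rewrite (@places_product rat_place (rat_places n)) ?rat_places_uniq //.
  - rewrite root_pow //; apply: prodr_ge0 => o _; apply: prodr_ge0 => i _.
    exact: supnorm_ge0.
  - by move=> o; rewrite mem_rat_places => /andP[].
  - move=> [p|] i //; rewrite mem_rat_places => p_pr; rewrite p_pr /= -ltnNge => np.
    by apply: h => //; apply: leq_ltn_trans np.
apply: eq_fsbigr => v /set_mem /= [o op /(places_overE _ op)[i <-]].
by rewrite /locH supnorm_pow // ?local_degree_gt0 //; apply: pl_av.
Qed.

Lemma calH_in_pow (s : seq K) : has (fun a => a != 0) s ->
  exists n0, forall n, (n0 <= n)%N ->
  calH_in R s ^+ d = \prod_(o <- rat_places n) \prod_i mixnorm (pl o i) o s.
Proof.
move=> hs; have [n0 h] := finite_supnorm1 hs; exists n0 => n n0n.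
rewrite /calH_in finite_placesE infinite_placesE.
rewrite (_ : \big[_/_]_(v \in [set v | exists2 o, isSome o && rat_place o & places_over o v]%classic) _ =
   \prod_(p <- index_iota 0 n.+1 | prime p) \prod_i supnorm (pl (Some p) i) s).
rewrite (_ : \big[_/_]_(v \in _) _ = \prod_i euclnorm (pl None i) s).
- rewrite root_pow; last first.
    apply: mulr_ge0; apply: prodr_ge0 => i _; last exact: sqrtr_ge0.
    by apply: prodr_ge0 => j _; apply: supnorm_ge0.
  by rewrite /rat_places [RHS]big_cons big_map big_filter mulrC.
- transitivity (\big[*%R/1]_(v \in [set v | exists2 o, o == None & places_over o v]%classic)
      euclnorm v s ^+ local_degree v).
    apply: eq_fsbigr => v /set_mem /= [o /eqP -> /(@places_overE None _ isT)[i <-]].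
    rewrite /loccalH /euclnorm -powR_mulrn ?sqrtr_ge0 //.
    have S0 : 0 <= \sum_(a <- s) pl None i a ^+ 2.
      by apply: sumr_ge0 => a _; rewrite exprn_ge0 // abv_ge0 //; apply: pl_av.
    by rewrite -(powR12_sqrt S0) -powRrM mulrC.
  rewrite (@places_product (fun o => o == None) [:: None]) //.
  - by rewrite big_seq1.
  - by move=> o; rewrite inE.
  - by move=> o /eqP ->.
  by move=> o i /eqP ->; rewrite inE.
transitivity (\big[*%R/1]_(v \in
    [set v | exists2 o, isSome o && rat_place o & places_over o v]%classic)
    supnorm v s ^+ local_degree v).
  apply: eq_fsbigr => v /set_mem /= [o /andP[_ op] /(places_overE _ op)[i <-]].
  by rewrite /locH supnorm_pow // ?local_degree_gt0 //; apply: pl_av.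
rewrite (@places_product (fun o => isSome o && rat_place o)
  [seq Some p | p <- index_iota 0 n.+1 & prime p]).
- by rewrite big_map big_filter.
- by have /andP[] := rat_places_uniq n.
- by move=> o /mapP[p]; rewrite mem_filter => /andP[p_pr _] ->.
- by move=> o /andP[].
move=> [p|] i // p_pr np; apply: h => //; apply: leq_ltn_trans n0n _.
rewrite ltnNge; apply: contra np => pn; apply: map_f.
by rewrite mem_filter mem_index_iota; apply/andP; split.
Qed.

End Master.

(** * Independence of the number field and product formula *)
Lemma embed_lin (K : fieldExtType rat) (eps : {rmorphism K -> algC})
    (nu : {rmorphism algC -> algC}) n (c : 'I_n -> rat) th :
  nu (eps (\sum_j c j *: th ^+ j)) = \sum_j ratr (c j) * nu (eps th) ^+ j.
Proof.
rewrite !rmorph_sum; apply: eq_bigr => j _ /=.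
by rewrite (rmorphZ_num eps) (rmorphM nu) (fmorph_rat nu) !rmorphXn.
Qed.

Section BaseChange.
Variables (R : realType) (K E : fieldExtType rat).
Variables (eps : {rmorphism K -> algC}) (epsE : {rmorphism E -> algC}).
Variables (sys : conj_system eps) (sysE : conj_system epsE).
Local Notation d := (\dim {:K}).
Local Notation D := (\dim {:E}).
Let t := eps (gen sys).
Hypothesis tE : exists u, epsE u = t.

Let fiber j := [set i | cj sysE i t == cj sys j t].

Lemma conj_root_aut (nu : {rmorphism algC -> algC}) x : root (minCpoly x) (nu x).
Proof. by rewrite -(minCpoly_aut nu) root_minCpoly. Qed.

(** Automorphisms of the algebraic numbers permute the embeddings of the
   larger field and move any conjugate of the generator of the smaller one to
   any other, so that all fibers of the restriction map have the same size. *)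
Let fiber_le j j' : (#|fiber j| <= #|fiber j'|)%N.
Proof.
have [nu Dnu] : exists nu : {rmorphism algC -> algC}, nu (cj sys j t) = cj sys j' t.
  by apply: conj_aut; rewrite minCpoly_aut conj_root_aut.
have ex i : exists i', nu (cj sysE i (epsE (gen sysE))) = cj sysE i' (epsE (gen sysE)).
  by apply: (cj_root (c := sysE)); rewrite -(minCpoly_aut (cj sysE i)) conj_root_aut.
pose s i := projT1 (cid (ex i)).
have sE i : nu (cj sysE i (epsE (gen sysE))) = cj sysE (s i) (epsE (gen sysE)).
  by rewrite /s; case: cid.
have sy i y : nu (cj sysE i (epsE y)) = cj sysE (s i) (epsE y).
  have [c ->] := gen_span sysE y; rewrite -[LHS]/((nu \o cj sysE i) _).
  by rewrite !embed_lin /= sE.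
have sinj : injective s.
  move=> i i' e; apply: (cj_inj (c := sysE)); apply: (fmorph_inj nu).
  by rewrite !sE e.
rewrite -[X in (X <= _)%N](card_imset _ sinj); apply/subset_leq_card/fintype.subsetP => i' /imsetP[i].
rewrite !inE => /eqP fi ->; have [u Du] := tE.
by rewrite -Du -sy Du fi Dnu.
Qed.

(** Each embedding of the smaller field has the same number [k] of extensions to
   the larger one. *)
Lemma base_change : exists k, [/\ (0 < k)%N, D = (d * k)%N &
  forall Phi : algC -> R,
    \prod_i Phi (cj sysE i t) = (\prod_j Phi (cj sys j t)) ^+ k].
Proof.
have ex i : exists j, cj sysE i t = cj sys j t by apply/cj_root/conj_root_aut.
pose p i := projT1 (cid (ex i)).
have pE i : cj sysE i t = cj sys (p i) t by rewrite /p; case: cid.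
pose j0 : 'I_d := Ordinal (d_gt0 K).
have cardp j : #|[pred i | p i == j]| = #|fiber j0|.
  transitivity #|fiber j|; last by apply/eqP; rewrite eqn_leq !fiber_le.
  apply: eq_card => i; rewrite !inE pE; apply/eqP/eqP => [->//|].
  by apply: (cj_inj (c := sys)).
have DE : D = (d * #|fiber j0|)%N.
  rewrite -[LHS]card_ord -[LHS]sum1_card (partition_big p predT) //=.
  rewrite (eq_bigr (fun=> #|fiber j0|)) => [|j _]; last first.
    by rewrite sum1_card -(cardp j); apply: eq_card => i; rewrite !inE.
  by rewrite sum_nat_const card_ord.
exists #|fiber j0|; split=> // [|Phi].
  by rewrite lt0n; apply: contraTneq (d_gt0 E) => k0; rewrite DE k0 muln0.
rewrite (partition_big p predT) //= -prodrXl; apply: eq_bigr => j _.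
rewrite (eq_bigr (fun=> Phi (cj sys j t))) => [|i /eqP <-]; last by rewrite pE.
by rewrite prodr_const -(cardp j); congr (_ ^+ _); apply: eq_card => i; rewrite !inE.
Qed.

(** The conjugates of an element are the values of a rational polynomial at those
   of the generator. *)
Lemma base_change_seq : exists k, [/\ (0 < k)%N, D = (d * k)%N &
  forall (s : seq K) (Phi : seq algC -> R),
    \prod_i Phi (map (cj sysE i) (map eps s)) =
    (\prod_j Phi (map (cj sys j) (map eps s))) ^+ k].
Proof.
have [k [k0 Dk h]] := base_change; exists k; split=> // s Phi.
pose c y := projT1 (cid (gen_span sys y)).
have cE y : y = \sum_j c y j *: gen sys ^+ j by rewrite /c; case: cid.
pose val y (xi : algC) := \sum_j ratr (c y j) * xi ^+ j.
have valE (nu : {rmorphism algC -> algC}) y : nu (eps y) = val y (nu t).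
  by rewrite {1}[y]cE embed_lin.
have mapE (nu : {rmorphism algC -> algC}) :
    map nu (map eps s) = [seq val y (nu t) | y <- s].
  by rewrite -map_comp; apply: eq_map => y; apply: valE.
under eq_bigr do rewrite mapE.
under [in RHS]eq_bigr do rewrite mapE.
exact: (h (fun xi => Phi [seq val y xi | y <- s])).
Qed.

End BaseChange.

Section HeightFormula.
Variable R : realType.

Let nonzero_map (K : fieldType) (eps : {rmorphism K -> algC}) (s : seq K) :
  has (fun a => a != 0) (map eps s) -> has (fun a => a != 0) s.
Proof.
by move=> /hasP[_ /mapP[a sa ->]]; rewrite fmorph_eq0 => a0; apply/hasP; exists a.
Qed.

(** A generator [t] of the field in which the height is defined stands for that
   field: the height can be computed in any number field that contains [t], so
   that several heights can be compared in a common field. *)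
Lemma heightH_formula s : has (fun a => a != 0) s ->
  exists t : algC, forall (E : fieldExtType rat) (epsE : {rmorphism E -> algC})
    (sysE : conj_system epsE), (exists u, epsE u = t) ->
  exists n0, forall n, (n0 <= n)%N ->
    heightH R s ^+ \dim {:E} =
    \prod_(o <- rat_places n) \prod_i supnorm (alg_abs R o \o cj sysE i) s.
Proof.
rewrite /heightH; case: (num_field_exists s) => K [eps [s1 Ds1 _]] hs.
have [sys] := conj_system_exists eps; exists (eps (gen sys)) => E epsE sysE tE.
have hs1 : has (fun a => a != 0) s1 by apply: (@nonzero_map K eps); rewrite Ds1.
have [n0 h] := heightH_in_pow R sys hs1; exists n0 => n /h {}h.
have [k [k0 DE bc]] := base_change_seq R sysE tE.
rewrite [X in _ ^+ X = _]DE exprM h -prodrXl; apply: eq_bigr => o _; rewrite -Ds1.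
under [RHS]eq_bigr do rewrite -(supnorm_map (alg_abs R o)).
rewrite (bc s1 (supnorm (alg_abs R o))); congr (_ ^+ _); apply: eq_bigr => j _.
by rewrite !supnorm_map.
Qed.

Lemma calH_formula s : has (fun a => a != 0) s ->
  exists t : algC, forall (E : fieldExtType rat) (epsE : {rmorphism E -> algC})
    (sysE : conj_system epsE), (exists u, epsE u = t) ->
  exists n0, forall n, (n0 <= n)%N ->
    calH R s ^+ \dim {:E} =
    \prod_(o <- rat_places n) \prod_i mixnorm (alg_abs R o \o cj sysE i) o s.
Proof.
rewrite /calH; case: (num_field_exists s) => K [eps [s1 Ds1 _]] hs.
have [sys] := conj_system_exists eps; exists (eps (gen sys)) => E epsE sysE tE.
have hs1 : has (fun a => a != 0) s1 by apply: (@nonzero_map K eps); rewrite Ds1.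
have [n0 h] := calH_in_pow R sys hs1; exists n0 => n /h {}h.
have [k [k0 DE bc]] := base_change_seq R sysE tE.
have mm (F : fieldType) (v : algC -> R) (f : F -> algC) o r :
    mixnorm v o (map f r) = mixnorm (v \o f) o r.
  by case: o => [p|] /=; rewrite ?supnorm_map ?euclnorm_map.
rewrite [X in _ ^+ X = _]DE exprM h -prodrXl; apply: eq_bigr => o _; rewrite -Ds1.
under [RHS]eq_bigr do rewrite -(mm algC (alg_abs R o)).
rewrite (bc s1 (mixnorm (alg_abs R o) o)); congr (_ ^+ _); apply: eq_bigr => j _.
by rewrite !mm.
Qed.

(** The norm of [z] is rational, so that this reduces to
   [rat_product_formula]. *)
Lemma product_formula (E : fieldExtType rat) (epsE : {rmorphism E -> algC})
    (sysE : conj_system epsE) (z : E) : z != 0 ->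
  exists n0, forall n, (n0 <= n)%N ->
    \prod_(o <- rat_places n) \prod_i alg_abs R o (cj sysE i (epsE z)) = 1.
Proof.
move=> z0; have [q Dq] := norm_rational (@cj_inj _ _ sysE) (@gen_span _ _ sysE) z.
have q0 : q != 0.
  rewrite -(fmorph_eq0 (ratr : {rmorphism rat -> algC})) /= -Dq.
  by apply/prodf_neq0 => i _; rewrite /= !fmorph_eq0.
have [n0 h] := rat_product_formula R q0; exists n0 => n /h e; rewrite -[RHS]e.
rewrite big_seq [RHS]big_seq; apply: eq_bigr => o; rewrite mem_rat_places => /andP[op _].
by rewrite -alg_abs_rat // -Dq abv_prod //; apply: alg_abs_av.
Qed.

End HeightFormula.

(** * Generic choice of roots of unity *)
Section TriangleConstant.
Variables (R : realType) (F : fieldType) (v : F -> R) (A : bool).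
Hypothesis av : is_absolute_value v.
Hypothesis ultra : ~~ A -> forall x y, v (x + y) <= Num.max (v x) (v y).

(** What the triangle inequality costs for a sum of [n] terms; [A] tells whether
   the absolute value may be archimedean. *)
Definition kap (n : nat) : R := if A then n%:R else 1.

Lemma kap_ge0 n : 0 <= kap n.
Proof. by rewrite /kap; case: A; rewrite ?ler0n ?ler01. Qed.

Lemma kap_ge1 n : (0 < n)%N -> 1 <= kap n.
Proof. by rewrite /kap; case: A; rewrite ?ler1n ?lexx. Qed.

Lemma kapM m n : kap (m * n) = kap m * kap n.
Proof. by rewrite /kap; case: A; rewrite ?natrM ?mulr1. Qed.

Lemma kap_le m n : (m <= n)%N -> kap m <= kap n.
Proof. by rewrite /kap; case: A; rewrite ?ler_nat ?lexx. Qed.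

Lemma kap_sum (I : Type) (r : seq I) (P : pred I) (E : I -> F) B : 0 <= B ->
  (forall i, P i -> v (E i) <= B) ->
  v (\sum_(i <- r | P i) E i) <= kap (count P r) * B.
Proof.
move=> B0 h; rewrite /kap; case: (boolP A) => hA.
  rewrite (le_trans (abv_sum av _ _ _)) // (le_trans (ler_sum _ h)) //.
  by rewrite big_const_seq iter_addr_0 mulr_natl.
rewrite mul1r; apply: (big_ind (fun x => v x <= B)) => //; first by rewrite abv0.
by move=> x y hx hy; rewrite (le_trans (ultra hA _ _)) // ge_max hx.
Qed.

Lemma kap_sum_ord n (E : 'I_n -> F) B : 0 <= B -> (forall i, v (E i) <= B) ->
  v (\sum_i E i) <= kap n * B.
Proof.
move=> B0 h; have := @kap_sum _ (enum 'I_n) predT E B B0 (fun i _ => h i).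
by rewrite big_enum count_predT size_enum_ord.
Qed.

Lemma kapD x y m n B : 0 <= B -> v x <= kap m * B -> v y <= kap n * B ->
  v (x + y) <= kap (m + n) * B.
Proof.
rewrite /kap => B0; case: (boolP A) => hA hx hy.
  by rewrite natrD mulrDl (le_trans (abvD av _ _)) // lerD.
by rewrite (le_trans (ultra hA _ _)) // ge_max hx.
Qed.

End TriangleConstant.

Section PolynomialFunctions.

(** Polynomials satisfy this; it is stable under the constructions below and
   enough to leave the zero set of a function along a line. *)
Definition polyfun a b (Phi : 'M[algC]_(a, b) -> algC) : Prop :=
  forall A B, exists q : {poly algC}, forall t, Phi (A + t *: B) = q.[t].

(** Stated by composition in order to be applied to vectors that depend
   polynomially on parameters. *)
Definition polymap n (P : 'rV[algC]_n -> algC) : Prop :=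
  forall a b (X : 'M[algC]_(a, b) -> 'rV[algC]_n),
    (forall k, polyfun (fun A => X A 0 k)) -> polyfun (fun A => P (X A)).

Section Closure.
Variables a b : nat.
Implicit Types Phi Psi : 'M[algC]_(a, b) -> algC.

Lemma polyfun_cst c : @polyfun a b (fun=> c).
Proof. by move=> A B; exists c%:P => t; rewrite hornerC. Qed.

Lemma polyfun_entry i j : @polyfun a b (fun A => A i j).
Proof.
move=> A B; exists ((A i j)%:P + (B i j) *: 'X) => t.
by rewrite hornerD hornerC hornerZ hornerX !mxE mulrC.
Qed.

Lemma polyfunD Phi Psi : polyfun Phi -> polyfun Psi -> polyfun (fun A => Phi A + Psi A).
Proof.
move=> h h' A B; have [q hq] := h A B; have [q' hq'] := h' A B.
by exists (q + q') => t; rewrite hornerD hq hq'.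
Qed.

Lemma polyfunM Phi Psi : polyfun Phi -> polyfun Psi -> polyfun (fun A => Phi A * Psi A).
Proof.
move=> h h' A B; have [q hq] := h A B; have [q' hq'] := h' A B.
by exists (q * q') => t; rewrite hornerM hq hq'.
Qed.

Lemma eq_polyfun Phi Psi : Phi =1 Psi -> polyfun Phi -> polyfun Psi.
Proof. by move=> e h A B; have [q hq] := h A B; exists q => t; rewrite -e. Qed.

Lemma polyfun_sum (I : Type) (r : seq I) (P : pred I) (Phi : I -> 'M[algC]_(a, b) -> algC) :
  (forall i, polyfun (Phi i)) -> polyfun (fun A => \sum_(i <- r | P i) Phi i A).
Proof.
move=> h; elim: r => [|i r IH].
  by apply: eq_polyfun (polyfun_cst 0) => A; rewrite big_nil.
case Pi: (P i); last by apply: eq_polyfun IH => A; rewrite big_cons Pi.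
by apply: eq_polyfun (polyfunD (h i) IH) => A; rewrite big_cons Pi.
Qed.

Lemma polyfun_prod (I : Type) (r : seq I) (P : pred I) (Phi : I -> 'M[algC]_(a, b) -> algC) :
  (forall i, polyfun (Phi i)) -> polyfun (fun A => \prod_(i <- r | P i) Phi i A).
Proof.
move=> h; elim: r => [|i r IH].
  by apply: eq_polyfun (polyfun_cst 1) => A; rewrite big_nil.
case Pi: (P i); last by apply: eq_polyfun IH => A; rewrite big_cons Pi.
by apply: eq_polyfun (polyfunM (h i) IH) => A; rewrite big_cons Pi.
Qed.

Lemma polyfunX Phi n : polyfun Phi -> polyfun (fun A => Phi A ^+ n).
Proof.
move=> h; apply: eq_polyfun (@polyfun_prod _ (index_enum 'I_n) predT (fun=> Phi) (fun=> h)).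
by move=> A; rewrite prodr_const card_ord.
Qed.

Lemma polyfun_mulmx m n p (X : 'M[algC]_(a, b) -> 'M[algC]_(m, n))
    (Y : 'M[algC]_(a, b) -> 'M[algC]_(n, p)) :
  (forall i j, polyfun (fun A => X A i j)) -> (forall i j, polyfun (fun A => Y A i j)) ->
  forall i j, polyfun (fun A => (X A *m Y A) i j).
Proof.
move=> hX hY i j.
apply: (@eq_polyfun (fun A => \sum_k X A i k * Y A k j)); first by move=> A; rewrite mxE.
by apply: polyfun_sum => k; apply: polyfunM.
Qed.

Lemma polyfun_det n (X : 'M[algC]_(a, b) -> 'M[algC]_n) :
  (forall i j, polyfun (fun A => X A i j)) -> polyfun (fun A => \det (X A)).
Proof.
move=> hX; apply: polyfun_sum => s; apply: polyfunM; first exact: polyfun_cst.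
exact: polyfun_prod.
Qed.

Lemma polyfun_meval n (x : 'I_n -> 'M[algC]_(a, b) -> algC) (P : mpoly n algC) :
  (forall l, polyfun (x l)) -> polyfun (fun A => meval (fun l => x l A) P).
Proof.
move=> hx; pose Phi A := \sum_(m <- msupp P) mcoeff m P * \prod_i x i A ^+ m i.
apply: (@eq_polyfun Phi); first by move=> A; rewrite mevalE.
apply: polyfun_sum => m; apply: polyfunM; first exact: polyfun_cst.
by apply: polyfun_prod => i; apply: polyfunX.
Qed.

Lemma nonroot (q : {poly algC}) (s : seq algC) : q != 0 -> uniq s ->
  (size q <= size s)%N -> exists2 x, x \in s & q.[x] != 0.
Proof.
move=> q0 us qs; apply/hasP; apply: contraLR qs; rewrite -all_predC -ltnNge => /allP h.
apply: max_poly_roots => //; apply/allP => x /h /=; rewrite negbK.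
by move/eqP/rootP.
Qed.

Lemma nonroot_nat (q : {poly algC}) : q != 0 -> exists x, q.[x] != 0.
Proof.
move=> q0; have [||x _ hx] := @nonroot q [seq n%:R | n <- iota 0 (size q)] q0.
- by rewrite map_inj_uniq ?iota_uniq // => m n /eqP; rewrite eqr_nat => /eqP.
- by rewrite size_map size_iota.
by exists x.
Qed.

(** On the line through [A] and [B] both functions are nonzero polynomials. *)
Lemma polyfun_domain Phi Psi A B : polyfun Phi -> polyfun Psi ->
  Phi A != 0 -> Psi B != 0 -> exists C, Phi C * Psi C != 0.
Proof.
move=> hP hQ PA QB; have [q hq] := hP A (B - A); have [q' hq'] := hQ A (B - A).
have nz : q * q' != 0.
  rewrite mulf_neq0 //.
    by apply: contraNneq PA => q0; rewrite -[A]addr0 -(scale0r (B - A)) hq q0 horner0.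
  apply: contraNneq QB => q0; have -> : B = A + 1 *: (B - A) by rewrite scale1r addrC subrK.
  by rewrite hq' q0 horner0.
have [t ht] := nonroot_nat nz; exists (A + t *: (B - A)).
by rewrite hq hq' -hornerM.
Qed.

(** The entries are replaced one after the other: a nonzero polynomial in one
   of them does not vanish at all the roots of unity. *)
Lemma polyfun_unity Phi A : polyfun Phi -> Phi A != 0 ->
  exists2 B, Phi B != 0 & forall i j, exists2 n, (0 < n)%N & B i j ^+ n = 1.
Proof.
move=> hP PA.
suff h (s : seq ('I_a * 'I_b)) : exists2 B, Phi B != 0 &
    forall i j, (i, j) \in s -> exists2 n, (0 < n)%N & B i j ^+ n = 1.
  have [B PB hB] := h (enum {: 'I_a * 'I_b}); exists B => // i j.
  by apply: hB; rewrite mem_enum.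
elim: s => [|[i0 j0] s [B PB hB]]; first by exists A.
have [q hq] := hP (B - B i0 j0 *: delta_mx i0 j0) (delta_mx i0 j0).
have q0 : q != 0.
  by apply: contraNneq PB => q0; rewrite -[B](subrK (B i0 j0 *: delta_mx i0 j0)) hq q0 horner0.
have [z pz] := C_prim_root_exists (ltn0Sn (size q)).
have [||x /mapP[k kN Dx] hx] := @nonroot q [seq z ^+ k | k <- iota 0 (size q).+1] q0.
- rewrite map_inj_in_uniq ?iota_uniq // => k l; rewrite !mem_iota /= => kN lN /eqP.
  by rewrite (eq_prim_root_expr pz) !modn_small // => /eqP.
- by rewrite size_map size_iota.
exists (B - B i0 j0 *: delta_mx i0 j0 + x *: delta_mx i0 j0); first by rewrite hq.
move=> i j; rewrite !mxE; case: (eqVneq (i, j) (i0, j0)) => [[-> ->] _|ne].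
  rewrite !eqxx /= !mulr1 subrr add0r Dx; exists (size q).+1 => //.
  by rewrite exprAC (prim_expr_order pz) expr1n.
rewrite inE (negPf ne) /= => /hB[n n0 hn]; exists n => //.
have -> : (i == i0) && (j == j0) = false by apply: negPf; rewrite -xpair_eqE.
by rewrite !mulr0 subr0 addr0.
Qed.

End Closure.
End PolynomialFunctions.

(** * Isotropic vectors with small coordinates *)
Section QuadraticForm.
Variables (L : nat) (G : 'M[algC]_L).
Hypothesis symG : G^T = G.
Implicit Types x y z : 'rV[algC]_L.

Definition bf x y : algC := (x *m G *m y^T) 0 0.

Lemma bfE x y : bf x y = \sum_j (\sum_i x 0 i * G i j) * y 0 j.
Proof. by rewrite /bf mxE; apply: eq_bigr => j _; rewrite !mxE. Qed.

Lemma bfDl x x' y : bf (x + x') y = bf x y + bf x' y.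
Proof. by rewrite /bf !mulmxDl mxE. Qed.

Lemma bfDr x y y' : bf x (y + y') = bf x y + bf x y'.
Proof. by rewrite /bf linearD mulmxDr mxE. Qed.

Lemma bfZl c x y : bf (c *: x) y = c * bf x y.
Proof. by rewrite /bf -!scalemxAl mxE. Qed.

Lemma bfZr c x y : bf x (c *: y) = c * bf x y.
Proof. by rewrite /bf linearZ -scalemxAr mxE. Qed.

Lemma bfC x y : bf x y = bf y x.
Proof.
rewrite /bf; have -> : y *m G *m x^T = (x *m G *m y^T)^T.
  by rewrite !trmx_mul trmxK symG mulmxA.
by rewrite [RHS]mxE.
Qed.

Local Notation e i := (delta_mx 0 i : 'rV[algC]_L).

Lemma bf_delta i j : bf (e i) (e j) = G i j.
Proof.
rewrite bfE (bigD1 j) //= [X in _ + X]big1 ?addr0 => [|k kj]; last first.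
  by rewrite [e j _ _]mxE (negPf kj) andbF mulr0.
rewrite [e j _ _]mxE !eqxx mulr1 (bigD1 i) //= big1 ?addr0 => [|k ki]; last first.
  by rewrite mxE (negPf ki) andbF mul0r.
by rewrite mxE !eqxx mul1r.
Qed.

Lemma bf_delta_l i y : bf (e i) y = \sum_j G i j * y 0 j.
Proof.
rewrite bfE; apply: eq_bigr => j _; congr (_ * _).
rewrite (bigD1 i) //= big1 ?addr0 => [|k ki]; first by rewrite mxE !eqxx mul1r.
by rewrite mxE (negPf ki) andbF mul0r.
Qed.

Lemma polyfun_bf a b (X Y : 'M[algC]_(a, b) -> 'rV[algC]_L) :
  (forall k, polyfun (fun A => X A 0 k)) -> (forall k, polyfun (fun A => Y A 0 k)) ->
  polyfun (fun A => bf (X A) (Y A)).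
Proof.
move=> hX hY; apply: (@eq_polyfun _ _ (fun A => \sum_j (\sum_i X A 0 i * G i j) * Y A 0 j)).
  by move=> A; rewrite bfE.
apply: polyfun_sum => j; apply: polyfunM => //; apply: polyfun_sum => i.
by apply: polyfunM => //; apply: polyfun_cst.
Qed.

Section Bounds.
Variables (R : realType) (v : algC -> R) (A : bool).
Hypothesis av : is_absolute_value v.
Hypothesis ultra : ~~ A -> forall s t : algC, v (s + t) <= Num.max (v s) (v t).
Variable g : R.
Hypothesis g0 : 0 <= g.
Hypothesis Gg : forall i j, v (G i j) <= g.
Local Notation kap := (kap R A).

Lemma bf_bound x y X Y : 0 <= X -> 0 <= Y -> (forall k, v (x 0 k) <= X) ->
  (forall k, v (y 0 k) <= Y) -> v (bf x y) <= kap (L * L) * (X * g * Y).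
Proof.
move=> X0 Y0 hX hY; rewrite bfE kapM -mulrA.
apply: (kap_sum_ord av ultra) => [|j]; first by rewrite !mulr_ge0 ?kap_ge0.
rewrite abvM // mulrA; apply: ler_pM; rewrite ?abv_ge0 //.
apply: (kap_sum_ord av ultra) => [|i]; first exact: mulr_ge0.
by rewrite abvM // ler_pM ?abv_ge0.
Qed.

(** Cauchy's bound for the roots of a quadratic polynomial. *)
Lemma root_bound al be ga t : al != 0 -> v al <= kap 4 * g -> v be <= kap 4 * g ->
  v ga <= kap 4 * g -> al * t ^+ 2 + be * t + ga = 0 ->
  Num.max 1 (v t) <= kap 8 * (g / v al).
Proof.
move=> al0 hal hbe hga e0; have va : 0 < v al by rewrite abv_gt0.
have k4 : 0 <= kap 4 * g by rewrite mulr_ge0 ?kap_ge0.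
rewrite mulrA ler_pdivlMr //.
have k48 : kap 4 * g <= kap 8 * g by rewrite ler_wpM2r // kap_le.
case: (leP 1 (v t)) => [t1|_]; last by rewrite mul1r (le_trans hal).
have t0 : 0 < v t by rewrite (lt_le_trans ltr01).
rewrite -(ler_pM2r t0) -mulrA mulrCA -expr2 -abvX // -abvM //.
have -> : al * t ^+ 2 = - (be * t + ga) by apply/eqP; rewrite -addr_eq0 addrA e0.
rewrite abvN // -[8%N]/(1 * 4 + 1 * 4)%N.
have h (x : algC) : v x <= kap 4 * g * v t -> v x <= kap (1 * 4) * (g * v t) by rewrite mul1n mulrA.
rewrite -mulrA; apply: (kapD av ultra); first by rewrite mulr_ge0 // ltW.
  by apply: h; rewrite abvM // ler_pM2r.
by apply: h; rewrite (le_trans hga) // ler_peMr.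
Qed.

End Bounds.

Definition rank_ge2 := exists a b c d, G a b * G c d != G a d * G c b.

(** The same bound at all places: this is what makes the height small. *)
Definition small_point (al : algC) (c : nat) x := forall (R : realType) (v : algC -> R) A,
  is_absolute_value v -> (~~ A -> forall s t : algC, v (s + t) <= Num.max (v s) (v t)) ->
  forall g, (forall i j, v (G i j) <= g) -> forall k, v (x 0 k) <= kap R A c * (g / v al).

(** If [e i] is not isotropic, it spans together with some second vector a plane
   on which the form is not degenerate. The two isotropic lines of this plane
   cannot both be orthogonal to [z], as they generate [e i]. *)
Lemma small_isotropic i z : rank_ge2 -> bf (e i) z != 0 ->
  exists x0 al, [/\ bf x0 x0 = 0, bf x0 z != 0, (exists a b, al = G a b), al != 0 &
    small_point al 24 x0].
Proof.
move=> [a [b [c [d abcd]]]] eiz.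
have ge0 (R : realType) (v : algC -> R) (g : R) : is_absolute_value v ->
    (forall i j, v (G i j) <= g) -> 0 <= g.
  by move=> av h; apply: le_trans (h i i); apply: abv_ge0.
have [Gii|Gii] := eqVneq (G i i) 0.
  have [a' [b' ab']] : exists a' b', G a' b' != 0.
    apply: contrapT => h; have h0 k l : G k l = 0.
      by apply/eqP; apply: contraT => kl; exfalso; apply: h; exists k, l.
    by move: abcd; rewrite !h0 !mul0r eqxx.
  exists (e i), (G a' b'); split=> //; [by rewrite bf_delta|by exists a', b'|].
  move=> R v A av ultra g Gg k; have g0 := ge0 R v g av Gg.
  have g1 : 1 <= g / v (G a' b') by rewrite ler_pdivlMr ?abv_gt0 // mul1r.
  apply: le_trans (_ : 1 <= _).
    by rewrite mxE; case: (_ && _); rewrite ?abv1 ?abv0 // ler01.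
  by rewrite -[1]mul1r ler_pM ?kap_ge1.
(* Up to the sign [M] is the polar form of the discriminant of the form on the
   planes that contain [e i]. It does not vanish identically in rank at least 2. *)
pose M k l := G i i * G k l - G i k * G i l.
have Gsym k l : G k l = G l k by rewrite -[in LHS]symG mxE.
have [k [l Mkl]] : exists k l, M k l != 0.
  apply: contrapT => h; have h0 k l : G k l = G i k * G i l / G i i.
    apply: (mulfI Gii); rewrite mulrCA divff // mulr1; apply/eqP; rewrite -subr_eq0.
    by apply: contraT => kl; exfalso; apply: h; exists k, l.
  by move/eqP: abcd; apply; rewrite (h0 a b) (h0 c d) (h0 a d) (h0 c b); ring.
(* A symmetric bilinear form with a nonzero entry [M k l] has a nonzero value on
   the diagonal, at one of [e k], [e l] and [e k + e l]. *)
have [j [ep [k' [ep01 Mw]]]] : exists (j : 'I_L) (ep : algC) (k' : 'I_L),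
    (ep = 0 \/ ep = 1) /\ M j j + ep * (2 * M j k') + ep ^+ 2 * M k' k' != 0.
  have [Mkk|Mkk] := eqVneq (M k k) 0; last first.
    by exists k, 0, k; split; [left|rewrite mul0r addr0 expr0n mul0r addr0].
  have [Mll|Mll] := eqVneq (M l l) 0; last first.
    by exists l, 0, l; split; [left|rewrite mul0r addr0 expr0n mul0r addr0].
  exists k, 1, l; split; first by right.
  by rewrite Mkk Mll mul1r mulr0 add0r addr0 mulf_neq0 // pnatr_eq0.
have [w wE] : exists w, w = e j + ep *: e k' by exists (e j + ep *: e k').
pose be := bf (e i) w; pose ga := bf w w.
have beE : be = G i j + ep * G i k' by rewrite /be wE bfDr bfZr !bf_delta.
have gaE : ga = G j j + ep * G j k' + (ep * G k' j + ep * (ep * G k' k')).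
  by rewrite /ga wE !bfDl !bfDr !bfZl !bfZr !bf_delta; ring.
pose de := sqrtC (be ^+ 2 - G i i * ga).
have de2 : de ^+ 2 = be ^+ 2 - G i i * ga by rewrite sqrtCK.
have de0 : de != 0.
  rewrite sqrtC_eq0; apply: contraNneq Mw => h; apply/eqP.
  rewrite -[RHS]oppr0 -h beE gaE /M [G k' j]Gsym; ring.
pose t (s : algC) := (- be + s * de) / G i i.
have root s : s ^+ 2 = 1 -> G i i * t s ^+ 2 + (2 * be) * t s + ga = 0.
  move=> s1; apply: (mulfI Gii); rewrite mulr0 /t.
  have -> : G i i * (G i i * ((- be + s * de) / G i i) ^+ 2 + 2 * be * ((- be + s * de) / G i i) + ga)
     = s ^+ 2 * de ^+ 2 - be ^+ 2 + G i i * ga by field.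
  by rewrite s1 de2; ring.
pose x s := t s *: e i + w.
have isoS s : s ^+ 2 = 1 -> bf (x s) (x s) = 0.
  move=> s1; rewrite -[RHS](root s s1) /x !bfDl !bfDr !bfZl !bfZr bf_delta.
  by rewrite [bf w (e i)]bfC -/be -/ga; ring.
have [s [s1 xz]] : exists s, s ^+ 2 = 1 /\ bf (x s) z != 0.
  have [h1|h1] := eqVneq (bf (x 1) z) 0; last by exists 1; rewrite expr1n.
  exists (-1); rewrite sqrrN expr1n; split=> //.
  apply: contraNneq eiz => h2; apply/eqP.
  have h3 : (t 1 - t (-1)) * bf (e i) z = 0.
    rewrite mulrBl; have := subrr (0 : algC); rewrite -{1}h1 -h2 /x !bfDl !bfZl => <-; ring.
  have t0 : t 1 - t (-1) != 0.
    have -> : t 1 - t (-1) = 2 * de / G i i by rewrite /t; field.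
    by rewrite !mulf_neq0 ?invr_eq0 ?pnatr_eq0.
  by apply: (mulfI t0); rewrite h3 mulr0.
exists (x s), (G i i); split=> //; [exact: isoS|by exists i, i|].
move=> R v A av ultra g Gg m; have g0 := ge0 R v g av Gg.
have vep : v ep <= 1 by case: ep01 => ->; rewrite ?abv0 ?abv1 ?ler01.
have one (y : algC) : v y <= g -> v y <= kap R A 1 * g.
  by rewrite /kap; case: (A); rewrite mul1r.
have epg (y : algC) : v y <= g -> v (ep * y) <= g.
  by move=> yg; rewrite abvM // (le_trans _ yg) // ler_piMl ?abv_ge0.
have hal : v (G i i) <= kap R A 4 * g.
  by rewrite (le_trans (Gg i i)) // ler_peMl ?kap_ge1.
have hbe : v (2 * be) <= kap R A 4 * g.
  have -> : 2 * be = (G i j + ep * G i k') + (G i j + ep * G i k') by rewrite beE; ring.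
  by rewrite -[4%N]/((1 + 1) + (1 + 1))%N; do ?[apply: (kapD av ultra) => //]; apply: one; rewrite ?epg.
have hga : v ga <= kap R A 4 * g.
  rewrite gaE -[4%N]/((1 + 1) + (1 + 1))%N.
  by do ?[apply: (kapD av ultra) => //]; apply: one; rewrite ?epg.
have := root_bound av ultra g0 Gii hal hbe hga (root s s1); set X := _ * _; move=> hX.
have X1 : 1 <= X by rewrite (le_trans _ hX) // le_max lexx.
have tX : v (t s) <= X by rewrite (le_trans _ hX) // le_max lexx orbT.
have X0 : 0 <= X by rewrite (le_trans ler01).
have bool1 (B : bool) (y : algC) : v y <= X -> v (y * B%:R) <= kap R A 1 * X.
  move=> yX; apply: (@le_trans _ _ X); last by rewrite ler_peMl ?kap_ge1.
  by case: B; rewrite ?mulr1 // mulr0 abv0.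
(* A coordinate of [x s] is a sum of three terms, each bounded by the estimate
   [kap R A 8 * (g / v al)] for the root. *)
have -> : kap R A 24 * (g / v (G i i)) = kap R A (1 + (1 + 1)) * X.
  by rewrite -[24%N]/(3 * 8)%N kapM -mulrA.
rewrite /x wE !mxE; do ?[apply: (kapD av ultra) => //].
- exact: bool1.
- by rewrite -[X in v X]mul1r; apply: bool1; rewrite abv1.
by apply: bool1; rewrite (le_trans vep).
Qed.

Definition unimodular x := forall k, exists2 n, (0 < n)%N & x 0 k ^+ n = 1.

Lemma unimodular_abv (R : realType) (v : algC -> R) x k :
  is_absolute_value v -> unimodular x -> v (x 0 k) = 1.
Proof. by move=> av ux; have [n n0 xn] := ux k; apply: abv_unity n0 xn. Qed.

(** A polynomial parametrization [phi] of isotropic vectors, with small values at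
   the vectors of roots of unity. Since it multiplies an isotropic [w] by
   [ell w], it reaches every isotropic direction at which [ell] does not
   vanish. *)
Definition good_param (phi : 'rV[algC]_L -> 'rV[algC]_L) (ell : 'rV[algC]_L -> algC) al :=
  [/\ forall y, bf (phi y) (phi y) = 0,
      forall k, polymap (fun y => phi y 0 k), polymap ell,
      forall w, bf w w = 0 -> phi w = ell w *: w &
      (exists a b, al = G a b) /\ al != 0 /\
      forall (R : realType) (v : algC -> R) A, is_absolute_value v ->
        (~~ A -> forall s t : algC, v (s + t) <= Num.max (v s) (v t)) ->
      forall g, (forall i j, v (G i j) <= g) -> forall y, unimodular y ->
      forall k, v (phi y 0 k) <= kap R A (72 * (L * L)) * (g * (g / v al))].

(** Up to the factor [bf y y], the image of [y] is the reflection of [x0] in the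
   hyperplane orthogonal to [y]. *)
Lemma reflection_param x0 al : (exists a b, al = G a b) -> al != 0 -> bf x0 x0 = 0 ->
  small_point al 24 x0 ->
  good_param (fun y => bf y y *: x0 - (2 * bf x0 y) *: y) (fun w => - (2 * bf x0 w)) al.
Proof.
move=> alG al0 x00 sx0; split=> //.
- move=> y; rewrite !bfDl !bfDr -!scaleNr !bfZl !bfZr x00 [bf y x0]bfC; ring.
- move=> k a b X hX; apply: (@eq_polyfun _ _ (fun A => bf (X A) (X A) * x0 0 k +
      (-2) * (bf x0 (X A) * X A 0 k))).
    by move=> A; rewrite !mxE; ring.
  apply: polyfunD; first by apply: polyfunM; [exact: polyfun_bf|exact: polyfun_cst].
  apply: polyfunM; first exact: polyfun_cst.
  by apply: polyfunM => //; apply: polyfun_bf => // l; apply: polyfun_cst.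
- move=> a b X hX; apply: (@eq_polyfun _ _ (fun A => (-2) * bf x0 (X A))).
    by move=> A; ring.
  apply: polyfunM; first exact: polyfun_cst.
  by apply: polyfun_bf => // l; apply: polyfun_cst.
- by move=> w w0; rewrite w0 scale0r sub0r scaleNr.
split=> //; split=> // R v A av ultra g Gg y uy k.
have g0 : 0 <= g by apply: le_trans (Gg k k); apply: abv_ge0.
have hx := sx0 R v A av ultra g Gg; set X := kap R A 24 * _ in hx.
have X0 : 0 <= X by rewrite /X mulr_ge0 ?kap_ge0 // divr_ge0 ?abv_ge0.
have y1 l : v (y 0 l) <= 1 by rewrite unimodular_abv.
have hyy := bf_bound av ultra g0 Gg ler01 ler01 y1 y1.
have hxy := bf_bound av ultra g0 Gg X0 ler01 hx y1.
(* Three terms, in which a sum of [L * L] products is multiplied by a coordinate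
   of [x0] bounded with the constant 24. *)
have -> : kap R A (72 * (L * L)) * (g * (g / v al)) = kap R A (1 + (1 + 1)) * (kap R A (L * L) * (X * g)).
  by rewrite /X -[72%N]/(3 * 24)%N 2!kapM; ring.
have B0 : 0 <= kap R A (L * L) * (X * g) by apply: mulr_ge0; [exact: kap_ge0|exact: mulr_ge0].
have one (s : algC) B : v s <= B -> 0 <= B -> v s <= kap R A 1 * B.
  by move=> sB B0'; rewrite (le_trans sB) // ler_peMl ?kap_ge1.
have t2 : v (- (bf x0 y * y 0 k)) <= kap R A (L * L) * (X * g).
  rewrite abvN // abvM // -[leRHS]mulr1 ler_pM ?abv_ge0 //.
  by move: hxy; rewrite mulr1.
rewrite !mxE; have -> : bf y y * x0 0 k - 2 * bf x0 y * y 0 k =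
  bf y y * x0 0 k + (- (bf x0 y * y 0 k) + - (bf x0 y * y 0 k)) by ring.
do ?[apply: (kapD av ultra) => //]; apply: one => //.
rewrite abvM // [X * g]mulrC mulrA ler_pM ?abv_ge0 //.
by move: hyy; rewrite mul1r mulr1.
Qed.

(** In rank one the form is a multiple of the square of one of its rows, and
   isotropic vectors are the kernel of that row. *)
Lemma rank_one_param i : ~ rank_ge2 -> G i i != 0 ->
  good_param (fun y => G i i *: y - bf (e i) y *: e i) (fun=> G i i) (G i i).
Proof.
move=> nr Gii.
have minor a b c d : G a b * G c d = G a d * G c b.
  by apply/eqP; apply: contraT => h; case: nr; exists a, b, c, d.
have bfi x y : G i i * bf x y = bf (e i) x * bf (e i) y.
  rewrite bfE !bf_delta_l mulr_sumr [RHS]mulr_sumr; apply: eq_bigr => k _.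
  rewrite !mulrA; congr (_ * _); rewrite mulr_sumr mulr_suml; apply: eq_bigr => l _.
  have e1 : G i i * G l k = G i k * G i l.
    by rewrite minor; congr (_ * _); rewrite -[in LHS]symG mxE.
  by rewrite mulrCA e1; ring.
split.
- move=> y; apply: (mulfI Gii); rewrite bfi mulr0.
  have -> : bf (e i) (G i i *: y - bf (e i) y *: e i) = 0.
    by rewrite bfDr -scaleNr !bfZr bf_delta; ring.
  by rewrite mul0r.
- move=> k a b X hX; apply: (@eq_polyfun _ _ (fun A => G i i * X A 0 k +
      (-1) * (bf (e i) (X A) * e i 0 k))).
    by move=> A; rewrite !mxE; ring.
  apply: polyfunD; first by apply: polyfunM => //; exact: polyfun_cst.
  apply: polyfunM; first exact: polyfun_cst.
  apply: polyfunM; last exact: polyfun_cst.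
  by apply: polyfun_bf => // l; apply: polyfun_cst.
- by move=> a b X hX; apply: polyfun_cst.
- move=> w w0; have : bf (e i) w * bf (e i) w = 0 by rewrite -bfi w0 mulr0.
  by move/eqP; rewrite mulf_eq0 orbb => /eqP ->; rewrite scale0r subr0.
split; first by exists i, i.
split=> // R v A av ultra g Gg y uy k.
have g0 : 0 <= g by apply: le_trans (Gg k k); apply: abv_ge0.
have y1 l : v (y 0 l) <= 1 by rewrite unimodular_abv.
have L0 : (0 < L)%N by apply: leq_ltn_trans (ltn_ord i).
have g1 : 1 <= g / v (G i i) by rewrite ler_pdivlMr ?abv_gt0 // mul1r.
apply: (@le_trans _ _ (kap R A (1 + L) * g)); last first.
  rewrite [X in _ <= _ * X]mulrC mulrA ler_wpM2r // -[leLHS]mulr1 ler_pM ?kap_ge0 //.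
  by apply: kap_le; move: L0; case: (L) => // n _; rewrite !mulSn; lia.
rewrite !mxE; apply: (kapD av ultra) => //.
  rewrite abvM // (le_trans (ler_pM _ _ (Gg i i) (y1 k))) ?abv_ge0 // mulr1.
  by rewrite ler_peMl ?kap_ge1.
rewrite abvN // abvM //.
apply: (@le_trans _ _ (v (bf (e i) y))).
  by rewrite ler_piMr ?abv_ge0 //; case: (_ && _); rewrite ?abv1 ?abv0 ?ler01.
rewrite bf_delta_l; apply: (kap_sum_ord av ultra) => // l.
by rewrite abvM // -[leRHS]mulr1 ler_pM ?abv_ge0.
Qed.

Lemma polymap_line P x y : polymap P -> exists q : {poly algC}, forall t, P (x + t *: y) = q.[t].
Proof.
move=> pP; apply: (pP 1%N L id) => k; exact: polyfun_entry.
Qed.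

Lemma good_param_exists P zeta : G != 0 -> polymap P ->
  bf zeta zeta = 0 -> P zeta != 0 ->
  exists phi ell al z, [/\ good_param phi ell al, bf z z = 0, P z != 0 & ell z != 0].
Proof.
move=> G0 pP z0 Pz.
have /matrix0Pn[a [b Gab]] := G0.
case: (pselect rank_ge2) => [r2|nr]; last first.
  have Gaa : G a a != 0.
    apply: contra_notN nr => /eqP Gaa; exists a, a, b, b; rewrite Gaa mul0r eq_sym.
    by rewrite -{2}symG mxE mulf_neq0.
  exists (fun y => G a a *: y - bf (e a) y *: e a), (fun=> G a a), (G a a), zeta.
  by split=> //; apply: rank_one_param.
(* If zeta is in the radical, moving it along an isotropic vector which is not
   keeps it isotropic. *)
have [z [i [zz Pz' ziz]]] : exists z i, [/\ bf z z = 0, P z != 0 & bf (e i) z != 0].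
  case: (pselect (exists i, bf (e i) zeta != 0)) => [[i hi]|rad]; first by exists zeta, i.
  have {}rad x : bf x zeta = 0.
    rewrite bfE; under eq_bigr do rewrite mulr_suml; rewrite exchange_big big1 // => k _ /=.
    under eq_bigr do rewrite -mulrA; rewrite -mulr_sumr -bf_delta_l.
    by apply/eqP; rewrite mulf_eq0; apply/orP; right; apply: contraT => h; case: rad; exists k.
  have [x [al [xx xb _ _ _]]] := @small_isotropic a (e b) r2 (etrans (congr1 (fun u => u != 0) (bf_delta a b)) Gab).
  have [q hq] := polymap_line zeta x pP.
  have q0 : q * 'X != 0.
    rewrite mulf_neq0 ?polyX_eq0 //; apply: contraNneq Pz => q0.
    by rewrite -[zeta]addr0 -(scale0r x) hq q0 horner0.
  have [s] := nonroot_nat q0; rewrite hornerM hornerX mulf_eq0 negb_or => /andP[qs s0].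
  exists (zeta + s *: x), b; split; last 2 first.
  - by rewrite hq.
  - by rewrite bfDr rad add0r bfZr bfC mulf_neq0.
  by rewrite !bfDl !bfDr z0 !bfZl !bfZr xx rad (bfC zeta) rad; ring.
have [x0 [al [x00 x0z alG al0 sx0]]] := small_isotropic r2 ziz.
exists (fun y => bf y y *: x0 - (2 * bf x0 y) *: y), (fun w => - (2 * bf x0 w)), al, z.
split=> //; first exact: reflection_param.
by rewrite oppr_eq0 mulf_neq0 // pnatr_eq0.
Qed.

(** The vectors of [S] orthogonal to [z] form a subspace of codimension at most
   1, which is compensated by [z] itself. *)
Lemma isotropic_extend m (S : 'M[algC]_(m, L)) z : row_free S -> S *m G *m S^T = 0 ->
  bf z z = 0 -> exists S' : 'M[algC]_L,
  [/\ S' *m G *m S'^T = 0, (z <= S')%MS & (m <= \rank S')%N].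
Proof.
move=> fS S0 z0; pose K := kermx (G *m z^T); pose S' := ((S :&: K) + z)%MS.
have zGz : z *m G *m z^T = 0.
  by apply/matrixP => i j; rewrite !ord1 [RHS]mxE; exact: z0.
have flip y : y *m G *m z^T = 0 -> z *m G *m y^T = 0.
  by move=> yz; apply: trmx_inj; rewrite !trmx_mul trmxK symG trmx0 mulmxA.
have inS' (x : 'rV[algC]_L) : (x <= S')%MS ->
    exists2 y, [/\ (y <= S)%MS, y *m G *m z^T = 0 & z *m G *m y^T = 0] &
    exists c, x = y + c *: z.
  case/sub_addsmxP => -[u1 u2] /= ->; exists (u1 *m (S :&: K)%MS); last first.
    by exists (u2 0 0); congr (_ + _); rewrite {1}[u2]mx11_scalar mul_scalar_mx.
  have yz : u1 *m (S :&: K)%MS *m G *m z^T = 0.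
    by rewrite -[_ *m G *m _]mulmxA; apply/sub_kermxP/(submx_trans (submxMl _ _))/capmxSr.
  split=> //; first exact/(submx_trans (submxMl _ _))/capmxSl.
  exact: flip.
exists S'; split; last 2 first.
- exact: addsmxSr.
- have rK : (L - 1 <= \rank K)%N.
    rewrite /K mxrank_ker leq_sub2l // (leq_trans (rank_leq_col _)) //.
  have [zS|nzS] := boolP (z <= S)%MS.
    have SK : (S <= K)%MS.
      apply/sub_kermxP; have [u ->] := submxP zS.
      by rewrite trmx_mul !mulmxA S0 mul0mx.
    have : (S <= S')%MS by rewrite (submx_trans _ (addsmxSl _ _)) // sub_capmx submx_refl.
    by move/mxrankS; rewrite (eqP fS).
  have cap0 : \rank ((S :&: K) :&: z)%MS = 0%N.
    apply/eqP; rewrite mxrank_eq0; apply: contraNT nzS => nz.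
    have rz : (\rank z <= \rank ((S :&: K) :&: z)%MS)%N.
      by rewrite (leq_trans (rank_leq_row _)) // lt0n mxrank_eq0.
    have e1 := mxrank_leqif_sup (capmxSr (S :&: K)%MS z).
    have : (z <= (S :&: K) :&: z)%MS by rewrite -(geq_leqif e1).
    move/submx_trans; apply; exact/(submx_trans (capmxSl _ _))/capmxSl.
  have := mxrank_sum_cap (S :&: K)%MS z; rewrite cap0 addn0 => ->.
  have := mxrank_sum_cap S K; have := rank_leq_col (S + K)%MS.
  have z1 : \rank z = 1%N.
    apply/eqP; rewrite eqn_leq rank_leq_row lt0n mxrank_eq0.
    by apply: contraNneq nzS => ->; rewrite sub0mx.
  by rewrite z1 (eqP fS); move: rK; lia.
have pair (x y : 'rV[algC]_L) : (x <= S')%MS -> (y <= S')%MS -> x *m G *m y^T = 0.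
  move=> /inS'[x1 [x1S x1z zx1] [c ->]] /inS'[y1 [y1S y1z zy1] [c' ->]].
  have xy : x1 *m G *m y1^T = 0.
    have [u ->] := submxP x1S; have [u' ->] := submxP y1S.
    by rewrite trmx_mul -!mulmxA (mulmxA S) (mulmxA (S *m G)) S0 mul0mx mulmx0.
  rewrite linearD linearZ /= !mulmxDl !mulmxDr -!scalemxAl -!scalemxAr.
  by rewrite xy x1z zy1 zGz !scaler0 !addr0.
apply/matrixP => i j; have := pair _ _ (row_sub i S') (row_sub j S').
rewrite -row_mul => /matrixP/(_ 0 0); rewrite mxE [X in _ = X]mxE => h.
rewrite mxE [RHS]mxE -[RHS]h; apply: eq_bigr => k _.
by rewrite [row i _ 0 k]mxE [S'^T k j]mxE [(row j S')^T k 0]mxE [row j S' 0 k]mxE.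
Qed.

(** The nonvanishing of [P] and linear independence are polynomial conditions on
   the parameters, which can be roots of unity as soon as each condition holds
   for some parameters. For the first these are copies of the zero [z], which
   the parametrization only multiplies by a scalar; for the second they are
   generic vectors of the isotropic space of [isotropic_extend], on which it
   does the same because this space contains [z]. *)
Theorem small_isotropic_points m (S : 'M[algC]_(m, L)) P zeta :
  G != 0 -> row_free S -> S *m G *m S^T = 0 -> polymap P ->
  (forall c x, c != 0 -> P x != 0 -> P (c *: x) != 0) ->
  bf zeta zeta = 0 -> P zeta != 0 ->
  exists (X : 'M[algC]_(m, L)) al, [/\ row_free X,
    forall i, bf (row i X) (row i X) = 0, forall i, P (row i X) != 0 &
    (exists a b, al = G a b) /\ al != 0 /\
      forall (R : realType) (v : algC -> R) A, is_absolute_value v ->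
        (~~ A -> forall s t : algC, v (s + t) <= Num.max (v s) (v t)) ->
      forall g, (forall i j, v (G i j) <= g) ->
      forall i k, v (X i k) <= kap R A (72 * (L * L)) * (g * (g / v al))].
Proof.
move=> G0 fS S0 pP hP z0 Pz.
have [phi [ell [al [z [[phi0 phiP ellP phiE [alG [al0 small]]] zz Pz' lz]]]]] :=
  good_param_exists G0 pP z0 Pz.
have [S' [S'0 zS' mS']] := isotropic_extend fS S0 zz.
have isoS' (x : 'rV[algC]_L) : (x <= S')%MS -> bf x x = 0.
  by case/submxP => u ->; rewrite /bf trmx_mul -!mulmxA (mulmxA S') (mulmxA (S' *m G)) S'0 mul0mx mulmx0 mxE.
have [T fT TS'] : exists2 T : 'M[algC]_(m, L), row_free T & (T <= S')%MS.
  exists ((pid_mx m : 'M_(m, \rank S')) *m row_base S').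
    by rewrite /row_free mxrankMfree ?row_base_free // rank_pid_mx.
  by rewrite (submx_trans (submxMl _ _)) // eq_row_base.
have [K TK] := row_freeP fT; have [u Du] := submxP zS'.
have [w Dw] := submxP TS'.
have rowE a b (X : 'M[algC]_(a, b) -> 'M[algC]_(m, L)) i :
    (forall i k, polyfun (fun A => X A i k)) -> forall k, polyfun (fun A => row i (X A) 0 k).
  by move=> h k; apply: (eq_polyfun _ (h i k)) => A; rewrite mxE.
pose Phi1 (A : 'M[algC]_(m, L)) := \prod_i ell (row i (A *m S')).
pose Phi2 (A : 'M[algC]_(m, L)) := \det (A *m S' *m K).
have lin i k : polyfun (fun A : 'M[algC]_(m, L) => (A *m S') i k).
  by apply: polyfun_mulmx => j l; [exact: polyfun_entry|exact: polyfun_cst].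
have [A0] : exists A, Phi1 A * Phi2 A != 0.
  apply: (@polyfun_domain _ _ _ _ (\matrix_(i, j) u 0 j) w).
  - by apply: polyfun_prod => i; apply: ellP; apply: rowE.
  - apply: polyfun_det; apply: polyfun_mulmx => // j l; exact: polyfun_cst.
  - apply/prodf_neq0 => i _; rewrite row_mul.
    have -> : row i (\matrix_(i, j) u 0 j) = u.
      by apply/rowP => j; rewrite !mxE.
    by rewrite -Du.
  by rewrite /Phi2 -Dw TK det1 oner_eq0.
rewrite mulf_eq0 negb_or => /andP[/prodf_neq0 h1 h2]; pose Y0 := A0 *m S'.
have Y0iso i : phi (row i Y0) = ell (row i Y0) *: row i Y0.
  by apply/phiE/isoS'; rewrite /Y0 row_mul submxMl.
pose X (Y : 'M[algC]_(m, L)) : 'M[algC]_(m, L) := \matrix_(i, k) phi (row i Y) 0 k.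
have Xrow Y i : row i (X Y) = phi (row i Y) by apply/rowP => k; rewrite !mxE.
have Xpoly i k : polyfun (fun Y => X Y i k).
  apply: (@eq_polyfun _ _ (fun Y => phi (row i Y) 0 k)); first by move=> Y; rewrite mxE.
  by apply: phiP; apply: (rowE _ _ id) => j l; apply: polyfun_entry.
pose Psi1 Y := \prod_i P (row i (X Y)); pose Psi2 Y := \det (X Y *m K).
have pP1 : polyfun Psi1 by apply: polyfun_prod => i; apply: pP; apply: rowE.
have pP2 : polyfun Psi2.
  by apply: polyfun_det; apply: polyfun_mulmx => // j l; exact: polyfun_cst.
have [Y1 hY1] : exists Y, Psi1 Y * Psi2 Y != 0.
  apply: (@polyfun_domain _ _ _ _ (\matrix_(i, j) z 0 j) Y0) => //.
    apply/prodf_neq0 => i _; rewrite Xrow.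
    have -> : row i (\matrix_(i < m, j < L) z 0 j) = z by apply/rowP => j; rewrite !mxE.
    by rewrite phiE //; apply: hP.
  have -> : Psi2 Y0 = \prod_i ell (row i Y0) * \det (Y0 *m K).
    have -> : \prod_i ell (row i Y0) = \det (diag_mx (\row_i ell (row i Y0))).
      by rewrite det_diag; apply: eq_bigr => i _; rewrite mxE.
    rewrite -det_mulmx mulmxA; congr (\det (_ *m _)); apply/matrixP => i k.
    by rewrite mul_diag_mx !mxE Y0iso !mxE.
  by rewrite mulf_neq0 //; apply/prodf_neq0 => i _; apply: h1.
have [Y + uY] := polyfun_unity (polyfunM pP1 pP2) hY1.
rewrite mulf_eq0 negb_or => /andP[/prodf_neq0 hP1 hP2].
exists (X Y), al; split.
- apply/row_freeP; exists (K *m invmx (X Y *m K)).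
  by rewrite mulmxA mulmxV // unitmxE unitfE.
- by move=> i; rewrite Xrow.
- by move=> i; apply: hP1.
split=> //; split=> // R v A av ultra g Gg i k; rewrite mxE.
by apply: small => // l; rewrite mxE; apply: uY.
Qed.

End QuadraticForm.

(** * Echelon bases and maximal minors *)
Section Minors.
Variables (L N : nat) (B : 'M[algC]_(L, N)).

Definition subcol (g : 'I_L -> 'I_N) : 'M[algC]_L := \matrix_(i, k) B i (g k).

Definition increasing (t : L.-tuple 'I_N) := sorted ltn (map (@nat_of_ord N) t).

Lemma maximal_minorsE : maximal_minors B =
  [seq \det (subcol (tnth t)) | t <- enum {: L.-tuple 'I_N} & increasing t].
Proof.
by rewrite /maximal_minors; elim: (enum _).
Qed.

Lemma subcol_sort g : injective g -> exists (t : L.-tuple 'I_N) (s : 'S_L),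
  [/\ increasing t, forall k, g k = tnth t (s k) &
      \det (subcol g) = (-1) ^+ s * \det (subcol (tnth t))].
Proof.
move=> ginj; pose u := [tuple g k | k < L].
pose leN (i j : 'I_N) := (i <= j)%N.
pose t := sort_tuple leN u.
have put : perm_eq u t by rewrite perm_sym perm_sort.
have /tuple_permP[s Ds] := put.
have uu : uniq u by rewrite map_inj_uniq ?enum_uniq.
have gE k : g k = tnth t (s k).
  have := congr1 (fun r => nth (g k) r k) Ds.
  by rewrite -!tnth_nth !tnth_mktuple.
exists t, s; split=> //.
  rewrite /increasing ltn_sorted_uniq_leq map_inj_uniq; last exact: val_inj.
  rewrite sort_uniq uu /= sorted_map; apply: sort_sorted => i j; exact: leq_total.
have -> : subcol g = col_perm s (subcol (tnth t)).
  by apply/matrixP => i k; rewrite !mxE gE.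
by rewrite col_permE det_mulmx det_perm odd_permV mulrC.
Qed.

Lemma subcol_noninj g : ~ injective g -> \det (subcol g) = 0.
Proof.
move=> ng; have [a [b [ab gab]]] : exists a b, a != b /\ g a = g b.
  apply: contrapT => h; apply: ng => a b e; apply/eqP; apply: contraT => ab.
  by exfalso; apply: h; exists a, b.
rewrite -det_tr; apply: (determinant_alternate ab) => k.
by rewrite !mxE gab.
Qed.

Lemma subcol_minor g : \det (subcol g) != 0 ->
  exists2 m, m \in maximal_minors B & exists b : bool, \det (subcol g) = (-1) ^+ b * m.
Proof.
case: (pselect (injective g)) => [ginj _|/subcol_noninj ->]; last by rewrite eqxx.
have [t [s [it _ ->]]] := subcol_sort ginj.
exists (\det (subcol (tnth t))); last by exists s.
rewrite maximal_minorsE; apply/mapP; exists t => //.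
by rewrite mem_filter it mem_enum.
Qed.

Section Norm.
Variables (R : realType) (v : algC -> R).
Hypothesis av : is_absolute_value v.

Lemma euclnorm_ge (s : seq algC) a : a \in s -> v a <= euclnorm v s.
Proof.
move=> sa; rewrite -[leLHS](ger0_norm (abv_ge0 av a)) -sqrtr_sqr ler_sqrt; last first.
  by apply: sumr_ge0 => b _; rewrite exprn_ge0 ?abv_ge0.
by rewrite (big_rem _ sa) /= lerDl sumr_ge0 // => b _; rewrite exprn_ge0 ?abv_ge0.
Qed.

Lemma mixnorm_ge o (s : seq algC) a : a \in s -> v a <= mixnorm v o s.
Proof. by case: o => [p|] /=; [exact: supnorm_ge|exact: euclnorm_ge]. Qed.

Lemma mixnorm_ge0 o (s : seq algC) : 0 <= mixnorm v o s.
Proof. by case: o => [p|] /=; [exact: supnorm_ge0|exact: sqrtr_ge0]. Qed.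

Lemma abv_sign (b : bool) x : v ((-1) ^+ b * x) = v x.
Proof. by case: b; rewrite ?expr1 ?mulN1r ?abvN // expr0 mul1r. Qed.

Lemma subcol_bound o g : v (\det (subcol g)) <= mixnorm v o (maximal_minors B).
Proof.
have [->|/subcol_minor[m mB [b ->]]] := eqVneq (\det (subcol g)) 0.
  by rewrite abv0 // mixnorm_ge0.
by rewrite abv_sign mixnorm_ge.
Qed.

End Norm.

Lemma nonzero_subcol : row_free B -> exists g, \det (subcol g) != 0.
Proof.
move=> fB; have fullB : row_full B^T by rewrite /row_full mxrank_tr.
exists (fullrankfun fullB); have := fullrowsub_unit fullB.
rewrite unitmxE unitfE -det_tr; congr (\det _ != 0).
by apply/matrixP => i k; rewrite !mxE.
Qed.

Variable g0 : 'I_L -> 'I_N.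
Local Notation Delta := (\det (subcol g0)).
Hypothesis Delta0 : Delta != 0.

Definition echelon : 'M[algC]_(L, N) := invmx (subcol g0) *m B.

Let unit0 : subcol g0 \in unitmx. Proof. by rewrite unitmxE unitfE. Qed.

Definition replace a j := fun k => if k == a then j else g0 k.

(** Cramer's rule. *)
Lemma echelonE a j : echelon a j * Delta = \det (subcol (replace a j)).
Proof.
rewrite /echelon /invmx unit0 -scalemxAl mxE mulrC mulrA mulfV // mul1r mxE.
rewrite (expand_det_col _ a); apply: eq_bigr => i _.
rewrite !mxE /replace eqxx mulrC; congr (_ * _).
rewrite /cofactor; congr (_ * \det _); apply/matrixP => k l; rewrite !mxE.
by rewrite eq_sym (negPf (neq_lift a l)).
Qed.

Lemma echelon_bound (R : realType) (v : algC -> R) o a j : is_absolute_value v ->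
  v (echelon a j) <= mixnorm v o (maximal_minors B) / v Delta.
Proof.
move=> av; rewrite ler_pdivlMr ?abv_gt0 // -abvM // echelonE.
exact: subcol_bound.
Qed.

Definition supp a := [set j | echelon a j != 0].

Lemma replace_inj a j : j \in supp a -> injective (replace a j).
Proof.
rewrite inE => h; apply: contrapT => /subcol_noninj; rewrite -echelonE => /eqP.
by rewrite mulf_eq0 (negPf h) (negPf Delta0).
Qed.

(** Distinct nonzero entries of a row of the echelon matrix come from distinct
   minors, the column [g0 a] being replaced by distinct columns. *)
Lemma supp_euclnorm (R : realType) (v : algC -> R) a : is_absolute_value v ->
  \sum_(j in supp a) v (echelon a j * Delta) ^+ 2 <=
  \sum_(m <- maximal_minors B) v m ^+ 2.
Proof.
move=> av; rewrite maximal_minorsE big_map big_filter big_enum_cond /=.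
have ex j : exists t : L.-tuple 'I_N, j \in supp a ->
    [/\ increasing t, v (\det (subcol (tnth t))) = v (echelon a j * Delta) &
        t =i codom (replace a j)].
  case: (boolP (j \in supp a)) => [ja|_]; last by exists [tuple g0 k | k < L].
  have [t [s [it gt dt]]] := subcol_sort (replace_inj ja).
  exists t => _; split=> //; first by rewrite echelonE dt abv_sign.
  move=> x; apply/tnthP/codomP => [[k ->]|[k ->]]; last by exists (s k); rewrite gt.
  by exists (s^-1%g k); rewrite gt permKV.
pose T j := projT1 (cid (ex j)).
have TP j : j \in supp a -> [/\ increasing (T j),
    v (\det (subcol (tnth (T j)))) = v (echelon a j * Delta) &
    T j =i codom (replace a j)] by rewrite /T; case: cid.
have Tinj : {in supp a &, injective T}.
  move=> j j' ja ja' e; have [_ _ cj] := TP j ja; have [_ _ cj'] := TP j' ja'.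
  have : j \in codom (replace a j') by rewrite -cj' -e cj; apply/codomP; exists a; rewrite /replace eqxx.
  case/codomP => k; rewrite /replace; case: eqP => // /eqP ka jk.
  have := replace_inj ja; move/(_ a k); rewrite /replace eqxx (negPf ka) jk => /(_ erefl) ak.
  by rewrite ak eqxx in ka.
rewrite (eq_bigr (fun j => v (\det (subcol (tnth (T j)))) ^+ 2)) => [|j /TP[_ -> _]] //.
rewrite -(big_imset (fun t : L.-tuple 'I_N => v (\det (subcol (tnth t))) ^+ 2) Tinj) /=.
rewrite [leRHS](bigID (mem (T @: supp a))) /= ler_wpDr //.
  by apply: sumr_ge0 => t _; rewrite exprn_ge0 ?abv_ge0.
rewrite le_eqVlt; apply/orP; left; apply/eqP; apply: eq_bigl => t.
rewrite andb_idl // => /imsetP[j ja ->]; by case: (TP j ja).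
Qed.

End Minors.

(** * Height estimates *)
Section Global.
Variables (R : realType) (D : nat).
Implicit Types F : option nat -> 'I_D -> R.

(** Truncations of products over all places, which are eventually constant in the
   cases of interest. *)
Definition glob n F : R := \prod_(o <- rat_places n) \prod_i F o i.

Lemma globM n F F' : glob n (fun o i => F o i * F' o i) = glob n F * glob n F'.
Proof. by rewrite /glob -big_split; apply: eq_bigr => o _; rewrite big_split. Qed.

Lemma globX n F k : glob n (fun o i => F o i ^+ k) = glob n F ^+ k.
Proof.
by rewrite /glob -prodrXl; apply: eq_bigr => o _; rewrite -prodrXl.
Qed.

Lemma globV n F : glob n (fun o i => (F o i)^-1) = (glob n F)^-1.
Proof. by rewrite /glob -prodfV; apply: eq_bigr => o _; rewrite prodfV. Qed.

(** Constants are lost at the archimedean place only, once for each embedding. *)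
Lemma glob_kap n c : glob n (fun o _ => kap R (o == None) c) = c%:R ^+ D.
Proof.
rewrite /glob big_cons /= prodr_const card_ord big_map big1_seq ?mulr1 // => p _.
by rewrite big1.
Qed.

Lemma glob_le n F F' :
  (forall o i, rat_place o -> 0 <= F o i) -> (forall o i, rat_place o -> F o i <= F' o i) ->
  glob n F <= glob n F'.
Proof.
move=> F0 FF'; rewrite /glob big_seq [leRHS]big_seq; apply: ler_prod => o.
rewrite mem_rat_places => /andP[op _]; apply/andP; split.
  by apply: prodr_ge0 => i _; apply: F0.
by apply: ler_prod => i _; rewrite F0 //= FF'.
Qed.

End Global.

Section Heights.
Variable R : realType.

Lemma heightH_ge0 s : 0 <= heightH R s.
Proof. by rewrite /heightH; case: (num_field_exists s) => K [eps [s1 _ _]]; apply: powR_ge0. Qed.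

Lemma calH_ge0 s : 0 <= calH R s.
Proof. by rewrite /calH; case: (num_field_exists s) => K [eps [s1 _ _]]; apply: powR_ge0. Qed.

Lemma place_ultra o (nu : {rmorphism algC -> algC}) : rat_place o -> ~~ (o == None) ->
  forall s t : algC, (alg_abs R o \o nu) (s + t) <=
    Num.max ((alg_abs R o \o nu) s) ((alg_abs R o \o nu) t).
Proof. by case: o => [p|] //= p_pr _ s t; rewrite rmorphD alg_abs_max. Qed.

Lemma place_av o (nu : {rmorphism algC -> algC}) : rat_place o ->
  is_absolute_value (alg_abs R o \o nu).
Proof. by move=> op; apply/abv_comp/alg_abs_av. Qed.

Lemma field_of (s : seq algC) : exists (E : fieldExtType rat) (eps : {rmorphism E -> algC})
  (sys : conj_system eps), forall t, t \in s -> exists u, eps u = t.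
Proof.
have [E [eps [s1 Ds _]]] := num_field_exists s; have [sys] := conj_system_exists eps.
by exists E, eps, sys => t; rewrite -Ds => /mapP[u _ ->]; exists u.
Qed.

Lemma eq_from_pow (x y : R) d : (0 < d)%N -> 0 <= x -> 0 <= y -> x ^+ d = y ^+ d -> x = y.
Proof. by move=> d0 x0 y0 /eqP; rewrite eqrXn2 // => /eqP. Qed.

Lemma mem_has (s : seq algC) a : a \in s -> a != 0 -> has (fun a => a != 0) s.
Proof. by move=> sa a0; apply/hasP; exists a. Qed.

(** A single nonzero coordinate contributes 1, by the product formula. *)
Lemma heightH_ge1 s a : a \in s -> a != 0 -> 1 <= heightH R s.
Proof.
move=> sa a0; have [t ht] := heightH_formula R (mem_has sa a0).
have [E [eps [sys hE]]] := field_of [:: t; a].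
have [u Du] : exists u, eps u = a by apply: hE; rewrite !inE eqxx orbT.
have [|n1 h1] := ht E eps sys; first by apply: hE; rewrite inE eqxx.
have u0 : u != 0 by rewrite -(fmorph_eq0 eps) Du.
have [n2 h2] := product_formula R sys u0.
rewrite -(@expr_ge1 _ (\dim {:E})) ?heightH_ge0 ?d_gt0 //.
rewrite (h1 (maxn n1 n2)) ?leq_maxl // -[leLHS](h2 (maxn n1 n2)) ?leq_maxr // Du.
apply: (@glob_le R _ _ (fun o i => alg_abs R o (cj sys i a))
  (fun o i => supnorm (alg_abs R o \o cj sys i) s)) => o i op.
  exact: (abv_ge0 (place_av (cj sys i) op)).
exact: (@supnorm_ge _ _ (alg_abs R o \o cj sys i)).
Qed.

Lemma calH_ge1 s a : a \in s -> a != 0 -> 1 <= calH R s.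
Proof.
move=> sa a0; have [t ht] := calH_formula R (mem_has sa a0).
have [E [eps [sys hE]]] := field_of [:: t; a].
have [u Du] : exists u, eps u = a by apply: hE; rewrite !inE eqxx orbT.
have [|n1 h1] := ht E eps sys; first by apply: hE; rewrite inE eqxx.
have u0 : u != 0 by rewrite -(fmorph_eq0 eps) Du.
have [n2 h2] := product_formula R sys u0.
rewrite -(@expr_ge1 _ (\dim {:E})) ?calH_ge0 ?d_gt0 //.
rewrite (h1 (maxn n1 n2)) ?leq_maxl // -[leLHS](h2 (maxn n1 n2)) ?leq_maxr // Du.
apply: (@glob_le R _ _ (fun o i => alg_abs R o (cj sys i a))
  (fun o i => mixnorm (alg_abs R o \o cj sys i) o s)) => o i op.
  exact: (abv_ge0 (place_av (cj sys i) op)).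
exact: (mixnorm_ge (place_av (cj sys i) op)).
Qed.

(** A vector normalized to have a coordinate equal to 1 has the same projective
   and affine height, so that one ordering of such vectors serves for both. *)
Lemma heightH_cons1 s : 1 \in s -> heightH R (1 :: s) = heightH R s.
Proof.
move=> s1; have n0 := oner_neq0 algC.
have [t ht] := heightH_formula R (mem_has s1 n0).
have [t' ht'] := heightH_formula R (mem_has (mem_head 1 s) n0).
have [E [eps [sys hE]]] := field_of [:: t; t'].
have [|n1 h1] := ht E eps sys; first by apply: hE; rewrite inE eqxx.
have [|n2 h2] := ht' E eps sys; first by apply: hE; rewrite !inE eqxx orbT.
apply: (@eq_from_pow _ _ (\dim {:E})); rewrite ?heightH_ge0 ?d_gt0 //.
rewrite (h1 (maxn n1 n2)) ?leq_maxl // (h2 (maxn n1 n2)) ?leq_maxr //.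
apply: eq_bigr => o _; apply: eq_bigr => i _; rewrite /supnorm big_cons.
by apply/max_idPr; apply: supnorm_ge.
Qed.

Section Echelon.
Variables (L N : nat) (B : 'M[algC]_(L, N)) (g0 : 'I_L -> 'I_N).
Local Notation Delta := (\det (subcol B g0)).
Hypothesis Delta0 : Delta != 0.
Local Notation C := (echelon B g0).
Local Notation P := (calH R (maximal_minors B)).

Let minor0 : exists2 a, a \in maximal_minors B & a != 0.
Proof.
have [m mB [b Dm]] := subcol_minor Delta0; exists m => //.
by apply: contraNneq Delta0 => m0; rewrite Dm m0 mulr0.
Qed.

(** The arithmetic-geometric mean inequality at the archimedean places, where
   the height is defined by the Euclidean norm, bounds the number of nonzero
   entries in a row by the square of the height. *)
Lemma support_bound a : (#|supp B g0 a|)%:R <= P ^+ 2.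
Proof.
set S := supp B g0 a; have [S0|S0] := posnP #|S|.
  by rewrite S0 exprn_ge0 // calH_ge0.
have [m0 mB m00] := minor0; have [t ht] := calH_formula R (mem_has mB m00).
pose c j := C a j * Delta.
have c0 j : j \in S -> c j != 0 by rewrite inE => h; rewrite mulf_neq0.
have [E [eps [sys hE]]] := field_of (t :: [seq c j | j <- enum S]).
have [|n1 h1] := ht E eps sys; first by apply: hE; rewrite inE eqxx.
have [n2 h2] : exists n2, forall n, (n2 <= n)%N -> forall j, j \in enum S ->
    glob n (fun o i => alg_abs R o (cj sys i (c j))) = 1.
  apply: list_eventually => j; rewrite mem_enum => jS.
  have [u Du] : exists u, eps u = c j.
    by apply: hE; rewrite inE; apply/orP; right; apply: map_f; rewrite mem_enum.
  have u0 : u != 0 by rewrite -(fmorph_eq0 eps) Du c0.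
  have [n2 h2] := product_formula R sys u0; exists n2 => n /h2.
  by rewrite Du.
pose n := maxn n1 n2; have {}h1 := h1 n (leq_maxl _ _); have {}h2 := h2 n (leq_maxr _ _).
pose s := #|S|; pose D := \dim {:E}; have D0 : (0 < D)%N := d_gt0 E.
have sR : (0 : R) < s%:R by rewrite ltr0n.
rewrite -(@ler_pXn2r _ (s * D)) ?muln_gt0 ?S0 ?D0 ?nnegrE ?ler0n ?exprn_ge0 ?calH_ge0 //.
rewrite [leRHS]exprAC mulnC exprM [X in _ <= X ^+ 2]exprM h1.
have loc o i : rat_place o -> kap R (o == None) s ^+ s *
   \prod_(j in S) (alg_abs R o (cj sys i (c j))) ^+ 2 <=
   (mixnorm (alg_abs R o \o cj sys i) o (maximal_minors B) ^+ s) ^+ 2.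
  move=> op; have av := place_av (cj sys i) op; rewrite exprAC.
  case: o op av => [p|] op av.
    rewrite /kap /= expr1n mul1r -[s]/(#|S|) -prodr_const.
    apply: ler_prod => j jS; rewrite exprn_ge0 ?(abv_ge0 av) //= lerXn2r ?nnegrE ?supnorm_ge0 ?(abv_ge0 av) //.
    by have := subcol_bound B av (Some p) (replace g0 a j); rewrite -echelonE.
  rewrite /kap /= /euclnorm sqr_sqrtr; last first.
    by apply: sumr_ge0 => b _; rewrite exprn_ge0 ?(abv_ge0 av).
  have := supp_euclnorm Delta0 a av; set X := \sum_(j in _) _; set Y := \sum_(m <- _) _ => XY.
  have X0 : 0 <= X by apply: sumr_ge0 => j _; rewrite exprn_ge0 ?(abv_ge0 av).
  apply: le_trans (_ : X ^+ s <= _); last by rewrite lerXn2r ?nnegrE // (le_trans X0).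
  have := @leif_AGM _ _ (mem S) (fun j => alg_abs R None (cj sys i (c j)) ^+ 2).
  move=> /(_ (fun j _ => exprn_ge0 _ (abv_ge0 av (c j))))[+ _] => /=.
  by rewrite -/s expr_div_n ler_pdivlMr ?exprn_gt0 // mulrC.
have := @glob_le R D n _ _ _ loc; rewrite globM !globX glob_kap -/D.
have -> : glob n (fun o i => \prod_(j in S) alg_abs R o (cj sys i (c j)) ^+ 2) = 1.
  rewrite /glob; under eq_bigr do rewrite exchange_big; rewrite exchange_big.
  rewrite big1 // => j jS.
  transitivity (glob n (fun o i => alg_abs R o (cj sys i (c j))) ^+ 2).
    by rewrite -globX.
  by rewrite h2 ?mem_enum // expr1n.
rewrite mulr1 -/(glob n _); apply => o i op.
have av := place_av (cj sys i) op.
rewrite mulr_ge0 ?exprn_ge0 ?kap_ge0 //; apply: prodr_ge0 => j _.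
by rewrite exprn_ge0 // (abv_ge0 av).
Qed.

Variable f : 'M[algC]_N.
Local Notation G := (C *m f *m C^T).
Local Notation entries := [seq f i j | i <- enum 'I_N, j <- enum 'I_N].
Local Notation n := (\max_a #|supp B g0 a|)%N.

Section Local.
Variables (o : option nat) (v : algC -> R).
Hypothesis av : is_absolute_value v.
Hypothesis ultra : ~~ (o == None) -> forall s t : algC, v (s + t) <= Num.max (v s) (v t).
Local Notation kap := (kap R (o == None)).
Let A := mixnorm v o (maximal_minors B) / v Delta.
Let F := supnorm v entries.

Let A0 : 0 <= A.
Proof. by rewrite divr_ge0 ?abv_ge0 ?mixnorm_ge0. Qed.

(** Only the nonzero entries of the rows of [C] contribute, so that the number of
   variables does not enter. *)
Lemma form_bound a b : v (G a b) <= kap (n * n) * (F * (A * A)).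
Proof.
have F0 : 0 <= F by apply: supnorm_ge0.
have CA a' j : v (C a' j) <= A by apply: echelon_bound.
have Ff i j : v (f i j) <= F.
  by apply: supnorm_ge; apply/allpairsP; exists (i, j); rewrite !mem_enum.
have sub (a' : 'I_L) (E : 'I_N -> algC) X : 0 <= X ->
    (forall j, v (E j) <= X) -> (forall j, j \notin supp B g0 a' -> E j = 0) ->
    v (\sum_j E j) <= kap n * X.
  move=> X0 EX E0; rewrite (bigID (mem (supp B g0 a'))) /= [X in _ + X]big1 // addr0.
  apply: le_trans (@kap_sum _ _ _ _ av ultra _ (index_enum 'I_N) (mem (supp B g0 a')) _ _ X0
    (fun j _ => EX j)) _.
  rewrite -sum1_count sum1_card ler_wpM2r // kap_le //.
  exact: (leq_bigmax a').
rewrite mxE kapM -mulrA; apply: (sub b).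
- apply: mulr_ge0; first exact: kap_ge0.
  by apply: mulr_ge0 => //; apply: mulr_ge0.
- move=> j; rewrite abvM // [C^T j b]mxE mulrA mulrA ler_pM ?abv_ge0 //.
  rewrite mxE -mulrA; apply: (sub a).
  + exact: mulr_ge0.
  + by move=> i; rewrite abvM // mulrC ler_pM ?abv_ge0.
  by move=> i; rewrite inE negbK => /eqP ->; rewrite mul0r.
by move=> j; rewrite inE negbK => /eqP h; rewrite [C^T j b]mxE h mulr0.
Qed.

Lemma image_bound (x : 'rV[algC]_L) X j : 0 <= X -> (forall k, v (x 0 k) <= X) ->
  v ((x *m C) 0 j) <= kap L * (X * A).
Proof.
move=> X0 hX; rewrite mxE; apply: (kap_sum_ord av ultra) => [|k]; first exact: mulr_ge0.
by rewrite abvM // ler_pM ?abv_ge0 // echelon_bound.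
Qed.

End Local.

(** In the product of the local estimates the constants [al], [Delta] and the
   coordinate used for the normalization disappear by the product formula. *)
Lemma point_height (x : 'rV[algC]_L) al j0 : f != 0 ->
  (forall (v : algC -> R) A, is_absolute_value v ->
     (~~ A -> forall s t : algC, v (s + t) <= Num.max (v s) (v t)) ->
     forall g, (forall i j, v (G i j) <= g) ->
     forall k, v (x 0 k) <= kap R A (72 * (L * L)) * (g * (g / v al))) ->
  al != 0 -> (x *m C) 0 j0 != 0 ->
  vech R (((x *m C) 0 j0)^-1 *: (x *m C)) <=
    (72 * (L * L) * L)%:R * mxH R f ^+ 2 * P ^+ 13.
Proof.
move=> f0 hx al0 xj0; set y := x *m C in xj0 *; set z := _ *: y.
have /matrix0Pn[i1 [j1 fij]] := f0.
have fin : f i1 j1 \in entries by apply/allpairsP; exists (i1, j1); rewrite !mem_enum.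
have [m0 mB m00] := minor0.
have [t1 ht1] := heightH_formula R (mem_has (mem_head 1 (coords z)) (oner_neq0 _)).
have [t2 ht2] := heightH_formula R (mem_has fin fij).
have [t3 ht3] := calH_formula R (mem_has mB m00).
have [E [eps [sys hE]]] := field_of [:: t1; t2; t3; al; Delta; y 0 j0].
have [|n1 h1] := ht1 E eps sys; first by apply: hE; rewrite !inE eqxx ?orbT.
have [|n2 h2] := ht2 E eps sys; first by apply: hE; rewrite !inE eqxx ?orbT.
have [|n3 h3] := ht3 E eps sys; first by apply: hE; rewrite !inE eqxx ?orbT.
have pf w : w \in [:: t1; t2; t3; al; Delta; y 0 j0] -> w != 0 ->
    exists n0, forall n, (n0 <= n)%N -> glob n (fun o i => alg_abs R o (cj sys i w)) = 1.
  move=> /hE[u Du] w0; have u0 : u != 0 by rewrite -(fmorph_eq0 eps) Du.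
  by have [n0 h] := product_formula R sys u0; exists n0 => m /h; rewrite Du.
have [|n4 h4] := pf al _ al0; first by rewrite !inE eqxx ?orbT.
have [|n5 h5] := pf Delta _ Delta0; first by rewrite !inE eqxx ?orbT.
have [|n6 h6] := pf (y 0 j0) _ xj0; first by rewrite !inE eqxx ?orbT.
pose q := (n1 + n2 + n3 + n4 + n5 + n6)%N.
have {}h1 := h1 q ltac:(by rewrite /q; lia); have {}h2 := h2 q ltac:(by rewrite /q; lia).
have {}h3 := h3 q ltac:(by rewrite /q; lia); have {}h4 := h4 q ltac:(by rewrite /q; lia).
have {}h5 := h5 q ltac:(by rewrite /q; lia); have {}h6 := h6 q ltac:(by rewrite /q; lia).
pose D := \dim {:E}; have D0 : (0 < D)%N := d_gt0 E.
pose c := (L * (72 * (L * L)) * ((n * n) * (n * n)))%N.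
pose v o i : algC -> R := alg_abs R o \o cj sys i.
pose A o i := mixnorm (v o i) o (maximal_minors B); pose F o i := supnorm (v o i) entries.
have loc o (i : 'I_D) : rat_place o -> supnorm (v o i) (1 :: coords z) <=
   kap R (o == None) c * (F o i ^+ 2 * (A o i ^+ 5 * ((v o i Delta ^+ 5)^-1 * ((v o i al)^-1 * (v o i (y 0 j0))^-1)))).
  move=> op; have av : is_absolute_value (v o i) by apply: place_av.
  have ultra := place_ultra (cj sys i) op.
  have va : 0 < v o i al by rewrite abv_gt0.
  have vD : 0 < v o i Delta by rewrite abv_gt0.
  have vy : 0 < v o i (y 0 j0) by rewrite abv_gt0.
  have A0 : 0 <= A o i by apply: mixnorm_ge0.
  have F0 : 0 <= F o i by apply: supnorm_ge0.
  pose g := kap R (o == None) (n * n) * (F o i * (A o i / v o i Delta * (A o i / v o i Delta))).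
  have AD0 : 0 <= A o i / v o i Delta by rewrite divr_ge0 // ltW.
  have gge0 : 0 <= g.
    by apply: mulr_ge0; [apply: kap_ge0|apply: mulr_ge0 => //; apply: mulr_ge0].
  have hG a b : v o i (G a b) <= g by apply: form_bound.
  have hxk := hx (v o i) (o == None) av ultra g hG.
  set X := _ * _ in hxk.
  have X0 : 0 <= X.
    by apply: mulr_ge0; [apply: kap_ge0|apply: mulr_ge0 => //; apply: divr_ge0; rewrite // ltW].
  have yb j : v o i (y 0 j) <= kap R (o == None) L * (X * (A o i / v o i Delta)).
    exact: image_bound.
  set W := (X in _ <= X).
  have DW : W = kap R (o == None) L * (X * (A o i / v o i Delta)) / v o i (y 0 j0).
    rewrite /W /X /g /c !kapM; field; by rewrite !gt_eqF.
  have zb j : v o i (y 0 j) / v o i (y 0 j0) <= W.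
    by rewrite DW ler_wpM2r // invr_ge0 ltW.
  apply/supnorm_leP.
    by rewrite (le_trans _ (zb j0)) // divr_ge0 // ltW.
  move=> s; rewrite inE => /predU1P[->|/mapP[j _ ->]].
    by rewrite abv1 // (le_trans _ (zb j0)) // divff ?gt_eqF.
  by rewrite mxE abvM // abvV // mulrC.
have : vech R z ^+ D <= (c%:R * mxH R f ^+ 2 * P ^+ 5) ^+ D.
  rewrite /vech h1; apply: le_trans (glob_le _ _ loc) _.
    by move=> o i op; apply: supnorm_ge0.
  rewrite !globM !globV globX glob_kap.
  rewrite [glob q (fun o i => v o i al)]h4 [glob q (fun o i => v o i Delta)]h5.
  rewrite [glob q (fun o i => v o i (y 0 j0))]h6 expr1n !invr1 !mulr1.
  rewrite -[glob q F]h2 -[glob q A]h3 -!exprMn le_eqVlt; apply/orP; left; apply/eqP.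
  by congr (_ ^+ _); rewrite -[heightH R _]/(mxH R f); ring.
rewrite ler_pXn2r ?nnegrE //; last 2 first.
- exact: heightH_ge0.
- by rewrite !mulr_ge0 ?ler0n ?exprn_ge0 ?heightH_ge0 ?calH_ge0.
move/le_trans; apply.
have nP : n%:R <= P ^+ 2.
  have [L0|L0] := posnP L; last first.
    have cL : (0 < #|'I_L|)%N by rewrite card_ord.
    by have [a ->] := bigop.eq_bigmax (fun a : 'I_L => #|supp B g0 a|) cL; apply: support_bound.
  rewrite big1 ?exprn_ge0 ?calH_ge0 // => a _; by have := ltn_ord a; rewrite [X in (_ < X)%N]L0.
have P0 : 0 <= P by apply: calH_ge0.
have n0 : 0 <= n%:R :> R by apply: ler0n.
(* The numbers of nonzero entries account for eight of the thirteen factors. *)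
have nP4 : ((n * n) * (n * n))%:R <= P ^+ 8 :> R.
  rewrite !natrM (_ : P ^+ 8 = (P ^+ 2 * P ^+ 2) * (P ^+ 2 * P ^+ 2)); last by rewrite -!exprD.
  by rewrite !ler_pM // mulr_ge0.
rewrite /c natrM; set u : R := (L * _)%:R.
have -> : (72 * (L * L) * L)%:R = u by rewrite /u mulnC.
have u0 : 0 <= u by apply: ler0n.
have H0 : 0 <= mxH R f by apply: heightH_ge0.
have -> : P ^+ 13 = P ^+ 8 * P ^+ 5 by rewrite -exprD.
rewrite [leRHS]mulrA ler_wpM2r ?exprn_ge0 //.
by rewrite [leRHS]mulrAC ler_wpM2r ?exprn_ge0 // ler_wpM2l.
Qed.

End Echelon.
End Heights.

(** * Small zeros outside an algebraic set *)
Lemma bformE N (f : 'M[algC]_N) x y : bform f x y = bf f x y.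
Proof.
rewrite bfE /bform exchange_big; apply: eq_bigr => j _ /=.
by rewrite mulr_suml; apply: eq_bigr => i _; rewrite [x 0 i * _]mulrC.
Qed.

Lemma meval_homog N d (P : {mpoly algC[N]}) c (x : 'rV[algC]_N) :
  P \is ishomog1 d mdeg ->
  meval (fun l => (c *: x) 0 l) P = c ^+ d * meval (fun l => x 0 l) P.
Proof.
move=> /dhomogP hP; rewrite !mevalE mulr_sumr big_seq [RHS]big_seq.
apply: eq_bigr => m mP; rewrite mulrCA; congr (_ * _).
have <- : mdeg m = d := hP m mP; rewrite mdegE expr_sum -big_split; apply: eq_bigr => i _ /=.
by rewrite mxE exprMn.
Qed.

Section Subspace.
Variables (N : nat) (V : {vspace 'rV[algC]_N}).

Lemma row_basis_mx i : row i (basis_mx V) = tnth (vbasis V) i.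
Proof. by apply/rowP => j; rewrite !mxE. Qed.

Lemma mem_basis_mx x : reflect (exists y, x = y *m basis_mx V) (x \in V).
Proof.
apply: (iffP idP) => [xV|[y ->]].
  exists (\row_i coord (vbasis V) i x); rewrite mulmx_sum_row {1}(coord_vbasis xV).
  by apply: eq_bigr => i _; rewrite mxE row_basis_mx (tnth_nth 0).
rewrite mulmx_sum_row; apply: memv_suml => i _; apply: memvZ.
by rewrite row_basis_mx vbasis_mem // mem_tnth.
Qed.

Lemma basis_mx_free : row_free (basis_mx V).
Proof.
apply: inj_row_free => y; rewrite mulmx_sum_row => y0; apply/rowP => i; rewrite [RHS]mxE.
have /freeP := basis_free (vbasisP V); apply.
by rewrite -[RHS]y0; apply: eq_bigr => j _; rewrite row_basis_mx (tnth_nth 0).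
Qed.

End Subspace.

Lemma free_rows N m (X : 'M[algC]_(m, N)) : row_free X -> free [tuple row i X | i < m].
Proof.
move=> fX; apply/freeP => k k0 i; have [Y XY] := row_freeP fX.
have : (\row_i k i) *m X = 0.
  rewrite mulmx_sum_row -[RHS]k0; apply: eq_bigr => j _.
  by rewrite mxE -tnth_nth tnth_mktuple.
move/(congr1 (mulmx^~ Y)); rewrite -mulmxA XY mulmx1 mul0mx => /rowP/(_ i).
by rewrite !mxE.
Qed.

(** The exponent of 3 is at least 4, and [3 ^ 4] exceeds 72. *)
Lemma boundT_ge (R : realType) (r L M : nat) (H P : R) : (1 <= r)%N -> (r <= L)%N ->
  1 <= H -> 1 <= P ->
  (72 * (L * L) * L)%:R * H ^+ 2 * P ^+ 13 <=
  boundT R (L - r) L M * H `^ Num.max r%:R (29 / 2) * P ^+ 30.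
Proof.
move=> r1 rL H1 P1; have L1 : (1 <= L)%N by apply: leq_trans rL.
have H0 : 0 <= H := le_trans ler01 H1; have P0 : 0 <= P := le_trans ler01 P1.
have LR : 1 <= L%:R :> R by rewrite ler1n.
have h3 : 72 * L%:R ^+ 3 <= boundT R (L - r) L M.
  rewrite /boundT natrB // (_ : L%:R - (L%:R - r%:R) = r%:R); last by ring.
  set E := (X in 3 `^ X); have E4 : 4 <= E.
    have rR : 1 <= r%:R :> R by rewrite ler1n.
    have a0 : 0 <= 18 * L%:R * (L%:R - 1) / r%:R :> R.
      by rewrite !mulr_ge0 ?invr_ge0 ?ler0n ?subr_ge0.
    have b0 : 0 <= 33 * L%:R * (L%:R - 1) / 4 :> R.
      by rewrite !mulr_ge0 ?invr_ge0 ?ler0n ?subr_ge0.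
    by rewrite /E; move: rR a0 b0; lra.
  apply: ler_pM; rewrite ?exprn_ge0 ?ler0n //; last by rewrite ler_weXn2l.
  have : (3 : R) `^ 4%:R <= 3 `^ E by apply: ler_powR => //; rewrite ler1n.
  by apply: le_trans; rewrite powR_mulrn ?ler0n // -natrX ler_nat.
have hH : H ^+ 2 <= H `^ Num.max r%:R (29 / 2).
  rewrite -powR_mulrn // ler_powR // le_max; apply/orP; right; lra.
have hP : P ^+ 13 <= P ^+ 30 by rewrite ler_weXn2l.
have -> : (72 * (L * L) * L)%:R = 72 * L%:R ^+ 3 :> R by rewrite !natrM; ring.
have c0 : 0 <= 72 * L%:R ^+ 3 :> R by rewrite mulr_ge0 ?exprn_ge0 ?ler0n.
by apply: ler_pM (ler_pM _ _ h3 hH) hP; rewrite ?mulr_ge0 ?exprn_ge0.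
Qed.

Theorem theorem1p1 (R : realType) (N L r lam m : nat)
    (f : 'M[algC]_N) (f_sym : f^T = f)
    (V : {vspace 'rV[algC]_N}) (dimV : \dim V = L)
    (rankV : form_rank f V = r) (r_ge1 : (1 <= r)%N)
    (lamE : lam = (L - r)%N)
    (W : {vspace 'rV[algC]_N}) (maxW : maximal_totally_isotropic f V W)
    (dimW : \dim W = m)
    (J : nat) (J_ge1 : (1 <= J)%N)
    (k : 'I_J -> nat) (k_ge1 : forall i, (1 <= k i)%N)
    (P : forall i : 'I_J, 'I_(k i) -> {mpoly algC[N]})
    (deg : forall i : 'I_J, 'I_(k i) -> nat)
    (deg_ge1 : forall i j, (1 <= deg i j)%N)
    (P_homog : forall i j, P i j \is ishomog1 (deg i j) mdeg)
    (M : nat) (ME : M = (\sum_(i < J) \max_(j < k i) deg i j)%N)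
    (has_zero : exists x : 'rV[algC]_N,
       [/\ x \in V, x <> 0, qform f x = 0 & ~ union_of_zero_sets P x]) :
  exists x : m.-tuple 'rV[algC]_N,
    [/\ free x,
        forall n : 'I_m,
          [/\ tnth x n \in V, qform f (tnth x n) = 0
            & ~ union_of_zero_sets P (tnth x n)],
        forall n1 n2 : 'I_m, (n1 <= n2)%N ->
          vecH R (tnth x n1) <= vecH R (tnth x n2),
        forall n1 n2 : 'I_m, (n1 <= n2)%N ->
          vech R (tnth x n1) <= vech R (tnth x n2)
      & forall n : 'I_m,
          vecH R (tnth x n) <= vech R (tnth x n) /\
          vech R (tnth x n) <=
            boundT R lam L M.+1 * mxH R f `^ Num.max r%:R (29 / 2)
              * spaceH R V ^+ 30].
Proof.
subst L m lam.
pose B := basis_mx V; have [g0 Delta0] := nonzero_subcol (basis_mx_free V).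
pose C := echelon B g0; pose G := C *m f *m C^T.
have U0 : subcol B g0 \in unitmx by rewrite unitmxE unitfE.
have BC : B = subcol B g0 *m C by rewrite /C /echelon mulKVmx.
have inV (y : 'rV[algC]_(\dim V)) : y *m C \in V.
  by apply/mem_basis_mx; exists (y *m invmx (subcol B g0)); rewrite -mulmxA.
have ofV x : x \in V -> exists y, x = y *m C.
  by move/mem_basis_mx => [y ->]; exists (y *m subcol B g0); rewrite -mulmxA -BC.
have freeC : row_free C.
  by rewrite /C /echelon /row_free mxrankMfree ?basis_mx_free // mxrank_unit ?unitmx_inv.
have symG : G^T = G.
  by rewrite /G; move: (C) => A; rewrite !trmx_mul trmxK f_sym mulmxA.
have GE y z : bform f (y *m C) (z *m C) = bf G y z.
  by rewrite bformE /bf /G; move: (C) => A; rewrite trmx_mul !mulmxA.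
have G0 : G != 0.
  apply: contraTneq r_ge1 => G0; rewrite -rankV -ltnNge ltnS leqn0 subn_eq0.
  apply/dimvS/subvP => x xV; apply/mem_radical; split=> // y yV.
  have [x' ->] := ofV x xV; have [y' ->] := ofV y yV.
  by rewrite GE /bf G0 mulmx0 mul0mx mxE.
have f0 : f != 0.
  by apply: contraNneq G0 => f0; rewrite /G f0 mulmx0 mul0mx.
case: has_zero => x0 [x0V _ x0f x0Z].
have [zeta Dz] := ofV x0 x0V; subst x0.
(* For each of the zero sets some polynomial does not vanish at the given zero;
   the product of these polynomials takes care of the union. *)
have exj i : exists j, meval (fun l => (zeta *m C) 0 l) (P i j) != 0.
  apply: contrapT => h; apply: x0Z; exists i => j; apply/eqP; apply: contraT => hj.
  by exfalso; apply: h; exists j.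
pose jj i := sval (cid (exj i)).
have hjj i : meval (fun l => (zeta *m C) 0 l) (P i (jj i)) != 0 by exact: svalP (cid (exj i)).
pose Q (y : 'rV[algC]_(\dim V)) := \prod_i meval (fun l => (y *m C) 0 l) (P i (jj i)).
have Qpoly : polymap Q.
  move=> a b X hX; apply: polyfun_prod => i; apply: polyfun_meval => l.
  apply: polyfun_mulmx => [i' j|i' j]; last exact: polyfun_cst.
  by rewrite ord1; apply: hX.
have Qscale c y : c != 0 -> Q y != 0 -> Q (c *: y) != 0.
  move=> c0 /prodf_neq0 Qy; apply/prodf_neq0 => i _.
  by rewrite -scalemxAl (meval_homog _ _ (P_homog i (jj i))) mulf_neq0 ?expf_neq0 ?Qy.
have Qout y : Q y != 0 -> ~ union_of_zero_sets P (y *m C).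
  by move=> /prodf_neq0 Qy [i hi]; have := Qy i isT; rewrite hi eqxx.
have [WV Wiso _] := maxW.
have exS : exists S : 'M[algC]_(\dim W, \dim V), basis_mx W = S *m C.
  have row_in i : exists y, row i (basis_mx W) = y *m C.
    by apply: ofV; rewrite row_basis_mx (subvP WV) // vbasis_mem // mem_tnth.
  exists (\matrix_i sval (cid (row_in i))); apply/row_matrixP => i.
  by rewrite row_mul [X in _ = X *m _]rowK; exact: svalP (cid (row_in i)).
have [S DS] := exS.
have freeS : row_free S.
  have := basis_mx_free W; rewrite DS /row_free mxrankMfree //.
have S0 : S *m G *m S^T = 0.
  apply/matrixP => i j; rewrite [RHS]mxE.
  have inW l : row l (basis_mx W) \in W by rewrite row_basis_mx vbasis_mem // mem_tnth.
  have := Wiso _ _ (inW i) (inW j); rewrite DS !row_mul GE /bf.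
  rewrite -row_mul => <-; move: (S *m G) => A.
  by rewrite !mxE; apply: eq_bigr => l _; rewrite !mxE.
have zz : bf G zeta zeta = 0 by rewrite -GE.
have Qz : Q zeta != 0 by apply/prodf_neq0 => i _; apply: hjj.
have [X [al [freeX Xiso QX [_ [al0 small]]]]] :=
  small_isotropic_points symG G0 freeS S0 Qpoly Qscale zz Qz.
have XC0 i : row i X *m C != 0.
  rewrite mulmx_free_eq0 //; apply/eqP => ri; have [Y XY] := row_freeP freeX.
  have := congr1 (fun A : 'M_(\dim W) => row i A 0 i) XY; rewrite row_mul ri mul0mx !mxE eqxx.
  by move/eqP; rewrite eq_sym oner_eq0.
have exj0 i := rV0Pn _ (XC0 i).
pose j0 i := sval (cid (exj0 i)).
have hj0 i : (row i X *m C) 0 (j0 i) != 0 by exact: svalP (cid (exj0 i)).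
(* With a coordinate normalized to 1 the two heights of a point agree. *)
pose sc i := ((row i X *m C) 0 (j0 i))^-1.
have sc0 i : sc i != 0 by rewrite invr_eq0.
pose pt i := sc i *: (row i X *m C).
pose xs := [tuple pt i | i < \dim W].
have free_xs : free xs.
  pose D := diag_mx (\row_i sc i) *m X *m C.
  have -> : xs = [tuple row i D | i < \dim W].
    by apply: eq_mktuple => i; rewrite /pt /D !row_mul row_diag_mx mxE -!scalemxAl -rowE.
  apply: free_rows; rewrite /row_free mxrankMfree // mxrankMfree //.
  rewrite mxrank_unit // unitmxE unitfE det_diag; apply/prodf_neq0 => i _.
  by rewrite mxE.
have ptP i : [/\ pt i \in V, qform f (pt i) = 0, ~ union_of_zero_sets P (pt i),
    vecH R (pt i) = vech R (pt i) &
    vech R (pt i) <= boundT R (\dim V - r) (\dim V) M.+1 *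
      mxH R f `^ Num.max r%:R (29 / 2) * spaceH R V ^+ 30].
  have ptE : pt i = (sc i *: row i X) *m C by rewrite /pt scalemxAl.
  split.
  - by rewrite ptE inV.
  - by rewrite ptE /qform GE bfZl bfZr Xiso !mulr0.
  - by rewrite ptE; apply/Qout/Qscale.
  - rewrite /vecH /vech heightH_cons1 //; apply/mapP; exists (j0 i); rewrite ?mem_enum //.
    by rewrite /pt mxE mulVf.
  have hx (v : algC -> R) A : is_absolute_value v ->
      (~~ A -> forall s t : algC, v (s + t) <= Num.max (v s) (v t)) ->
      forall g, (forall i j, v (G i j) <= g) -> forall l,
      v ((row i X) 0 l) <= kap R A (72 * (\dim V * \dim V)) * (g * (g / v al)).
    by move=> av ultra g Gg l; rewrite mxE; apply: small.
  apply: le_trans (point_height Delta0 f0 hx al0 (hj0 i)) _.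
  apply: boundT_ge => //.
  - by rewrite -rankV leq_subr.
  - have /matrix0Pn[i1 [j1 fij]] := f0.
    apply: heightH_ge1 fij; apply/allpairsP; exists (i1, j1).
    by rewrite !mem_enum.
  have [mm mB [b Db]] := subcol_minor Delta0; apply: calH_ge1 mB _.
  by apply: contraNneq Delta0 => m0; rewrite Db m0 mulr0.
(* A single sort is enough, because the two heights agree on these points. *)
pose leh (x y : 'rV[algC]_N) := vech R x <= vech R y.
pose ys := sort_tuple leh xs.
have ysP n : exists i, tnth ys n = pt i.
  have : tnth ys n \in xs by rewrite -(mem_sort leh) mem_tnth.
  by case/tnthP => i ->; exists i; rewrite tnth_mktuple.
have mono (n1 n2 : 'I_(\dim W)) : (n1 <= n2)%N -> vech R (tnth ys n1) <= vech R (tnth ys n2).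
  move=> n12; rewrite !(tnth_nth 0).
  have : sorted leh ys by apply: sort_sorted => x y; exact: le_total.
  move/(sorted_leq_nth (fun y x z => @le_trans _ _ (vech R y) (vech R x) (vech R z)) (fun x => lexx _)).
  by move/(_ 0); apply; rewrite ?inE ?size_tuple.
exists ys; split=> //.
- by rewrite (perm_free (_ : perm_eq ys xs)) // perm_sort.
- by move=> n; have [i ->] := ysP n; case: (ptP i).
- move=> n1 n2 /mono; have [i1 ->] := ysP n1; have [i2 ->] := ysP n2.
  by case: (ptP i1) => _ _ _ -> _; case: (ptP i2) => _ _ _ -> _.
by move=> n; have [i ->] := ysP n; case: (ptP i) => _ _ _ -> ->.
Qed.
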